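(* Let $Q(CG,3)$ be the quiver with mutable vertices $1,\dots,6$ and frozen vertices $z_1,z_2,z_3$ described in the context, let $\mathbb{P}=\mathrm{Trop}(z_1,z_2,z_3)$, $\mathbb{Z}\mathbb{P}=\mathbb{Z}[z_1^{\pm1},z_2^{\pm1},z_3^{\pm1}]$ and $\mathbb{Z}\mathbb{P}_+=\mathbb{Z}[z_1,z_2,z_3]$. For $\mathbb{A}\in\{\mathbb{Z}\mathbb{P},\mathbb{Z}\mathbb{P}_+\}$ let $\mathcal{A}_{\mathbb{A}}(CG,3)$ and $\mathcal{U}_{\mathbb{A}}(CG,3)$ be the cluster algebra and upper cluster algebra over $\mathbb{A}$ defined by $Q(CG,3)$. Then $\mathcal{A}_{\mathbb{Z}\mathbb{P}}(CG,3)=\mathcal{U}_{\mathbb{Z}\mathbb{P}}(CG,3)$, but $\mathcal{A}_{\mathbb{Z}\mathbb{P}_+}(CG,3)\subsetneq\mathcal{U}_{\mathbb{Z}\mathbb{P}_+}(CG,3)$ is a strict containment.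
   Context: The quiver $Q(CG,3)$ (defining the Cremmer–Gervais cluster structure on $3\times 3$ matrices) has mutable vertices $1,2,3,4,5,6$, frozen vertices $z_1,z_2,z_3$, and the following arrows, each of multiplicity one. Between mutable vertices: $2\to1$, $2\to3$, $2\to4$, $1\to6$, $3\to4$, $3\to5$, $4\to5$, $4\to6$, $5\to2$, $5\to6$, $6\to3$. Involving frozen vertices: $1\to z_1$, $z_1\to2$, $3\to z_1$, $4\to z_2$, $z_2\to3$, $6\to z_3$, $z_3\to1$. The tropical semifield $\mathbb{P}=\mathrm{Trop}(z_1,\dots,z_m)$ is the free abelian group (written multiplicatively) generated by $z_1,\dots,z_m$, with auxiliary addition $\prod_i z_i^{a_i}\oplus\prod_i z_i^{b_i}=\prod_i z_i^{\min(a_i,b_i)}$. Its group ring is $\mathbb{Z}\mathbb{P}=\mathbb{Z}[z_1^{\pm1},\dots,z_m^{\pm1}]$. Seeds. Let $\mathcal{F}$ be a field containing $\mathbb{Z}\mathbb{P}$. A seed of rank $n$ in $\mathcal{F}$ is a triple $(B,\mathbf{x},\mathbf{y})$ where $\mathbf{x}=(x_1,\dots,x_n)$ (the cluster) is an $n$-tuple in $\mathcal{F}$ freely generating $\mathcal{F}$ as a field over the fraction field of $\mathbb{Z}\mathbb{P}$, $\mathbf{y}=(y_1,\dots,y_n)$ is an $n$-tuple in $\mathbb{P}$, and $B$ is an integral skew-symmetrizable $n\times n$ matrix. Mutation. Write $[a]_+=\max(a,0)$. For $1\le k\le n$ the mutation of a seed in direction $k$ is the seed $(\mu_k(B),\mu_k(\mathbf{x}),\mu_k(\mathbf{y}))$,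 where $\mu_k(\mathbf{x})$ is obtained from $\mathbf{x}$ by replacing $x_k$ with $x_k'=\dfrac{y_k\prod_j x_j^{[B_{jk}]_+}+\prod_j x_j^{[-B_{jk}]_+}}{(y_k\oplus 1)x_k}$; $\mu_k(\mathbf{y})=(y_1',\dots,y_n')$ with $y_k'=y_k^{-1}$ and $y_i'=y_iy_k^{[B_{ki}]_+}(y_k\oplus 1)^{-B_{ki}}$ for $i\ne k$; and $\mu_k(B)_{ij}=-B_{ij}$ if $i=k$ or $j=k$, and $\mu_k(B)_{ij}=B_{ij}+\frac12(|B_{ik}|B_{kj}+B_{ik}|B_{kj}|)$ otherwise. Two seeds are mutation equivalent if one is obtained from the other by a sequence of mutations, up to permuting indices. Cluster algebras. The cluster variables are the elements of the clusters of all seeds mutation equivalent to $(B,\mathbf{x},\mathbf{y})$. For a ground ring $\mathbb{Z}\subseteq\mathbb{A}\subseteq\mathbb{Z}\mathbb{P}$, the cluster algebra over $\mathbb{A}$ is the unital $\mathbb{A}$-subalgebra of $\mathcal{F}$ generated by all cluster variables, and the upper cluster algebra over $\mathbb{A}$ is $\bigcap\mathbb{A}[(x_1')^{\pm1},\dots,(x_n')^{\pm1}]$, the intersection over all clusters $(x_1',\dots,x_n')$ of seeds mutation equivalent to $(B,\mathbf{x},\mathbf{y})$. Seed of a quiver. A quiver with mutable vertices $1,\dots,n$ and frozen vertices $z_1,\dots,z_m$ defines a seed over $\mathrm{Trop}(z_1,\dots,z_m)$: $B$ is skew-symmetric with $B_{ji}$ equal to the number of arrows $i\to j$ minus the number of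 arrows $j\to i$ between mutable vertices, and $y_i=\prod_j z_j^{a_j}$ with $a_j$ equal to the number of arrows $i\to z_j$ minus the number of arrows $z_j\to i$. The cluster algebra and upper cluster algebra defined by the quiver are those of this seed. *)

(* Defs.v *)
From HB Require Import structures.
From mathcomp Require Import all_boot all_order all_algebra all_fingroup.
From mathcomp Require Import mpoly.
From mathcomp Require Import boolp classical_sets.

Set Implicit Arguments.
Unset Strict Implicit.
Unset Printing Implicit Defensive.

Import Order.TTheory GRing.Theory Num.Theory.

Local Open Scope ring_scope.
Local Open Scope classical_set_scope.

(* The tropical semifield Trop(z_1, ..., z_m) is written additively, through   *)
(* exponent vectors: the row vector a stands for the Laurent monomial          *)
(* \prod_j z_j ^ a_j.  The product of the semifield is thus +%R, its unit is   *)
(* 0, the k-th power of a is k *: a, and the auxiliary addition is trop_add.   *)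
Notation trop m := 'rV[int]_m.

Definition trop_add m (a b : trop m) : trop m :=
  \row_j Num.min (a 0 j) (b 0 j).

(* [a]_+ *)
Definition pos_part (a : int) : int := Num.max a 0.

Section Subrings.
Variable F : fieldType.

Definition gen_subring (G : set F) : set F :=
  smallest (fun S : set F => GRing.subring_closed (mem S)) G.

Definition gen_subfield (G : set F) : set F :=
  smallest (fun S : set F => GRing.divring_closed (mem S)) G.

(* For a subring A of F, the unital A-subalgebra of F generated by G. *)
Definition gen_subalg (A G : set F) : set F := gen_subring (A `|` G).

Definition laurent_subalg n (A : set F) (x : 'I_n -> F) : set F :=
  gen_subalg A (range x `|` range (fun i => (x i)^-1)).

End Subrings.

Section Coefficients.
Variables (F : fieldType) (m : nat) (z : 'I_m -> F).

(* The group ring ZP is realized inside F.  The map sending the generators of  *)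
(* ZP to the z_j is an embedding iff the z_j are algebraically independent     *)
(* over the integers; this forces F to have characteristic 0.                  *)
Definition embeds_ZP : Prop :=
  forall p : {mpoly int[m]}, mmap (intr : int -> F) z p = 0 -> p = 0.

Definition ZP : set F := gen_subring (range z `|` range (fun j => (z j)^-1)).

Definition ZPplus : set F := gen_subring (range z).

Definition frac_ZP : set F := gen_subfield ZP.

Definition trop_val (a : trop m) : F := \prod_j z j ^ a 0 j.

Definition freely_generates n (x : 'I_n -> F) : Prop :=
  (forall p : {mpoly F[n]},
      (forall u : 'X_{1..n}, frac_ZP p@_u) -> p.@[x] = 0 -> p = 0)
  /\ gen_subfield (frac_ZP `|` range x) = [set: F].

End Coefficients.

Definition skew_symmetrizable n (B : 'M[int]_n) : Prop :=
  exists2 d : 'I_n -> int,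
    forall i, 0 < d i & forall i j, d i * B i j = - (d j * B j i).

(* Raw triples (B, x, y); the conditions making them seeds are in is_seed. *)
Record seed (F : fieldType) (n m : nat) := Seed {
  exch : 'M[int]_n;
  cluster : 'I_n -> F;
  coeff : 'I_n -> trop m
}.

Arguments Seed {F n m}.

Section Seeds.
Variables (F : fieldType) (n m : nat) (z : 'I_m -> F).
Implicit Types (s t : seed F n m) (A : set F).

Definition is_seed s : Prop :=
  skew_symmetrizable (exch s) /\ freely_generates z (cluster s).

(* The entry |b_ik| b_kj + b_ik |b_kj| is even, so the division is exact. *)
Definition mut_exch (k : 'I_n) (B : 'M[int]_n) : 'M[int]_n :=
  \matrix_(i, j)
    if (i == k) || (j == k) then - B i j
    else B i j + ((`|B i k| * B k j + B i k * `|B k j|) %/ 2)%Z.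

Definition mut_cluster (k : 'I_n) s : 'I_n -> F :=
  let: Seed B x y := s in
  fun i => if i == k then
      (trop_val z (y k) * \prod_j x j ^ pos_part (B j k)
         + \prod_j x j ^ pos_part (- B j k))
      / (trop_val z (trop_add (y k) 0) * x k)
    else x i.

Definition mut_coeff (k : 'I_n) (B : 'M[int]_n) (y : 'I_n -> trop m) :
    'I_n -> trop m :=
  fun i => if i == k then - y k
    else y i + pos_part (B k i) *: y k + (- B k i) *: trop_add (y k) 0.

Definition mutation s (k : 'I_n) : seed F n m :=
  Seed (mut_exch k (exch s)) (mut_cluster k s)
       (mut_coeff k (exch s) (coeff s)).

Definition permute (p : 'S_n) s : seed F n m :=
  Seed (\matrix_(i, j) exch s (p i) (p j))
       (fun i => cluster s (p i)) (fun i => coeff s (p i)).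

Definition mutation_equivalent s t : Prop :=
  exists (ks : seq 'I_n) (p : 'S_n), t = permute p (foldl mutation s ks).

Definition cluster_variables s : set F :=
  \bigcup_(t in [set t | mutation_equivalent s t]) range (cluster t).

Definition cluster_algebra A s : set F := gen_subalg A (cluster_variables s).

Definition upper_cluster_algebra A s : set F :=
  \bigcap_(t in [set t | mutation_equivalent s t]) laurent_subalg A (cluster t).

End Seeds.

(* A quiver with mutable vertices inl i and frozen vertices inr j is the list  *)
(* of its arrows (source, target), with repetitions for multiple arrows.       *)
Definition quiver (n m : nat) := seq (('I_n + 'I_m) * ('I_n + 'I_m)).

Section QuiverSeed.
Variables (n m : nat) (Q : quiver n m).

Definition arrows (v w : 'I_n + 'I_m) : int := (count_mem (v, w) Q)%:Z.

(* Entry (i, j) counts the arrows j -> i positively. *)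
Definition quiver_exch : 'M[int]_n :=
  \matrix_(i, j) (arrows (inl j) (inl i) - arrows (inl i) (inl j)).

Definition quiver_coeff (i : 'I_n) : trop m :=
  \row_j (arrows (inl i) (inr j) - arrows (inr j) (inl i)).

Definition quiver_seed (F : fieldType) (x : 'I_n -> F) : seed F n m :=
  Seed quiver_exch x quiver_coeff.

Lemma quiver_seedP (F : fieldType) (z : 'I_m -> F) (x : 'I_n -> F) :
  freely_generates z x -> is_seed z (quiver_seed x).
Proof.
move=> free_x; split=> //; exists (fun=> 1) => [//|i j].
by rewrite !mul1r !mxE opprB.
Qed.

End QuiverSeed.

(* The quiver Q(CG,3); vertices are numbered from 1, ordinals from 0. *)
Definition QCG3 : quiver 6 3 :=
  let v1 := inl (@Ordinal 6 0 isT) in let v2 := inl (@Ordinal 6 1 isT) in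
  let v3 := inl (@Ordinal 6 2 isT) in let v4 := inl (@Ordinal 6 3 isT) in
  let v5 := inl (@Ordinal 6 4 isT) in let v6 := inl (@Ordinal 6 5 isT) in
  let z1 := inr (@Ordinal 3 0 isT) in let z2 := inr (@Ordinal 3 1 isT) in
  let z3 := inr (@Ordinal 3 2 isT) in
  [:: (v2, v1); (v2, v3); (v2, v4); (v1, v6); (v3, v4); (v3, v5);
      (v4, v5); (v4, v6); (v5, v2); (v5, v6); (v6, v3);
      (v1, z1); (z1, v2); (v3, z1); (v4, z2); (z2, v3); (v6, z3); (z3, v1)].

(* Main.v *)
Require Import Defs.
From mathcomp Require Import all_boot all_order all_algebra all_fingroup.
From mathcomp Require Import mpoly.
From mathcomp Require Import boolp classical_sets.
From mathcomp Require Import ring zify.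

(** The cluster variables of the initial seed are explicit polynomials in the
    entries of a 3 x 3 matrix with rows [a], [b], [c] (see [CG3_cluster]), and the
    entries are algebraically independent ([CG3_entries]).  Everything is decided
    by comparing three rings: the cluster algebra, the upper cluster algebra and
    the polynomial ring [S] in the nine entries.

    Cluster algebras are contained in upper cluster algebras.  Call upper bound of
    a seed the ring of elements that are Laurent in the seed and in all its
    neighbours.  The extended exchange matrix has full rank, so two exchange
    binomials of vertices [j] and [k] not joined by an arrow form a regular sequence;
    when there is an arrow, elements can be written with two comaximal denominators.
    In both cases an element Laurent in a seed and in its neighbours at [j] and [k]
    is Laurent in the seed reached by mutating at [k] and then at [j]
    ([rank_two]), so the upper bound does not depend on the seed
    ([upper_bound_walk]).  As it contains the cluster of the seed, this is
    the Laurent phenomenon.  Over [ZPplus] one observes that a frozen variable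
    never divides an exchange binomial: an expansion without frozen denominators
    in one seed has none in the neighbouring seeds either
    ([laurent_plus_mutation]).

    Over [ZP] both algebras agree with [S] after inverting the frozen variables.
    An element Laurent in the initial seed and in its six neighbours, without
    frozen denominators, is a polynomial in the entries: the denominator [x_k] is
    a nonzerodivisor modulo which the product of the denominators of the [k]-th
    neighbour stays regular, so all denominators cancel
    ([upper_bound_polynomial]).  In the other direction, short walks exhibit the
    entries of the first and the last row as cluster variables, and the entries
    of the middle row times a frozen variable as polynomials in cluster variables
    ([cluster_algebra_entries]).

    Over [ZPplus] the entry [b2] in the centre is in the upper cluster algebra,
    but not in the cluster algebra.  Give the nine entries the weights 9 to 17;
    then all cluster variables are homogeneous, and [b2], of weight 13, is not a
    sum of products of two or more elements of positive weight.  If it were in the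
    algebra generated by the cluster and frozen variables, some cluster variable
    would thus be an integral multiple [h] of [b2].  This is excluded by a Poisson
    bracket for which every cluster is log-canonical: bracketing with [h] would be
    diagonalizable on the Laurent ring of a cluster containing [h], with
    eigenvalues in the integral multiples of [h], whereas on the span of the
    minors [y = a3 * c2 - a2 * c3] and [x = a2 * b3 - a3 * b2] the square of this
    derivation is multiplication by [h ^+ 2 - 4 * a * c], where [h], [a] and [c] are
    the same integral multiple of [b2], [a2] and [c2]
    ([centre_not_cluster_variable]). *)

Set Implicit Arguments.
Unset Strict Implicit.
Unset Printing Implicit Defensive.

Import Order.TTheory GRing.Theory Num.Theory.
Local Open Scope ring_scope.
Local Open Scope classical_set_scope.


(** * Subrings of a field *)

Section Subring.
Variable F : fieldType.
Implicit Types (E R G : set F) (T u v f g h : F) (p q : {poly F}).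

Definition subring E : Prop :=
  [/\ E 1, forall u v, E u -> E v -> E (u - v)
    & forall u v, E u -> E v -> E (u * v)].

Lemma gen_subring_subring G : subring (gen_subring G).
Proof.
split=> [A [[A1 _ _] _]|u v Gu Gv A [[A1 AB AM] sGA]|u v Gu Gv A [[A1 AB AM] sGA]].
- by have := A1; rewrite inE.
- have := AB u v; rewrite !inE; apply; first by apply: Gu; split.
  by apply: Gv; split.
- have := AM u v; rewrite !inE; apply; first by apply: Gu; split.
  by apply: Gv; split.
Qed.

Lemma sub_gen_subring G u : G u -> gen_subring G u.
Proof. by move=> Gu A [_]; apply. Qed.

Lemma gen_subring_min G R : subring R -> G `<=` R -> gen_subring G `<=` R.
Proof.
move=> [R1 RB RM] sGR u; apply; split=> //; split; rewrite ?inE //.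
  by move=> x y; rewrite !inE; apply: RB.
by move=> x y; rewrite !inE; apply: RM.
Qed.

Section Closure.
Variable E : set F.
Hypothesis subE : subring E.

Lemma subring1 : E 1. Proof. by case: subE. Qed.
Lemma subringB u v : E u -> E v -> E (u - v). Proof. by case: subE => _ + _; apply. Qed.
Lemma subringM u v : E u -> E v -> E (u * v). Proof. by case: subE => _ _; apply. Qed.
Lemma subring0 : E 0. Proof. by rewrite -(subrr 1); apply: subringB; apply: subring1. Qed.
Lemma subringN u : E u -> E (- u).
Proof. by rewrite -[- u]sub0r; apply: subringB; apply: subring0. Qed.
Lemma subringD u v : E u -> E v -> E (u + v).
Proof. by move=> Eu Ev; rewrite -[v]opprK; apply: subringB => //; apply: subringN. Qed.
Lemma subringX u n : E u -> E (u ^+ n).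
Proof. by move=> Eu; elim: n => [|n IHn]; [apply: subring1|rewrite exprS; apply: subringM]. Qed.
Lemma subring_nat n : E n%:R.
Proof. by elim: n => [|n IHn]; [apply: subring0|rewrite -natr1; apply: subringD => //; apply: subring1]. Qed.
Lemma subring_int (n : int) : E n%:~R.
Proof. by case: n => n; rewrite ?NegzE ?rmorphN; [|apply: subringN]; apply: subring_nat. Qed.
Lemma subring_sum (I : Type) (r : seq I) (P : pred I) (f : I -> F) :
  (forall i, P i -> E (f i)) -> E (\sum_(i <- r | P i) f i).
Proof. by move=> Ef; elim/big_rec: _ => [|i y Pi Ey]; [apply: subring0|apply: subringD => //; apply: Ef]. Qed.
Lemma subring_prod (I : Type) (r : seq I) (P : pred I) (f : I -> F) :
  (forall i, P i -> E (f i)) -> E (\prod_(i <- r | P i) f i).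
Proof. by move=> Ef; elim/big_rec: _ => [|i y Pi Ey]; [apply: subring1|apply: subringM => //; apply: Ef]. Qed.
Lemma subring_exprz u (n : int) : E u -> (n < 0 -> E u^-1) -> E (u ^ n).
Proof.
case: n => n Eu Eu'; first by rewrite -exprnP; apply: subringX.
by rewrite NegzE -exprnN -exprVn; apply: subringX; apply: Eu'; rewrite NegzE oppr_lt0.
Qed.
End Closure.

(** ** Removing denominators *)

(** As [u] and [v] generate the unit ideal, so do any powers of them. *)
Lemma comaximal_frac R u v a b f m n : subring R ->
  R u -> R v -> R a -> R b -> a * u + b * v = 1 ->
  R (u ^+ m * f) -> R (v ^+ n * f) -> R f.
Proof.
move=> sR Ru Rv Ra Rb abuv.
have Rone g : R (u * g) -> R (v ^+ n * g) -> R g.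
  move=> Rug; elim: n => [|l IHl]; first by rewrite mul1r.
  rewrite exprS -mulrA => Rvg; apply: IHl.
  rewrite -[_ * g]mul1r -abuv mulrDl -!mulrA; apply: (subringD sR); apply: (subringM sR) => //.
  by rewrite mulrCA; apply: (subringM sR) => //; apply: (subringX sR).
elim: m => [|m IHm]; first by rewrite mul1r.
rewrite exprS -mulrA => Ruf Rvf; apply: IHm => //; apply: Rone => //.
by rewrite mulrCA; apply: (subringM sR) => //; apply: (subringX sR).
Qed.

(** This is: [u] is a nonzerodivisor on [R / v R]. *)
Definition regular_mod R v u : Prop :=
  forall g h, u * h = v * g -> R g -> R h -> exists2 k, R k & h = v * k.

Lemma regular_modX R v u n : subring R -> R u ->
  regular_mod R v u -> regular_mod R v (u ^+ n).
Proof.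
move=> sR Ru reg; elim: n => [|n IHn] g h + Rg Rh.
  by rewrite mul1r => ->; exists g.
rewrite exprS -mulrA => /reg reg_h.
have [||k Rk /IHn] := reg_h => //; last by apply.
by apply: (subringM sR) => //; apply: (subringX sR).
Qed.

Lemma regular_modM R v u u' : subring R -> R u' ->
  regular_mod R v u -> regular_mod R v u' -> regular_mod R v (u * u').
Proof.
move=> sR Ru' reg reg' g h + Rg Rh.
rewrite -mulrA => /reg reg_h.
have [||k Rk /reg'] := reg_h => //; last by apply.
exact: (subringM sR).
Qed.

(** The denominator [v] can be cancelled one factor at a time: modulo [v], the
    numerator is killed by a power of the nonzerodivisor [u]. *)
Lemma regular_frac R u v f m n : subring R -> R u -> R v -> v != 0 ->
  regular_mod R v u -> R (u ^+ m * f) -> R (v ^+ n * f) -> R f.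
Proof.
move=> sR Ru Rv v0 reg; elim: n f => [|n IHn] f Rm Rn; first by rewrite mul1r in Rn.
have Rvf : R (v * f).
  by apply: IHn; [rewrite mulrCA; apply: (subringM sR)|rewrite mulrA -exprSr].
have [k Rk /(mulfI v0) -> //] := regular_modX (n := m) sR Ru reg (mulrCA _ _ _) Rm Rvf.
Qed.

(** ** Polynomials and Laurent polynomials in one element over a subring *)

Definition poly_on E p : Prop := forall i, E p`_i.

Definition transcendental E T : Prop :=
  forall p, poly_on E p -> p.[T] = 0 -> p = 0.

Definition adjoin E T : set F := [set f | exists2 p, poly_on E p & f = p.[T]].

Definition laurent E T : set F :=
  [set f | exists N, exists2 p, poly_on E p & f * T ^+ N = p.[T]].

Lemma sub_transcendental E E' T : E `<=` E' ->
  transcendental E' T -> transcendental E T.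
Proof. by move=> sE tr p Ep; apply: tr => i; apply/sE/Ep. Qed.

Section PolyOn.
Variable E : set F.
Hypothesis sE : subring E.

Lemma poly_onC u : E u -> poly_on E u%:P.
Proof. by move=> Eu i; rewrite coefC; case: eqP => // _; apply: (subring0 sE). Qed.
Lemma poly_onXn n : poly_on E 'X^n.
Proof. by move=> i; rewrite coefXn; apply: (subring_nat sE). Qed.
Lemma poly_onX : poly_on E 'X.
Proof. by move=> i; rewrite coefX; apply: (subring_nat sE). Qed.
Lemma poly_onB p q : poly_on E p -> poly_on E q -> poly_on E (p - q).
Proof. by move=> Ep Eq i; rewrite coefB; apply: (subringB sE). Qed.
Lemma poly_onD p q : poly_on E p -> poly_on E q -> poly_on E (p + q).
Proof. by move=> Ep Eq i; rewrite coefD; apply: (subringD sE). Qed.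
Lemma poly_onM p q : poly_on E p -> poly_on E q -> poly_on E (p * q).
Proof. by move=> Ep Eq i; rewrite coefM; apply: (subring_sum sE) => j _; apply: (subringM sE). Qed.
Lemma poly_onZ u p : E u -> poly_on E p -> poly_on E (u *: p).
Proof. by move=> Eu Ep i; rewrite coefZ; apply: (subringM sE). Qed.
Lemma poly_on_exp p n : poly_on E p -> poly_on E (p ^+ n).
Proof.
move=> Ep; elim: n => [|n IHn]; first by apply: poly_onC; apply: (subring1 sE).
by rewrite exprS; apply: poly_onM.
Qed.
Lemma poly_on_sum (I : Type) (r : seq I) (P : pred I) (f : I -> {poly F}) :
  (forall i, P i -> poly_on E (f i)) -> poly_on E (\sum_(i <- r | P i) f i).
Proof.
move=> Ef; elim/big_rec: _ => [|i y Pi Ey]; first by apply: poly_onC; apply: (subring0 sE).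
by apply: poly_onD => //; apply: Ef.
Qed.

Lemma horner_on p T R : subring R -> E `<=` R -> R T -> poly_on E p -> R p.[T].
Proof.
move=> sR sER RT Ep; rewrite horner_coef; apply: (subring_sum sR) => i _.
by apply: (subringM sR); [apply/sER/Ep|apply: (subringX sR)].
Qed.

Lemma transcendental_neq0 T : transcendental E T -> T != 0.
Proof.
move=> tr; apply/eqP => T0; have /eqP := tr 'X poly_onX (etrans (hornerX T) T0).
by rewrite polyX_eq0.
Qed.

Lemma transcendental_inj T p q : transcendental E T ->
  poly_on E p -> poly_on E q -> p.[T] = q.[T] -> p = q.
Proof.
move=> tr Ep Eq pq; apply/eqP; rewrite -subr_eq0; apply/eqP; apply: tr.
  exact: poly_onB.
by rewrite hornerD hornerN pq addrN.
Qed.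

Lemma adjoin_subring T : subring (adjoin E T).
Proof.
split=> [|u v [p Ep ->] [q Eq ->]|u v [p Ep ->] [q Eq ->]].
- by exists 1%:P; [apply: poly_onC; apply: (subring1 sE)|rewrite hornerC].
- by exists (p - q); [apply: poly_onB|rewrite hornerD hornerN].
- by exists (p * q); [apply: poly_onM|rewrite hornerM].
Qed.

Lemma laurent_subring T : subring (laurent E T).
Proof.
split=> [|u v [m [p Ep pE]] [n [q Eq qE]]|u v [m [p Ep pE]] [n [q Eq qE]]].
- by exists 0%N, 1%:P; [apply: poly_onC; apply: (subring1 sE)|rewrite hornerC mul1r].
- exists (m + n)%N, (p * 'X^n - q * 'X^m).
    by apply: poly_onB; apply: poly_onM => //; apply: poly_onXn.
  by rewrite hornerD hornerN !hornerM !hornerXn -pE -qE exprD; ring.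
- exists (m + n)%N, (p * q); first exact: poly_onM.
  by rewrite hornerM -pE -qE exprD; ring.
Qed.

Lemma laurentC T u : E u -> laurent E T u.
Proof. by exists 0%N, u%:P; [apply: poly_onC|rewrite hornerC mulr1]. Qed.

Lemma laurentX T : laurent E T T.
Proof. by exists 0%N, 'X; [apply: poly_onX|rewrite hornerX mulr1]. Qed.

Lemma laurentV T : T != 0 -> laurent E T T^-1.
Proof.
move=> T0; exists 1%N, 1%:P; first by apply: poly_onC; apply: (subring1 sE).
by rewrite hornerC mulVf.
Qed.

Lemma adjoinC T u : E u -> adjoin E T u.
Proof. by exists u%:P; [apply: poly_onC|rewrite hornerC]. Qed.

Lemma adjoinX T : adjoin E T T.
Proof. by exists 'X; [apply: poly_onX|rewrite hornerX]. Qed.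

Lemma sub_laurent R T : subring R -> E `<=` R -> R T -> R T^-1 ->
  T != 0 -> laurent E T `<=` R.
Proof.
move=> sR sER RT RT' T0 f [N [p Ep pE]].
have -> : f = p.[T] * T^-1 ^+ N by rewrite -pE exprVn mulfK // expf_neq0.
by apply: (subringM sR); [apply: horner_on|apply: (subringX sR)].
Qed.

Lemma laurent_common T (c : nat -> F) n : (forall i, laurent E T (c i)) ->
  exists N, forall i, (i < n)%N -> exists2 p, poly_on E p & c i * T ^+ N = p.[T].
Proof.
move=> Lc; elim: n => [|n [N IHN]]; first by exists 0%N.
have [M [q Eq qE]] := Lc n; exists (N + M)%N => i; rewrite ltnS leq_eqVlt.
case/orP=> [/eqP->|/IHN[p Ep pE]].
  exists (q * 'X^N); first by apply: poly_onM => //; apply: poly_onXn.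
  by rewrite hornerM hornerXn -qE exprD; ring.
exists (p * 'X^M); first by apply: poly_onM => //; apply: poly_onXn.
by rewrite hornerM hornerXn -pE exprD; ring.
Qed.

End PolyOn.

Section Exchange.
Variable E : set F.
Hypothesis sE : subring E.

(** Independence of two elements does not depend on their order: a relation
    for [u] with coefficients Laurent in [v] is read as a relation for [v]. *)
Lemma transcendental_swap u v : transcendental E u ->
  transcendental (laurent E u) v -> transcendental (laurent E v) u.
Proof.
move=> tru trv p Lp pu0.
have [N cN] := laurent_common sE (size p) Lp.
have [q qP] : exists q : nat -> {poly F}, forall i, (i < size p)%N ->
    poly_on E (q i) /\ p`_i * v ^+ N = (q i).[v].
  have /choice[q qP] : forall i, exists r : {poly F}, (i < size p)%N ->
      poly_on E r /\ p`_i * v ^+ N = r.[v].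
    move=> i; case: (ltnP i (size p)) => [/cN[r Er rE]|_]; first by exists r.
    by exists 0.
  by exists q.
have v0 : v != 0 := transcendental_neq0 (laurent_subring sE u) trv.
pose r := \sum_(i < size p) u ^+ i *: q i.
have Lr : poly_on (laurent E u) r.
  move=> j; rewrite coef_sum; apply: (subring_sum (laurent_subring sE u)) => i _.
  rewrite coefZ; apply: (subringM (laurent_subring sE u)).
    by apply: (subringX (laurent_subring sE u)); apply: (laurentX sE).
  by apply: (laurentC sE); have [] := qP i (ltn_ord i).
have r0 : r = 0.
  apply: trv => //; rewrite horner_sum -[RHS](mul0r (v ^+ N)) -[in RHS]pu0.
  rewrite horner_coef mulr_suml; apply: eq_bigr => i _.
  by rewrite hornerZ -(proj2 (qP i (ltn_ord i))); ring.
apply/polyP => i; rewrite coef0; have [lt_ip|] := ltnP i (size p); last exact: nth_default.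
have q0 : q i = 0.
  apply/polyP => j; rewrite coef0.
  have t0 : \poly_(l < size p) (q l)`_j = 0.
    apply: tru.
      move=> l; rewrite coef_poly; case: ifP => [lt_l|_]; last exact: (subring0 sE).
      by have [Eq _] := qP l lt_l; apply: Eq.
    rewrite horner_poly -[RHS](coef0 F j) -r0 coef_sum.
    by apply: eq_bigr => l _; rewrite coefZ mulrC.
  by move/polyP/(_ i): t0; rewrite coef_poly lt_ip coef0.
have := proj2 (qP i lt_ip); rewrite q0 horner0 => /eqP.
by rewrite mulf_eq0 expf_eq0 (negPf v0) andbF orbF => /eqP.
Qed.

(** Comparing the two expansions shows that the coefficient of [T ^- s] is
    divisible by the [s]-th power of [T * T'], so that the polar part is a
    polynomial in [T']. *)
Lemma laurent_exchange T T' f : transcendental E T -> E (T * T') ->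
  T' != 0 -> laurent E T f -> laurent E T' f ->
  exists p, exists2 q, poly_on E p /\ poly_on E q & f = p.[T] + q.[T'].
Proof.
move=> tr; set P := T * T' => EP T'0 [N [p Ep pE]] [M [q Eq qE]].
have T0 := transcendental_neq0 sE tr.
have PE : T' = P / T by rewrite /P mulrAC divff // mul1r.
pose K := (N + size q)%N.
(* both expansions, multiplied by [P ^+ M * T ^+ K], as polynomials in [T] *)
have eq1 : P ^+ M *: (p * 'X^(K - N)) =
    \sum_(i < size q) (q`_i * P ^+ i) *: 'X^(M + K - i).
  apply: (transcendental_inj sE tr).
  - apply: (poly_onZ sE); first exact: (subringX sE).
    by apply: (poly_onM sE) => //; apply: (poly_onXn sE).
  - apply: (poly_on_sum sE) => i _; apply: (poly_onZ sE); last exact: (poly_onXn sE).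
    by apply: (subringM sE) => //; apply: (subringX sE).
  rewrite hornerZ hornerM hornerXn -pE horner_sum.
  have -> : P ^+ M * (f * T ^+ N * T ^+ (K - N)) = q.[T'] * T ^+ (M + K).
    rewrite -qE -mulrA -exprD subnKC ?leq_addr // exprMn exprD; ring.
  rewrite horner_coef mulr_suml; apply: eq_bigr => i _.
  rewrite hornerZ hornerXn -mulrA -mulrA; congr (_ * _).
  have lt_i : (i < size q)%N := ltn_ord i.
  have lei : (i <= M + K)%N by rewrite /K; lia.
  rewrite -{1}(subnKC lei) exprD mulrA -exprMn; congr (_ ^+ _ * _).
  by rewrite /P mulrC.
have coefq s : (0 < s)%N -> (s <= N)%N -> P ^+ M * p`_(N - s)%N = q`_(M + s)%N * P ^+ (M + s)%N.
  move=> s0 sN; have /polyP/(_ (K - s)%N) := eq1.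
  have Ks : (K - s = (N - s) + (K - N))%N by rewrite /K; lia.
  rewrite coefZ {1}Ks coefMXn ltnNge leq_addl /= addnK => ->.
  rewrite coef_sum; have [lt_q|ge_q] := ltnP (M + s)%N (size q).
    rewrite (bigD1 (Ordinal lt_q)) //= big1 ?addr0.
      by rewrite coefZ coefXn (_ : (K - s == _)%N = true) ?mulr1 //; apply/eqP; rewrite /K; lia.
    move=> i /eqP neq_i; rewrite coefZ coefXn; case: eqP => [eqK|_]; last by rewrite mulr0.
    case: neq_i; apply: val_inj => /=; have lt_i : (i < size q)%N := ltn_ord i.
    by move: eqK lt_i; rewrite /K; lia.
  rewrite [q`_(M + s)%N]nth_default // mul0r big1 // => i _.
  rewrite coefZ coefXn; case: eqP => [eqK|_]; last by rewrite mulr0.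
  have lt_i : (i < size q)%N := ltn_ord i.
  by exfalso; move: eqK ge_q s0 sN lt_i; rewrite /K; lia.
have P0 : P != 0 by rewrite mulf_neq0.
have coefp s : (0 < s)%N -> (s <= N)%N -> p`_(N - s)%N = q`_(M + s)%N * P ^+ s.
  move=> s0 sN; apply: (mulfI (expf_neq0 M P0)).
  by rewrite coefq // exprD; ring.
exists (\poly_(i < size p) p`_(N + i)%N), (\poly_(i < N.+1) (if i == 0%N then 0 else q`_(M + i)%N)).
  split=> i; rewrite coef_poly; case: ifP => _ //; try exact: (subring0 sE).
  by case: ifP => _ //; apply: (subring0 sE).
apply: (mulIf (expf_neq0 N T0)); rewrite pE mulrDl !horner_poly.
rewrite big_ord_recl /= mul0r add0r.
rewrite (@horner_coef_wide _ (N + size p)) ?leq_addl // big_split_ord /= addrC.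
congr (_ + _).
  by rewrite mulr_suml; apply: eq_bigr => i _; rewrite -mulrA -exprD addnC.
rewrite mulr_suml (reindex_inj rev_ord_inj) /=; apply: eq_bigr => i _.
rewrite /bump /= add1n coefp //.
have -> : T ^+ N = T ^+ i.+1 * T ^+ (N - i.+1) by rewrite -exprD subnKC ?ltn_ord.
by rewrite /P exprMn; ring.
Qed.

End Exchange.
End Subring.


Section Regular.
Variable F : fieldType.
Implicit Types (E R : set F) (T u v r s g h : F).
Variables (E : set F) (T : F).
Hypotheses (sE : subring E) (trT : transcendental E T).

(** [1 + s * T ^+ a] has constant coefficient [1], so the coefficients of [g],
    taken in increasing order, are successively multiples of [r]. *)
Lemma dvd_unit_const r s a g h : (0 < a)%N -> E r -> r != 0 -> E s ->
  laurent E T g -> laurent E T h -> (1 + s * T ^+ a) * g = r * h ->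
  exists2 k, laurent E T k & g = r * k.
Proof.
move=> a0 Er r0 Es [M [p Ep pE]] [N [q Eq qE]] gh.
have T0 := transcendental_neq0 sE trT.
have pq : (1 + s *: 'X^a) * (p * 'X^N) = r *: (q * 'X^M).
  apply: (transcendental_inj sE trT).
  - apply: (poly_onM sE); last by apply: (poly_onM sE) => //; apply: (poly_onXn sE).
    apply: (poly_onD sE); first by apply: (poly_onC sE); apply: (subring1 sE).
    by apply: (poly_onZ sE) => //; apply: (poly_onXn sE).
  - apply: (poly_onZ sE) => //; apply: (poly_onM sE) => //; exact: (poly_onXn sE).
  rewrite !(hornerM, hornerD, hornerZ, hornerXn, hornerC) -pE -qE.
  by transitivity ((1 + s * T ^+ a) * g * T ^+ M * T ^+ N); [ring|rewrite gh; ring].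
set p' := p * 'X^N in pq.
have [c cP] : exists c : nat -> F, forall i, E (c i) /\ p'`_i = r * c i.
  suff /choice[c cP] : forall i, exists c, E c /\ p'`_i = r * c by exists c.
  elim/ltn_ind => i IHi.
  have /polyP/(_ i) := pq.
  rewrite mulrDl mul1r coefD -scalerAl !coefZ coefXnM.
  have Eq' : E (q * 'X^M)`_i by apply: (poly_onM sE) => //; apply: (poly_onXn sE).
  case: ltnP => [_|le_ai] pE'.
    by exists (q * 'X^M)`_i; split=> //; rewrite -pE' mulr0 addr0.
  have [c [Ec cE]] : exists c, E c /\ p'`_(i - a) = r * c by apply: IHi; rewrite ltn_subrL a0 (leq_trans a0).
  exists ((q * 'X^M)`_i - s * c); split.
    by apply: (subringB sE) => //; apply: (subringM sE).
  by rewrite mulrBr -pE' cE; ring.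
have p'E : p' = r *: \poly_(i < size p') c i.
  apply/polyP => i; rewrite coefZ coef_poly; case: ltnP => [_|le_pi]; first by have [] := cP i.
  by rewrite mulr0 nth_default.
exists ((\poly_(i < size p') c i).[T] / T ^+ (M + N)).
  exists (M + N)%N, (\poly_(i < size p') c i); last by rewrite divfK ?expf_neq0.
  by move=> i; rewrite coef_poly; case: ifP => _; [have [] := cP i|apply: (subring0 sE)].
have : p'.[T] = g * T ^+ (M + N) by rewrite hornerM hornerXn -pE exprD; ring.
rewrite {1}p'E hornerZ => pTE; apply: (mulIf (expf_neq0 (M + N) T0)).
by rewrite -pTE -mulrA divfK ?expf_neq0.
Qed.

Lemma poly_shift (p : {poly F}) : p`_0 = 0 -> p = \poly_(i < size p) p`_i.+1 * 'X.
Proof.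
move=> p0; apply/polyP => -[|i]; first by rewrite coefMX.
rewrite coefMX coef_poly /=; case: ltnP => // le_pi.
by rewrite nth_default // ltnW.
Qed.

Lemma regular_mod_var P0 P1 : E P0 -> P0 != 0 -> adjoin E T P1 ->
  regular_mod (adjoin E T) T (P0 + T * P1).
Proof.
move=> EP0 P00 [p1 Ep1 ->] g h + [q Eq qE] [p Ep pE]; rewrite qE pE => eqT.
have eqp : (P0%:P + 'X * p1) * p = 'X * q.
  apply: (transcendental_inj sE trT).
  - apply: (poly_onM sE) => //; apply: (poly_onD sE); first exact: (poly_onC sE).
    by apply: (poly_onM sE) => //; apply: (poly_onX sE).
  - by apply: (poly_onM sE) => //; apply: (poly_onX sE).
  by rewrite !(hornerM, hornerD, hornerX, hornerC).
have p0 : p`_0 = 0.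
  have /polyP/(_ 0%N) := eqp.
  rewrite mulrDl coefD coefCM -mulrA !coefXM /= addr0 => /eqP.
  by rewrite mulf_eq0 (negPf P00) => /eqP.
exists (\poly_(i < size p) p`_i.+1).[T].
  exists (\poly_(i < size p) p`_i.+1) => // i.
  by rewrite coef_poly; case: ifP => _ //; apply: (subring0 sE).
by rewrite {1}(poly_shift p0) hornerM hornerX mulrC.
Qed.

(** The linear element [a * T + b] is prime once [b] is a nonzerodivisor modulo
    [a]: the quotient embeds in the field by sending [T] to [- b / a]. *)
Lemma regular_mod_linear a b (y : {poly F}) : E a -> E b -> a != 0 ->
  regular_mod E a b -> poly_on E y -> y.[- b / a] != 0 ->
  regular_mod (adjoin E T) (a * T + b) y.[T].
Proof.
move=> Ea Eb a0 reg Ey y0 g h + [q Eq qE] [p Ep pE]; rewrite qE pE => eqT.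
pose l := a *: 'X + b%:P.
have El : poly_on E l.
  by apply: (poly_onD sE); [apply: (poly_onZ sE) => //; apply: (poly_onX sE)|apply: (poly_onC sE)].
have eqp : y * p = l * q.
  apply: (transcendental_inj sE trT); try exact: (poly_onM sE).
  by rewrite !(hornerM, hornerD, hornerZ, hornerX, hornerC).
have l0 : l.[- b / a] = 0.
  by rewrite !(hornerD, hornerZ, hornerX, hornerC) mulrC divfK // addNr.
have /factor_theorem[k kE] : root p (- b / a).
  have /eqP := congr1 (horner^~ (- b / a)) eqp.
  by rewrite /= !hornerM l0 mul0r mulf_eq0 (negPf y0).
have [k' pk] : exists k', p = l * k'.
  exists (a^-1 *: k); rewrite kE mulrC -scalerAr scalerAl; congr (_ * _); apply/polyP => i.
  rewrite /l !(coefZ, coefD, coefN, coefC, coefX); case: i => [|i] /=; field => //.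
(* the coefficients of [l * k'] are in [E], those of [k'] have a power of [a] as denominator *)
have div_a : forall k'', poly_on E (l * k'') -> poly_on E (a *: k'') -> poly_on E k''.
  move=> {k kE pk k'} k' Elk Eak.
  have step i : exists2 c, E c & a * k'`_i = a * c.
    elim: i => [|i [c Ec cE]].
      have Eb0 : E (b * k'`_0).
        by have := Elk 0%N; rewrite /l mulrDl coefD -scalerAl coefZ coefXM mulr0 add0r coefCM.
      have Ea0 : E (a * k'`_0) by rewrite -coefZ; apply: Eak.
      by have [c Ec cE] := reg _ _ (mulrCA b a k'`_0) Eb0 Ea0; exists c.
    have := Elk i.+1; rewrite /l mulrDl coefD -scalerAl coefZ coefXM /= coefCM => Eki.
    have Ek : E k'`_i by rewrite (mulfI a0 cE).
    have Ebk : E (b * k'`_i.+1).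
      by rewrite -[X in E X](addKr (a * k'`_i)) addrC; apply: (subringB sE) => //; apply: (subringM sE).
    have Eak1 : E (a * k'`_i.+1) by rewrite -coefZ; apply: Eak.
    by have [d Ed dE] := reg _ _ (mulrCA b a k'`_i.+1) Ebk Eak1; exists d.
  by move=> i; have [c Ec /(mulfI a0) ->] := step i.
have En m i : (size k' <= i + m)%N -> E (a ^+ m * k'`_i).
  elim: m i => [|m IHm] i; rewrite ?addn0 => le_i.
    by rewrite nth_default // mulr0; apply: (subring0 sE).
  have -> : a ^+ m.+1 * k'`_i = a ^+ m * p`_i.+1 - b * (a ^+ m * k'`_i.+1).
    by rewrite pk /l mulrDl coefD -scalerAl coefZ coefXM /= coefCM exprS; ring.
  apply: (subringB sE); apply: (subringM sE) => //; first exact: (subringX sE).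
  by apply: IHm; rewrite addSnnS.
have Ek : poly_on E (a ^+ size k' *: k') by move=> i; rewrite coefZ; apply: En; apply: leq_addl.
have {}Ek : poly_on E k'.
  elim: (size k') Ek => [|n IHn]; first by rewrite scale1r.
  rewrite exprS -scalerA => Ek; apply: IHn; apply: div_a => //.
  by rewrite -scalerAr -pk; apply: (poly_onZ sE) => //; apply: (subringX sE).
exists k'.[T]; first by exists k'.
by rewrite pk hornerM !(hornerD, hornerZ, hornerX, hornerC).
Qed.
End Regular.


(** * Laurent rings of algebraically independent families *)

Section Family.
Variables (F : fieldType) (I : finType).
Implicit Types (X : I -> F) (J K : pred I) (v w : I -> int).

(** The index sets of the variables and of the inverted variables are separate, to
    cover polynomial rings, Laurent rings and rings where only the mutable
    variables are inverted. *)
Definition lauring X J K : set F :=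
  gen_subring ([set X i | i in [set i | J i]] `|` [set (X i)^-1 | i in [set i | K i]]).

Definition all_but (k : I) : pred I := fun i => i != k.

(** Algebraic independence over the prime ring, in the form in which the arguments
    on one variable at a time use it. *)
Definition independent X : Prop :=
  forall i, transcendental (lauring X (all_but i) (all_but i)) (X i).

Definition mon X v : F := \prod_i X i ^ v i.

Lemma lauring_subring X J K : subring (lauring X J K).
Proof. exact: gen_subring_subring. Qed.

Lemma lauring_var X J K i : J i -> lauring X J K (X i).
Proof. by move=> Ji; apply: sub_gen_subring; left; exists i. Qed.

Lemma lauring_inv X J K i : K i -> lauring X J K (X i)^-1.
Proof. by move=> Ki; apply: sub_gen_subring; right; exists i. Qed.

Lemma lauring_min X J K (R : set F) : subring R ->
  (forall i, J i -> R (X i)) -> (forall i, K i -> R (X i)^-1) ->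
  lauring X J K `<=` R.
Proof.
by move=> sR RX RXV; apply: gen_subring_min => // y [] [i Hi <-]; [apply: RX|apply: RXV].
Qed.

Lemma lauring_sub X X' J J' K K' :
  (forall i, J i -> J' i /\ X i = X' i) -> (forall i, K i -> K' i /\ X i = X' i) ->
  lauring X J K `<=` lauring X' J' K'.
Proof.
move=> JX KX; apply: lauring_min; first exact: lauring_subring.
  by move=> i /JX[Ji ->]; apply: lauring_var.
by move=> i /KX[Ki ->]; apply: lauring_inv.
Qed.

Lemma lauring_laurent X J K i : X i != 0 ->
  lauring X J K `<=`
  laurent (lauring X (fun j => J j && (j != i)) (fun j => K j && (j != i))) (X i).
Proof.
move=> Xi0; set E := lauring X (fun j => J j && _) _.
have sE : subring E by apply: lauring_subring.
apply: lauring_min => [|j Jj|j Kj]; first exact: laurent_subring.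
  have [->|ne_ji] := eqVneq j i; first exact: laurentX.
  by apply: (laurentC sE); apply: lauring_var; rewrite Jj ne_ji.
have [->|ne_ji] := eqVneq j i; first exact: laurentV.
by apply: (laurentC sE); apply: lauring_inv; rewrite Kj ne_ji.
Qed.

Lemma lauring_adjoin X J K i : ~~ K i ->
  lauring X J K `<=` adjoin (lauring X (fun j => J j && (j != i)) K) (X i).
Proof.
move=> Ki; set E := lauring X (fun j => J j && _) _.
have sE : subring E by apply: lauring_subring.
apply: lauring_min => [|j Jj|j Kj]; first exact: adjoin_subring.
  have [->|ne_ji] := eqVneq j i; first exact: adjoinX.
  by apply: (adjoinC sE); apply: lauring_var; rewrite Jj ne_ji.
by apply: (adjoinC sE); apply: lauring_inv.
Qed.

Lemma laurent_lauring X J K i : J i -> K i -> X i != 0 ->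
  laurent (lauring X (fun j => J j && (j != i)) (fun j => K j && (j != i))) (X i) `<=`
  lauring X J K.
Proof.
move=> Ji Ki Xi0; apply: sub_laurent => //; first exact: lauring_subring.
- by apply: lauring_sub => j /andP[].
- exact: lauring_var.
- exact: lauring_inv.
Qed.

Lemma independent_neq0 X i : independent X -> X i != 0.
Proof. by move=> /(_ i); apply: transcendental_neq0; apply: lauring_subring. Qed.

(** For a member [X i] that stays, exchange the roles of [X i] and of the new
    element over the ring of the remaining ones. *)
Lemma independent_replace X X' k : (forall i, i != k -> X' i = X i) ->
  transcendental (lauring X (all_but k) (all_but k)) (X' k) ->
  independent X -> independent X'.
Proof.
move=> X'E trk indX i.
have [->|ne_ik] := eqVneq i k.
  apply: sub_transcendental trk.
  by apply: lauring_sub => j; rewrite /all_but => ne_jk; split=> //; apply: X'E.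
pose B j := (j != i) && (j != k).
pose E := lauring X B B.
have sE : subring E by apply: lauring_subring.
have tri : transcendental E (X i).
  by apply: sub_transcendental (indX i); apply: lauring_sub => j /andP[].
have trk' : transcendental (laurent E (X i)) (X' k).
  apply: sub_transcendental trk; apply: sub_laurent => //.
  - exact: lauring_subring.
  - by apply: lauring_sub => j /andP[].
  - exact: lauring_var.
  - exact: lauring_inv.
  - exact: independent_neq0.
have k0 := transcendental_neq0 (laurent_subring sE _) trk'.
rewrite X'E //; apply: sub_transcendental (transcendental_swap sE tri trk').
move=> f /(@lauring_laurent _ _ _ k k0); apply: sub_laurent => //.
- exact: laurent_subring.
- move=> g Eg; apply: (laurentC sE); move: g Eg.
  by apply: lauring_sub => j /andP[]; rewrite /all_but /B => -> ne_jk; split=> //; apply: X'E.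
- exact: laurentX.
- exact: laurentV.
Qed.

Section Monomials.
Variable X : I -> F.
Hypothesis X0 : forall i, X i != 0.

Lemma mon_neq0 v : mon X v != 0.
Proof. by apply/prodf_neq0 => i _; apply: expfz_neq0. Qed.

Lemma monD v w : mon X (fun i => v i + w i) = mon X v * mon X w.
Proof. by rewrite -big_split; apply: eq_bigr => i _; apply: expfzDr. Qed.

Lemma monN v : mon X (fun i => - v i) = (mon X v)^-1.
Proof. by rewrite -prodfV; apply: eq_bigr => i _; rewrite invr_expz. Qed.

Lemma monB v w : mon X (fun i => v i - w i) = mon X v / mon X w.
Proof. by rewrite monD monN. Qed.

Lemma monX v (n : int) : mon X (fun i => v i * n) = mon X v ^ n.
Proof.
case: n => n; first rewrite -exprnP.
  by rewrite -prodrXl; apply: eq_bigr => i _; rewrite exprnP exprz_exp.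
rewrite NegzE -exprnN -exprVn -monN -prodrXl; apply: eq_bigr => i _.
by rewrite exprnP exprz_exp mulrN mulNr.
Qed.

Lemma eq_mon X' v w : (forall i, v i = w i) -> (forall i, v i != 0 -> X i = X' i) ->
  mon X v = mon X' w.
Proof.
move=> vw XX'; apply: eq_bigr => i _; rewrite -vw.
by have [->|/XX'->//] := eqVneq (v i) 0; rewrite !expr0z.
Qed.

Definition off k v : I -> int := fun i => if i == k then 0 else v i.

Lemma mon_off k v : mon X v = X k ^ v k * mon X (off k v).
Proof.
rewrite /mon (bigD1 k) //=; congr (_ * _).
rewrite [RHS](bigD1 k) //= /off eqxx expr0z mul1r.
by apply: eq_bigr => i /negPf ->.
Qed.

Lemma lauring_mon J K v : (forall i, 0 < v i -> J i) -> (forall i, v i < 0 -> J i && K i) ->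
  lauring X J K (mon X v).
Proof.
have sR := lauring_subring X J K.
move=> vJ vK; apply: (subring_prod sR) => i _.
have [v_neg|v_pos|->] := ltrgtP (v i) 0; last by rewrite expr0z; apply: (subring1 sR).
  have /andP[Ji Ki] := vK i v_neg.
  by apply: (subring_exprz sR) => [|_]; [apply: lauring_var|apply: lauring_inv].
apply: (subring_exprz sR) => [|v_neg]; first by apply: lauring_var; apply: vJ.
by have := lt_trans v_neg v_pos; rewrite ltxx.
Qed.

End Monomials.

Lemma mon_neq1 X v i : independent X -> v i != 0 -> mon X v != 1.
Proof.
move=> indX; have X0 j : X j != 0 by apply: independent_neq0.
wlog vi_pos : v / 0 < v i.
  move=> IH vi0; have [vi_pos|vi_neg|vi_eq] := ltrgtP 0 (v i); [exact: IH| |by rewrite -vi_eq eqxx in vi0].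
  rewrite -invr_eq1 -monN; apply: IH; first by rewrite oppr_gt0.
  by rewrite oppr_eq0.
move=> _; apply/eqP; rewrite (mon_off X i) => v1.
set E := lauring X (all_but i) (all_but i).
have sE : subring E by apply: lauring_subring.
case vE: (v i) vi_pos v1 => [n|//] n0; rewrite -exprnP => v1.
have Eu : E (mon X (off i v)).
  apply: lauring_mon => j; rewrite /off /all_but; case: eqVneq => //; by rewrite ltxx.
have /polyP/(_ n) : mon X (off i v) *: 'X^n - 1%:P = 0.
  apply: (indX i).
    apply: (poly_onB sE); last by apply: (poly_onC sE); apply: (subring1 sE).
    by apply: (poly_onZ sE) => //; apply: (poly_onXn sE).
  by rewrite !(hornerD, hornerN, hornerZ, hornerXn, hornerC) mulrC v1 subrr.
rewrite coefB coefZ coefXn eqxx coefC mulr1 coef0.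
case: n n0 {vE v1} => [//|n] _ /=; rewrite subr0 => /eqP.
by rewrite (negPf (mon_neq0 X0 _)).
Qed.

(** Two binomials whose exponent differences are linearly independent form a
    regular sequence: eliminating [X p] from [- mon v] and [- mon w], which are
    [1] modulo the binomials, leaves in the ideal they generate a nonzero
    element free of [X p], whereas the first binomial is a unit times a
    polynomial in [X p] with constant coefficient [1]. *)
Lemma regular_binomials X (v1 v2 w1 w2 : I -> int) : independent X ->
  (forall a b : int, (forall i, a * (v1 i - v2 i) = b * (w1 i - w2 i)) -> a = 0 /\ b = 0) ->
  regular_mod (lauring X predT predT) (mon X v1 + mon X v2) (mon X w1 + mon X w2).
Proof.
move=> indX; have X0 j : X j != 0 by apply: independent_neq0.
have sR := lauring_subring X predT predT; set R := lauring _ _ _ in sR *.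
have Rmon v : R (mon X v) by apply: lauring_mon.
wlog [p p_pos] : v1 v2 / exists p, v2 p < v1 p.
  move=> IH lin; have [/existsP[p pP]|] := boolP [exists p, v2 p < v1 p].
    by apply: IH => //; exists p.
  rewrite negb_exists => /forallP le12.
  have [/existsP[p pP]|] := boolP [exists p, v1 p < v2 p].
    rewrite addrC; apply: IH; first by exists p.
    move=> a b ab; have [|/eqP + ->] := lin (- a) b; first by move=> i; rewrite -ab; ring.
    by rewrite oppr_eq0 => /eqP.
  rewrite negb_exists => /forallP le21.
  suff: 1 = 0 :> int by [].
  have [|//] := lin 1 0 => i; rewrite mul0r mul1r; apply/eqP; rewrite subr_eq0 eq_le.
  by rewrite !leNgt le12 le21.
move=> lin; set P := mon X v1 + _; set Q := mon X w1 + _.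
pose v i := v1 i - v2 i; pose w i := w1 i - w2 i.
case vE: (v p) => [n|n]; last by move: p_pos; rewrite -subr_gt0 -/(v p) vE.
have n0 : (0 < n)%N by move: p_pos; rewrite -subr_gt0 -/(v p) vE.
pose S := mon X v; pose T := mon X w.
have S0 : S != 0 := mon_neq0 X0 v; have T0 : T != 0 := mon_neq0 X0 w.
have PE : P = mon X v2 * (1 + S) by rewrite /S (monB X0) /P; field; apply: mon_neq0.
have QE : Q = mon X w2 * (1 + T) by rewrite /T (monB X0) /Q; field; apply: mon_neq0.
pose r := (- T) ^+ n * (- S) ^ (- w p) - 1.
pose E := lauring X (all_but p) (all_but p).
have sE : subring E by apply: lauring_subring.
have RV m : R (mon X m)^-1 by rewrite -monN.
have RS : R S := Rmon v. have RT : R T := Rmon w.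
have nE : (-1 : F) ^+ n * (-1) ^ (- w p) = 1 \/ (-1 : F) ^+ n * (-1) ^ (- w p) = -1.
  have /orP[/eqP|/eqP] : (((-1) ^+ n * (-1) ^ (- w p) : F) == 1) || ((-1) ^+ n * (-1) ^ (- w p) == -1 :> F).
  - rewrite -sqrf_eq1 exprMn sqrr_sign mul1r expr2 -exprzMl ?unitrN1 //.
    by rewrite mulrNN mulr1 exp1rz.
  - by left.
  - by right.
pose u i := w i * n%:Z + v i * - w p.
have rE : r = ((-1) ^+ n * (-1) ^ (- w p)) * mon X u - 1.
  rewrite /r /u (monD X0) !monX -/S -/T -exprnP.
  by rewrite -[- T]mulN1r -[- S]mulN1r exprMn exprzMl ?unitfE ?oppr_eq0 ?oner_eq0 // mulrACA.
have u_p : u p = 0 by rewrite /u vE; ring.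
have Er : E r.
  rewrite rE; apply: (subringB sE); last exact: (subring1 sE).
  apply: (subringM sE).
    by case: nE => ->; [|apply: (subringN sE)]; apply: (subring1 sE).
  apply: lauring_mon => i; rewrite /all_but; case: eqVneq => [->|//]; by rewrite u_p ltxx.
have r0 : r != 0.
  have [i ui0] : exists i, u i != 0.
    apply/existsP; apply: contraT; rewrite negb_exists => /forallP u0.
    have [|_ n0'] := lin (w p) n%:Z; last by case: n n0 n0' {vE r rE u u0 u_p nE Er}.
    by move=> i; move: (u0 i); rewrite negbK /u -/(v i) -/(w i) => /eqP; lia.
  apply/eqP => /eqP; rewrite rE subr_eq0 => /eqP mu.
  have := mon_neq1 (v := fun i => u i * 2%:Z) indX (_ : u i * 2%:Z != 0).
  rewrite monX -exprnP expr2 => /(_ _)/eqP; apply; first by lia.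
  case: nE mu => ->; rewrite ?mul1r ?mulN1r => mu; first by rewrite mu mul1r.
  by rewrite -[mon X u]opprK mu mulrNN mulr1.
(* [- S] and [- T] are [1] modulo [P] and [Q] *)
have powS : exists2 a, R a & (- S) ^ (- w p) - 1 = a * P.
  have powR (s : F) m : R s -> exists2 a, R a & s ^+ m - 1 = a * (s - 1).
    move=> Rs; exists (\sum_(i < m) s ^+ i); last by rewrite subrX1 mulrC.
    by apply: (subring_sum sR) => i _; apply: (subringX sR).
  case: (- w p) => m.
    have [a Ra aE] := powR (- S) m (subringN sR RS).
    exists (- a / mon X v2); first by apply: (subringM sR) => //; apply: (subringN sR).
    by rewrite -exprnP aE PE; field; apply: mon_neq0.
  have RS' : R (- S)^-1 by rewrite invrN; apply: (subringN sR); apply: (RV v).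
  have [a Ra aE] := powR (- S)^-1 m.+1 RS'.
  exists (- a / S / mon X v2).
    apply: (subringM sR) => //; apply: (subringM sR); last exact: (RV v).
    exact: (subringN sR).
  by rewrite NegzE -exprnN -exprVn aE PE; field; rewrite oppr_eq0 S0 mon_neq0.
have powT : exists2 a, R a & (- T) ^+ n - 1 = a * Q.
  exists (- (\sum_(i < n) (- T) ^+ i) / mon X w2).
    apply: (subringM sR) => //; apply: (subringN sR); apply: (subring_sum sR) => i _.
    by apply: (subringX sR); apply: (subringN sR).
  by rewrite subrX1 QE; field; apply: mon_neq0.
have [a Ra aE] := powS; have [b Rb bE] := powT.
have Rr : r = (- T) ^+ n * (a * P) + b * Q by rewrite -aE -bE /r; ring.
move=> g h Qh Rg Rh.
pose g' := mon X v2 * ((- T) ^+ n * a * h + b * g).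
have RTn : R ((- T) ^+ n) by apply: (subringX sR); apply: (subringN sR).
have Rg' : R g'.
  apply: (subringM sR) => //; apply: (subringD sR); last exact: (subringM sR).
  by apply: (subringM sR) => //; apply: (subringM sR).
have SE : S = mon X (off p v) * X p ^+ n by rewrite /S (mon_off X p) vE mulrC.
have Es : E (mon X (off p v)).
  by apply: lauring_mon => i; rewrite /off /all_but; case: eqVneq => //; rewrite ltxx.
have toE f : R f -> laurent E (X p) f by apply: lauring_laurent.
have gh : (1 + mon X (off p v) * X p ^+ n) * g' = r * h.
  rewrite -SE Rr; transitivity ((- T) ^+ n * a * P * h + b * (Q * h)); last by ring.
  by rewrite Qh /g' PE; ring.
have [k Lk kE] := dvd_unit_const sE (indX p) n0 Er r0 Es (toE _ Rg') (toE _ Rh) gh.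
exists (k / mon X v2).
  apply: (subringM sR) => //.
  exact: (@laurent_lauring X predT predT p isT isT (X0 p)).
apply: (mulfI r0); rewrite -gh kE -SE PE; field; exact: mon_neq0.
Qed.

End Family.


(** * Seeds with extended exchange matrices of full rank *)

Lemma pos_partB (a : int) : pos_part a - pos_part (- a) = a.
Proof. rewrite /pos_part; lia. Qed.

Lemma pos_part_ge0 (a : int) : 0 <= pos_part a.
Proof. rewrite /pos_part; lia. Qed.

Lemma pos_part_id (a : int) : 0 <= a -> pos_part a = a.
Proof. rewrite /pos_part; lia. Qed.

Lemma pos_part_eq0 (a : int) : a <= 0 -> pos_part a = 0.
Proof. rewrite /pos_part; lia. Qed.

Lemma pos_part_min (a : int) : pos_part (- a) = - Num.min a 0.
Proof. rewrite /pos_part; lia. Qed.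

Lemma mut_exch_entry (a b : int) :
  ((`|a| * b + a * `|b|) %/ 2)%Z = a * pos_part b + pos_part (- a) * b.
Proof.
suff -> : `|a| * b + a * `|b| = (a * pos_part b + pos_part (- a) * b) * 2 by rewrite mulzK.
have [a0|a0] := lerP 0 a; have [b0|b0] := lerP 0 b.
- by rewrite !ger0_norm // (pos_part_id b0) pos_part_eq0 ?oppr_le0 //; ring.
- by rewrite ger0_norm // ltr0_norm // !pos_part_eq0 ?oppr_le0 ?(ltW b0) //; ring.
- rewrite ltr0_norm // ger0_norm // (pos_part_id b0) pos_part_id; last by rewrite oppr_ge0 ltW.
  ring.
- rewrite !ltr0_norm // (pos_part_eq0 (ltW b0)) pos_part_id; last by rewrite oppr_ge0 ltW.
  ring.
Qed.

Section SeedTheory.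
Variables (F : fieldType) (n m : nat) (z : 'I_m -> F).
Local Notation idx := ('I_n + 'I_m)%type.
Implicit Types (s t : seed F n m) (k : 'I_n) (i : idx) (f : F).

Definition ext_cluster s i : F :=
  match i with inl a => cluster s a | inr j => z j end.

Definition ext_exch s k i : int :=
  match i with inl a => exch s a k | inr j => coeff s k 0 j end.

Local Notation X := ext_cluster.
Local Notation e := ext_exch.

Definition plus_mon s k : F := mon (X s) (fun i => pos_part (e s k i)).
Definition minus_mon s k : F := mon (X s) (fun i => pos_part (- e s k i)).
Definition exchange s k : F := plus_mon s k + minus_mon s k.

Definition skew s : Prop := forall a b, exch s a b = - exch s b a.

Definition full_rank s : Prop :=
  forall c : 'I_n -> int, (forall i, \sum_k c k * e s k i = 0) -> forall k, c k = 0.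

Definition good s : Prop := [/\ independent (X s), skew s & full_rank s].

Lemma good_neq0 s i : good s -> X s i != 0.
Proof. by case=> indX _ _; apply: independent_neq0. Qed.

Lemma skew_diag s k : skew s -> exch s k k = 0.
Proof. move=> /(_ k k); lia. Qed.

Lemma ext_exch_mut s k j i : e (mutation z s k) j i =
  if (j == k) || (i == inl k) then - e s j i
  else e s j i + (e s k i * pos_part (e s j (inl k)) + pos_part (- e s k i) * e s j (inl k)).
Proof.
case: i => [a|l] /=; rewrite ?mxE.
  rewrite orbC; have -> : (inl a == inl k :> idx) = (a == k) by [].
  by case: ifP => // _; rewrite mut_exch_entry.
rewrite /mut_coeff orbF; case: eqVneq => [->|_]; first by rewrite mxE.
rewrite /trop_add !mxE pos_part_min; ring.
Qed.

Lemma ext_cluster_mut_neq s k i : i != inl k -> X (mutation z s k) i = X s i.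
Proof.
case: i => //= a; have -> : (inl a != inl k :> idx) = (a != k) by [].
by case: s => B x y /= /negPf ->.
Qed.

Lemma ext_cluster_mut s k : (forall j, z j != 0) -> cluster s k != 0 ->
  X s (inl k) * X (mutation z s k) (inl k) = exchange s k.
Proof.
move=> z0; case: s => B x y /= xk0; rewrite eqxx mulrCA.
rewrite /exchange /plus_mon /minus_mon /mon !big_sumType /=.
set Mp := \prod_(i < n) x i ^ pos_part (B i k).
set Mm := \prod_(i < n) x i ^ pos_part (- B i k).
set t := trop_val z (trop_add (y k) 0).
have tE : t = (\prod_(j < m) z j ^ pos_part (- (y k) 0 j))^-1.
  rewrite /t /trop_val -prodfV; apply: eq_bigr => j _; rewrite invr_expz !mxE.
  congr (_ ^ _); rewrite /pos_part; lia.
have yE : trop_val z (y k) =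
    (\prod_(j < m) z j ^ pos_part ((y k) 0 j)) / \prod_(j < m) z j ^ pos_part (- (y k) 0 j).
  rewrite -prodf_div; apply: eq_bigr => j _.
  by rewrite invr_expz -expfzDr // pos_partB.
rewrite yE tE; set Zm := \prod_(j < m) z j ^ pos_part (- _); field.
by rewrite xk0 andbT; apply/prodf_neq0 => j _; apply: expfz_neq0.
Qed.

Section Good.
Variable s : seed F n m.
Hypothesis gs : good s.

Let X0 i : X s i != 0. Proof. exact: good_neq0. Qed.
Let z0 j : z j != 0. Proof. exact: (X0 (inr j)). Qed.
Let skew_s : skew s. Proof. by case: gs. Qed.

Lemma mutE k : X s (inl k) * X (mutation z s k) (inl k) = exchange s k.
Proof. by apply: ext_cluster_mut => //; apply: (X0 (inl k)). Qed.

Lemma ext_exch_kk k : e s k (inl k) = 0.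
Proof. exact: skew_diag. Qed.

Lemma lauring_mon_off (B : pred idx) (v : idx -> int) :
  (forall i, ~~ B i -> v i = 0) -> lauring (X s) B B (mon (X s) v).
Proof.
move=> vB; apply: lauring_mon => i vi; rewrite ?andbb; apply: contraT => /vB vi0;
by rewrite vi0 ltxx in vi.
Qed.

Lemma exchange_lauring k : lauring (X s) (all_but (inl k)) (all_but (inl k)) (exchange s k).
Proof.
apply: (subringD (lauring_subring _ _ _)); apply: lauring_mon_off => i; rewrite negbK => /eqP ->;
by rewrite ext_exch_kk.
Qed.

(** If the exchange binomial vanished its two monomials would be opposite,
    whereas distinct monomials are independent. *)
Lemma exchange_neq0 k : exchange s k != 0.
Proof.
have [indX _ rank] := gs.
have [i ei] : exists i, e s k i != 0.
  apply/existsP; apply: contraT; rewrite negb_exists => /forallP e0.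
  suff : ((k == k)%:Z = 0) by rewrite eqxx.
  apply: (rank (fun j => (j == k)%:Z)) => i; rewrite (bigD1 k) //= eqxx mul1r big1 ?addr0; first by apply/eqP; have := e0 i; rewrite negbK.
  by move=> j /negPf ->; rewrite mul0r.
apply/eqP => /eqP; rewrite /exchange addr_eq0 => /eqP PM.
have := mon_neq1 (v := fun i => e s k i * 2%:Z) indX (_ : e s k i * 2%:Z != 0).
case/(_ _)/eqP; first by move: ei; lia.
rewrite monX.
have -> : mon (X s) (e s k) = plus_mon s k / minus_mon s k.
  by rewrite /plus_mon /minus_mon -(monB X0); apply: eq_mon => // j; rewrite pos_partB.
by rewrite PM mulNr divff ?mon_neq0 // -exprnP sqrrN expr1n.
Qed.

(** The new variable is the exchange binomial divided by the old one, which
    preserves independence; the new columns are combinations of the old ones with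
    an invertible matrix of coefficients, which preserves the rank. *)
Lemma good_mutation k : good (mutation z s k).
Proof.
have [indX _ rank] := gs.
split.
- apply: (independent_replace (X := X s) (k := inl k)) => //.
    by move=> i; apply: ext_cluster_mut_neq.
  set E := lauring _ _ _.
  have sE : subring E by apply: lauring_subring.
  have -> : X (mutation z s k) (inl k) = exchange s k / X s (inl k).
    by rewrite -mutE mulrC mulKf.
  move=> p Ep pT.
  (* multiplying by a power of the old variable reverses the polynomial *)
  pose q := \poly_(i < size p) (p`_((size p).-1 - i) * exchange s k ^+ ((size p).-1 - i)).
  have q0 : q = 0.
    apply: (indX (inl k)).
      move=> i; rewrite coef_poly; case: ifP => _; last exact: (subring0 sE).
      by apply: (subringM sE) => //; apply: (subringX sE); apply: exchange_lauring.
    transitivity (p.[exchange s k / X s (inl k)] * X s (inl k) ^+ (size p).-1); last by rewrite pT mul0r.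
    rewrite horner_poly horner_coef mulr_suml (reindex_inj rev_ord_inj) /=.
    apply: eq_bigr => i _.
    have lt_i : (i < size p)%N := ltn_ord i.
    have iE : ((size p).-1 - (size p - i.+1) = i)%N by lia.
    rewrite iE exprMn exprVn -!mulrA; congr (_ * (_ * _)).
    have -> : (size p).-1 = (i + (size p - i.+1))%N by lia.
    by rewrite exprD mulKf //; apply: (expf_neq0 _ (X0 (inl k))).
  apply/polyP => i; rewrite coef0; have [lt_i|ge_i] := ltnP i (size p); last exact: nth_default.
  move/polyP: q0 => /(_ ((size p).-1 - i)%N); rewrite coef_poly coef0 ifT; last by lia.
  rewrite subKn; last by lia.
  by move=> /eqP; rewrite mulf_eq0 expf_eq0 (negPf (exchange_neq0 k)) andbF orbF => /eqP.
- move=> a b.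
  have := ext_exch_mut s k b (inl a); have := ext_exch_mut s k a (inl b).
  rewrite /= -/(mut_exch k (exch s)) => -> ->.
  have inlE (c d : 'I_n) : (inl c == inl d :> idx) = (c == d) by [].
  rewrite !inlE orbC; case: ifP => _; first by rewrite skew_s.
  by rewrite (skew_s b a) (skew_s k a) (skew_s k b); ring.
- move=> c c0.
  have cE i : \sum_j c j * e (mutation z s k) j i = c k * e (mutation z s k) k i +
      \sum_(j | j != k) c j * e (mutation z s k) j i by rewrite (bigD1 k).
  have ckE : \sum_(j | j != k) c j * e s j (inl k) = 0.
    apply: oppr_inj; rewrite oppr0 -[RHS](c0 (inl k)) cE ext_exch_mut eqxx orTb.
    rewrite ext_exch_kk oppr0 mulr0 add0r -sumrN.
    by apply: eq_bigr => j _; rewrite ext_exch_mut eqxx orbT mulrN.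
  pose d j := if j == k then \sum_(j | j != k) c j * pos_part (e s j (inl k)) - c k else c j.
  have d0 : forall j, d j = 0.
    apply: rank => i; rewrite (bigD1 k) //= {1}/d eqxx.
    have -> : \sum_(j | j != k) d j * e s j i = \sum_(j | j != k) c j * e s j i.
      by apply: eq_bigr => j /negPf jk; rewrite /d jk.
    have [->|ik] := eqVneq i (inl k); first by rewrite ext_exch_kk mulr0 add0r.
    rewrite -[RHS](c0 i) cE ext_exch_mut eqxx orTb.
    transitivity (c k * - e s k i + (\sum_(j | j != k) c j * e s j i +
       ((\sum_(j | j != k) c j * pos_part (e s j (inl k))) * e s k i +
       (\sum_(j | j != k) c j * e s j (inl k)) * pos_part (- e s k i)))).
      by rewrite ckE; ring.
    congr (_ + _); rewrite !mulr_suml -!big_split; apply: eq_bigr => j /negPf jk /=.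
    by rewrite ext_exch_mut jk (negPf ik) /=; ring.
  have cj j : j != k -> c j = 0 by move=> /negPf jk; have := d0 j; rewrite /d jk.
  move=> j; have [->|/cj//] := eqVneq j k.
  have := d0 k; rewrite /d eqxx big1 => [|i /cj ->]; last by rewrite mul0r.
  lia.
Qed.

End Good.
End SeedTheory.


(** ** Rank two *)

Section Localization.
Variables (F : fieldType) (R : set F) (u : F).
Hypotheses (sR : subring R) (Ru : R u).

Definition localization : set F := [set f | exists N, R (u ^+ N * f)].

Lemma localization_subring : subring localization.
Proof.
have up N M f : R (u ^+ N * f) -> R (u ^+ (M + N) * f).
  by rewrite exprD -mulrA => Rf; apply: (subringM sR) => //; apply: (subringX sR).
split=> [|f g [N RN] [M RM]|f g [N RN] [M RM]].
- by exists 0%N; rewrite mul1r; apply: (subring1 sR).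
- exists (M + N)%N; rewrite mulrBr; apply: (subringB sR); first exact: up.
  by rewrite addnC; apply: up.
- by exists (N + M)%N; rewrite exprD mulrACA; apply: (subringM sR).
Qed.

Lemma localizationC f : R f -> localization f.
Proof. by exists 0%N; rewrite mul1r. Qed.

Lemma localization1 f : R (u * f) -> localization f.
Proof. by exists 1%N. Qed.
End Localization.

(** With [Pk = Ak * Tj ^+ b + Ck] the exchange binomial of [Tk], an element
    [f] of the three given Laurent rings is a fraction over [R] with denominator
    a power of [Pk] (write [f] as a polynomial in [Tj] and [Tj'], which are both
    in [R]), and also one with denominator a power of [Tj * Tj'']. As [b > 0]
    these two are comaximal in [R]. *)
Lemma rank_two_linked (F : fieldType) (D R : set F) (Tk Tk' Tj Tj' Tj'' Ak Ck Aj Cj V f : F) b :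
  subring D -> subring R -> D `<=` R -> (0 < b)%N ->
  D Ak -> D Ck -> D Ck^-1 -> D Aj -> D Cj -> D V -> D V^-1 ->
  R Tk' -> R Tk'^-1 -> R Tj'' -> R Tj''^-1 ->
  Tk != 0 -> Tk' != 0 -> Tj' != 0 -> Tj'' != 0 -> Ck != 0 -> V != 0 ->
  Tk * Tk' = Ak * Tj ^+ b + Ck ->
  Tj * Tj' = Aj + Cj * Tk ^+ b ->
  Tj * Tj'' = V * (Aj * Tk' ^+ b + Cj * Ck ^+ b) ->
  transcendental (laurent D Tk) Tj ->
  laurent (laurent D Tk) Tj f -> laurent (laurent D Tk) Tj' f ->
  laurent (laurent D Tk') Tj f -> R f.
Proof.
move=> sD sR sDR b0 DAk DCk DCk' DAj DCj DV DV' RTk RTk' RTj RTj' Tk0 Tk'0 Tj'0 Tj''0 Ck0 V0.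
set Pk := Ak * _ + _; set u := V * _ => kE jE j'E tr fL fLj fLk.
have sDk := laurent_subring sD Tk.
have Tj0 := transcendental_neq0 sDk tr.
have Tb : Tj ^+ b = Tj * Tj ^+ b.-1 by rewrite -exprS prednK.
have Ru : R u.
  apply: (subringM sR); first exact: sDR.
  apply: (subringD sR); apply: (subringM sR); try exact: sDR; apply: (subringX sR) => //.
  exact: sDR.
have Tj_R : R Tj by rewrite -[Tj](mulfK Tj''0) j'E; apply: (subringM sR).
have RPk : R Pk.
  apply: (subringD sR); last exact: sDR.
  by apply: (subringM sR); [exact: sDR|apply: (subringX sR)].
have RTk_ : R Tk by rewrite -[Tk](mulfK Tk'0) kE; apply: (subringM sR).
have Tj'_R : R Tj'.
  (* [Tj'] differs from a monomial multiple of [Tj''] by an element of [R] *)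
  have -> : Tj' = V^-1 * Tk'^-1 ^+ b * Tj'' +
      Cj * Tk'^-1 ^+ b * (Ak * Tj ^+ b.-1 * \sum_(i < b) Pk ^+ (b.-1 - i) * Ck ^+ i).
    apply: (mulfI Tj0); rewrite jE mulrDr.
    have -> : Tj * (V^-1 * Tk'^-1 ^+ b * Tj'') = V^-1 * Tk'^-1 ^+ b * u by rewrite -j'E; ring.
    have -> : Tj * (Cj * Tk'^-1 ^+ b * (Ak * Tj ^+ b.-1 * \sum_(i < b) Pk ^+ (b.-1 - i) * Ck ^+ i)) =
        Cj * Tk'^-1 ^+ b * ((Pk - Ck) * \sum_(i < b) Pk ^+ (b.-1 - i) * Ck ^+ i).
      by move: (\sum_(i < b) _) => G; rewrite /Pk addrK Tb; ring.
    rewrite -subrXX // -kE /u exprMn exprVn; field.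
    by rewrite V0 expf_neq0.
  apply: (subringD sR).
    by apply: (subringM sR) => //; apply: (subringM sR); [apply: sDR|apply: (subringX sR)].
  apply: (subringM sR).
    by apply: (subringM sR); [apply: sDR|apply: (subringX sR)].
  apply: (subringM sR).
    by apply: (subringM sR); [apply: sDR|apply: (subringX sR)].
  apply: (subring_sum sR) => i _.
  by apply: (subringM sR); apply: (subringX sR) => //; apply: sDR.
have [N RN] : localization R Pk f.
  have sW := localization_subring sR RPk.
  have DkW : laurent D Tk `<=` localization R Pk.
    apply: sub_laurent => //.
    - by move=> g Dg; apply: localizationC; apply: sDR.
    - exact: localizationC.
    - by apply: localization1; rewrite -kE mulrAC divff // mul1r.
  have Pkj : laurent D Tk (Tj * Tj').
    rewrite jE; apply: (subringD sDk); first exact: laurentC.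
    by apply: (subringM sDk); [exact: laurentC|apply: (subringX sDk); exact: laurentX].
  have [p [q [Ep Eq] ->]] := laurent_exchange sDk tr Pkj Tj'0 fL fLj.
  by apply: (subringD sW); [apply: (horner_on sW DkW _ Ep)|apply: (horner_on sW DkW _ Eq)];
    apply: localizationC.
have [M RM] : localization R u f.
  have sW := localization_subring sR Ru.
  move: fLk; apply: sub_laurent => //.
  - apply: sub_laurent => //; try exact: localizationC.
    by move=> g Dg; apply: localizationC; apply: sDR.
  - exact: localizationC.
  - by apply: localization1; rewrite -j'E mulrAC divff // mul1r.
apply: (comaximal_frac (u := Pk) (v := u) (a := Ck^-1)
  (b := - (Ck^-1 * Ak * Tj ^+ b.-1 * Tj''^-1)) sR _ _ _ _ _ RN RM) => //.
- exact: sDR.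
- apply: (subringN sR); apply: (subringM sR) => //.
  by apply: (subringM sR); [apply: (subringM sR); apply: sDR|apply: (subringX sR)].
by rewrite -j'E /Pk Tb; field; rewrite Tj''0 Ck0.
Qed.

(** ** The upper bound of a seed *)

Section Upper.
Variables (F : fieldType) (n m : nat) (z : 'I_m -> F).
Local Notation idx := ('I_n + 'I_m)%type.
Local Notation X := (ext_cluster z).
Local Notation e := ext_exch.
Local Notation mu s k := (mutation z s k).
Implicit Types (s t : seed F n m) (k j : 'I_n) (i : idx) (f : F).

Lemma exchange_mut s k : good z s -> exchange z (mu s k) k = exchange z s k.
Proof.
move=> gs; have gs' := good_mutation gs k.
have e'k i : e (mu s k) k i = - e s k i by rewrite ext_exch_mut eqxx.
have supp i v : (e s k i = 0 -> v = 0) -> v != 0 -> X (mu s k) i = X s i.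
  move=> v0 vn0; apply: ext_cluster_mut_neq; apply: contra_neq vn0 => ik.
  by apply: v0; rewrite ik (ext_exch_kk gs).
rewrite /exchange /plus_mon /minus_mon addrC; congr (_ + _); apply: eq_mon => i.
- by rewrite e'k opprK.
- by apply: supp; rewrite e'k opprK => ->.
- by rewrite e'k.
- by apply: supp; rewrite e'k => ->; rewrite oppr0.
Qed.

Lemma mutationK s k : good z s -> mu (mu s k) k = s.
Proof.
move=> gs; have gs' := good_mutation gs k.
have exchE j i : e (mu (mu s k) k) j i = e s j i.
  have e'k i' : e (mu s k) k i' = - e s k i' by rewrite ext_exch_mut eqxx.
  have e'j : e (mu s k) j (inl k) = - e s j (inl k) by rewrite ext_exch_mut eqxx orbT.
  rewrite (ext_exch_mut _ (mu s k)) e'k e'j opprK ext_exch_mut.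
  case: (_ || _); first by rewrite opprK.
  have aE := pos_partB (e s k i); have bE := pos_partB (e s j (inl k)).
  transitivity (e s j i + e s k i * (pos_part (e s j (inl k)) - pos_part (- e s j (inl k)))
    - e s j (inl k) * (pos_part (e s k i) - pos_part (- e s k i))); first by ring.
  by rewrite aE bE; ring.
have clE i : X (mu (mu s k) k) i = X s i.
  have [->|ik] := eqVneq i (inl k); last by rewrite !ext_cluster_mut_neq.
  have X0 := good_neq0 (inl k) gs'; apply: (mulfI X0).
  by rewrite mutE // mulrC mutE // exchange_mut.
case: s gs {gs'} exchE clE => B x y gs exchE clE.
have -> : mu (mu (Seed B x y) k) k = Seed (exch (mu (mu (Seed B x y) k) k))
   (cluster (mu (mu (Seed B x y) k) k)) (coeff (mu (mu (Seed B x y) k) k)) by [].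
congr Seed.
- by apply/matrixP => a j; apply: (exchE j (inl a)).
- by apply/funext => a; apply: (clE (inl a)).
- by apply/funext => j; apply/rowP => l; apply: (exchE j (inr l)).
Qed.
End Upper.


Section Upper.
Variables (F : fieldType) (n m : nat) (z : 'I_m -> F).
Local Notation idx := ('I_n + 'I_m)%type.
Local Notation X := (ext_cluster z).
Local Notation e := ext_exch.
Local Notation mu s k := (mutation z s k).
Implicit Types (s t : seed F n m) (k j : 'I_n) (i : idx) (f : F).

(** The Laurent ring of a seed over [ZP], and the one over [ZPplus] in which the
    frozen variables are not inverted. *)
Definition laurent_seed s : set F := lauring (X s) predT predT.
Definition laurent_plus s : set F := lauring (X s) predT (fun i => if i is inl _ then true else false).

Definition all_but2 (a b : idx) : pred idx := fun i => (i != a) && (i != b).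

Lemma ext_exch_skew s j k : good z s -> e s j (inl k) = - e s k (inl j).
Proof. by case=> _ sk _; apply: sk. Qed.

(** Here an element of both Laurent rings can be written over the target ring with
    denominator a power of either exchange binomial; the two binomials form a
    regular sequence, as the columns [j] and [k] are independent. *)
Lemma rank_two_unlinked s j k f : good z s -> j != k -> e s k (inl j) = 0 ->
  laurent_seed (mu s k) f -> laurent_seed (mu s j) f ->
  laurent_seed (mu (mu s k) j) f.
Proof.
move=> gs jk ekj Lk Lj.
have gk := good_mutation gs k; have gkj := good_mutation gk j; have gj := good_mutation gs j.
have ejk : e s j (inl k) = 0 by rewrite (ext_exch_skew _ _ gs) ekj oppr0.
have indX := let: And3 h _ _ := gkj in h.
have X0 t i : good z t -> X t i != 0 by apply: good_neq0.
set X'' := X (mu (mu s k) j); set R := laurent_seed (mu (mu s k) j).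
have sR : subring R by apply: lauring_subring.
have inlE (a b : 'I_n) : (inl a == inl b :> idx) = (a == b) by [].
have X''E i : i != inl j -> i != inl k -> X'' i = X s i.
  by move=> ij ik; rewrite /X'' !ext_cluster_mut_neq.
have supp l (v : int) i : l = k \/ l = j -> (e s l i = 0 -> v = 0) -> v != 0 -> X s i = X'' i.
  move=> lE v0 vn0; rewrite X''E //; apply: contra_neq vn0 => iE; apply: v0; rewrite iE;
  by case: lE => ->; rewrite ?ekj ?ejk ?(ext_exch_kk gs).
have monE l : l = k \/ l = j -> exchange z s l =
    mon X'' (fun i => pos_part (e s l i)) + mon X'' (fun i => pos_part (- e s l i)).
  by move=> lE; congr (_ + _); apply: eq_mon => // i; apply: (supp l) => // ->; rewrite ?oppr0.
have exch_j : exchange z (mu s k) j = exchange z s j.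
  have e'j i : e (mu s k) j i = e s j i.
    rewrite ext_exch_mut (negPf jk) orFb ejk.
    by case: eqP => [->|_]; rewrite ?ejk ?oppr0 // pos_part_eq0 // !mulr0 !addr0.
  congr (_ + _); apply: eq_mon => i; rewrite ?e'j // => vn0;
    apply: ext_cluster_mut_neq; apply: contra_neq vn0 => ->; by rewrite ejk.
have Tk' : X'' (inl k) = X (mu s k) (inl k).
  by rewrite /X'' ext_cluster_mut_neq // inlE eq_sym.
have mk : X s (inl k) * X'' (inl k) = exchange z s k by rewrite Tk' mutE.
have mj : X s (inl j) * X'' (inl j) = exchange z s j.
  rewrite -exch_j -mutE // ext_cluster_mut_neq // inlE //.
have RX i : R (X'' i) by apply: lauring_var.
have RXV i : R (X'' i)^-1 by apply: lauring_inv.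
have Rex l : l = k \/ l = j -> R (exchange z s l).
  by move=> /monE ->; apply: (subringD sR); apply: lauring_mon.
have loc a b : (a = k /\ b = j) \/ (a = j /\ b = k) -> laurent_seed (mu s a) f ->
    exists N, R (exchange z s b ^+ N * f).
  move=> ab La; have [ak bk] : (a = k \/ a = j) /\ (b = k \/ b = j) by case: ab => -[-> ->]; auto.
  have sW := localization_subring sR (Rex b bk).
  have mb : X s (inl b) * X'' (inl b) = exchange z s b by case: bk => ->.
  have ma : X s (inl a) * X'' (inl a) = exchange z s a by case: ak => ->.
  have aE : X (mu s a) (inl a) = X'' (inl a).
    by apply: (mulfI (X0 s (inl a) gs)); rewrite ma mutE.
  have bE : X (mu s a) (inl b) = X s (inl b).
    by apply: ext_cluster_mut_neq; rewrite inlE; case: ab => -[-> ->]; rewrite // eq_sym.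
  have b0 : X'' (inl b) != 0 := X0 _ (inl b) gkj.
  have other i : i != inl a -> i != inl b -> X (mu s a) i = X'' i.
    move=> ia ib; rewrite ext_cluster_mut_neq // X''E //;
    by case: ab ia ib => -[-> ->].
  suff sub : laurent_seed (mu s a) `<=` localization R (exchange z s b) by exact: sub.
  apply: lauring_min => // i _.
    have [->|ia] := eqVneq i (inl a); first by rewrite aE; apply: localizationC.
    have [->|ib] := eqVneq i (inl b); last by rewrite other //; apply: localizationC.
    rewrite bE; apply: localizationC; rewrite -[X s _](mulfK b0) mb.
    by apply: (subringM sR) => //; apply: Rex.
  have [->|ia] := eqVneq i (inl a); first by rewrite aE; apply: localizationC.
  have [->|ib] := eqVneq i (inl b); last by rewrite other //; apply: localizationC.
  by rewrite bE; apply: localization1; rewrite -mb mulrAC divff ?mul1r // X0.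
have [N RN] := loc j k (or_intror (conj erefl erefl)) Lj.
have [M RM] := loc k j (or_introl (conj erefl erefl)) Lk.
apply: (regular_frac sR (u := exchange z s j) (v := exchange z s k) _ _ _ _ RM RN).
- by apply: Rex; right.
- by apply: Rex; left.
- exact: exchange_neq0.
rewrite !monE; [|by right|by left]; apply: regular_binomials => // a b ab.
have [_ _ rank] := gs.
have := rank (fun l => (if l == k then a else 0) - (if l == j then b else 0)).
have kj : (k == j) = false by rewrite eq_sym (negPf jk).
move=> c0; have {}c0 : forall l, (if l == k then a else 0) - (if l == j then b else 0) = 0.
  apply: c0 => i; rewrite (bigD1 k) //= (bigD1 j) //= big1 => [|l /andP[/negPf -> /negPf ->]]; last first.
    by rewrite subrr mul0r.
  have := ab i; rewrite !pos_partB eqxx kj (negPf jk) eqxx subr0 sub0r addr0 => ->.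
  by ring.
split; first by have := c0 k; rewrite eqxx kj subr0.
by have := c0 j; rewrite eqxx (negPf jk) sub0r => /eqP; rewrite oppr_eq0 => /eqP.
Qed.

(** When [j] and [k] are linked, exactly one monomial of the exchange binomial at
    [k] contains [x_j], which is the situation of [rank_two_linked] over the Laurent
    ring in the remaining variables. *)
Lemma rank_two s j k f : good z s -> j != k ->
  laurent_seed s f -> laurent_seed (mu s k) f -> laurent_seed (mu s j) f ->
  laurent_seed (mu (mu s k) j) f.
Proof.
move=> gs jk Ls Lk Lj.
have [ekj|ekj] := eqVneq (e s k (inl j)) 0; first exact: rank_two_unlinked.
have gk := good_mutation gs k; have gkj := good_mutation gk j; have gj := good_mutation gs j.
have X0 t i : good z t -> X t i != 0 by apply: good_neq0.
have inlE (a b : 'I_n) : (inl a == inl b :> idx) = (a == b) by [].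
have kj : (k == j) = false by rewrite eq_sym (negPf jk).
(* the sign [g] makes the entry [b] of [vk] at [j] positive *)
have [g [gE g_pos]] : exists g : int, (g = 1 \/ g = -1) /\ 0 < g * e s k (inl j).
  have [e0|e0|e0] := ltrgtP 0 (e s k (inl j)); last by rewrite -e0 eqxx in ekj.
    by exists 1; rewrite mul1r; auto.
  by exists (-1); rewrite mulN1r oppr_gt0; auto.
pose vk i := g * e s k i; pose vj i := g * e s j i; pose vj' i := g * e (mu s k) j i.
have exchE t l : exchange z t l = mon (X t) (fun i => pos_part (g * e t l i)) +
    mon (X t) (fun i => pos_part (- (g * e t l i))).
  case: gE => ->; [|rewrite addrC]; congr (_ + _); apply: eq_mon => // i;
  by rewrite ?mul1r ?mulN1r ?opprK.
case bE: (g * e s k (inl j)) g_pos => [b|//] b0.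
have vkj : vk (inl j) = b by [].
have vjk : vj (inl k) = - b%:Z by rewrite /vj (ext_exch_skew _ _ gs) mulrN bE.
have vkk : vk (inl k) = 0 by rewrite /vk (ext_exch_kk gs) mulr0.
have vjj : vj (inl j) = 0 by rewrite /vj (ext_exch_kk gs) mulr0.
have vj'k : vj' (inl k) = b by rewrite /vj' ext_exch_mut eqxx orbT mulrN -/(vj _) vjk opprK.
have vj'E i : i != inl k -> vj' i = vj i - b%:Z * pos_part (- vk i).
  move=> ik; rewrite /vj' ext_exch_mut (negPf jk) (negPf ik) mulrDr -/(vj i); congr (_ + _).
  have ejE : e s j (inl k) = - e s k (inl j) by apply: ext_exch_skew.
  move: bE; rewrite /vk ejE; case: gE => ->; rewrite ?mul1r ?mulN1r.
    by move=> ->; rewrite pos_part_eq0 ?oppr_le0 // mulr0 add0r; ring.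
  move=> ->; rewrite pos_part_id // opprK -{1}(pos_partB (e s k i)); ring.
pose Z := all_but2 (inl k) (inl j).
pose D := lauring (X s) Z Z.
have sD : subring D by apply: lauring_subring.
have D_mon v : v (inl k) = 0 -> v (inl j) = 0 -> D (mon (X s) v).
  move=> vk0 vj0; apply: lauring_mon => i vi; rewrite ?andbb /Z /all_but2; apply/andP;
  by split; apply: contraTneq vi => ->; rewrite ?vk0 ?vj0 ltxx.
pose Ak := mon (X s) (off (inl j) (fun i => pos_part (vk i))).
pose Ck := mon (X s) (fun i => pos_part (- vk i)).
pose Aj := mon (X s) (fun i => pos_part (vj i)).
pose Cj := mon (X s) (off (inl k) (fun i => pos_part (- vj i))).
pose V := mon (X s) (off (inl k) (fun i => pos_part (vj' i) - pos_part (vj i))).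
have pos0 : pos_part 0 = 0 by [].
have posN : pos_part (- b%:Z) = 0 by rewrite pos_part_eq0 // oppr_le0.
have vj'j : vj' (inl j) = 0.
  by rewrite vj'E ?inlE ?jk // vjj vkj posN mulr0 subr0.
have posb : pos_part b = b by rewrite pos_part_id.
have DV : D V by apply: D_mon; rewrite /off ?eqxx // inlE (negPf jk) vj'j vjj subrr.
have DV' : D V^-1.
  rewrite -monN; apply: D_mon; rewrite /off ?eqxx ?oppr0 // inlE (negPf jk) vj'j vjj subrr oppr0 //.
have DCk : D Ck by apply: D_mon; rewrite ?vkk ?vkj ?posN // oppr0.
have DCk' : D Ck^-1 by rewrite -monN; apply: D_mon; rewrite ?vkk ?vkj ?posN ?oppr0.
have X0s i : X s i != 0 by apply: X0.
set R := laurent_seed (mu (mu s k) j).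
have sR : subring R by apply: lauring_subring.
have X''E i : Z i -> X (mu (mu s k) j) i = X s i.
  by case/andP=> ik ij; rewrite !ext_cluster_mut_neq.
have Tk'E : X (mu (mu s k) j) (inl k) = X (mu s k) (inl k).
  by rewrite ext_cluster_mut_neq // inlE kj.
have exprE (x : F) (p : nat) : x ^ p%:Z = x ^+ p by [].
have two t : good z t -> (forall i, Z i -> X t i = X s i) ->
    laurent_seed t `<=` laurent (laurent D (X t (inl k))) (X t (inl j)).
  move=> gt tE; set E := laurent D _; have sE : subring E by apply: laurent_subring.
  have sEj := laurent_subring sE (X t (inl j)).
  apply: lauring_min => // i _.
    have [->|ij] := eqVneq i (inl j); first exact: laurentX.
    apply: (laurentC sE); have [->|ik] := eqVneq i (inl k); first exact: laurentX.
    by apply: (laurentC sD); rewrite tE; [apply: lauring_var|]; apply/andP.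
  have [->|ij] := eqVneq i (inl j); first by apply: laurentV => //; apply: X0.
  apply: (laurentC sE); have [->|ik] := eqVneq i (inl k); first by apply: laurentV => //; apply: X0.
  by apply: (laurentC sD); rewrite tE; [apply: lauring_inv|]; apply/andP.
apply: (rank_two_linked (D := D) (Tk := X s (inl k)) (Tk' := X (mu s k) (inl k))
  (Tj := X s (inl j)) (Tj' := X (mu s j) (inl j)) (Tj'' := X (mu (mu s k) j) (inl j))
  (Ak := Ak) (Ck := Ck) (Aj := Aj) (Cj := Cj) (V := V) (b := b)) => //.
- by apply: lauring_sub => i Zi; rewrite X''E.
- by apply: D_mon; rewrite /off ?eqxx // inlE kj vkk.
- by apply: D_mon; rewrite ?vjk ?posN // vjj.
- by apply: D_mon; rewrite /off ?eqxx // inlE (negPf jk) vjj oppr0.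
- by rewrite -Tk'E; apply: lauring_var.
- by rewrite -Tk'E; apply: lauring_inv.
- exact: lauring_var.
- exact: lauring_inv.
- exact: X0.
- exact: X0.
- exact: X0.
- exact: mon_neq0.
- exact: mon_neq0.
- by rewrite mutE // exchE (mon_off _ (inl j)) -/(vk _) vkj posb exprE mulrC.
- by rewrite mutE // exchE [X in _ + X](mon_off _ (inl k)) -/(vj _) vjk opprK posb exprE mulrC.
- have -> : X s (inl j) = X (mu s k) (inl j) by rewrite ext_cluster_mut_neq // inlE.
  rewrite mutE // exchE (mon_off _ (inl k)) -/(vj' _) vj'k posb exprE mulrDr mulrA [in RHS]mulrC.
  have toX v : v (inl k) = 0 -> mon (X (mu s k)) v = mon (X s) v.
    move=> v0; apply: eq_mon => // i vi0; apply: ext_cluster_mut_neq.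
    by apply: contra_neq vi0 => ->.
  congr (_ + _).
    congr (_ * _); rewrite toX /off ?eqxx // /V /Aj -monD //; apply: eq_mon => // i.
    rewrite /off; case: eqVneq => [->|_]; last by rewrite -/(vj' i); ring.
    by rewrite vjk posN addr0.
  rewrite toX; last by rewrite -/(vj' _) vj'k posN.
  rewrite /V /Cj /Ck -exprE -monX -!monD //; apply: eq_mon => // i; rewrite /off -/(vj' i).
  case: eqVneq => [->|ik]; first by rewrite vj'k vkk oppr0 pos0 posN mul0r !addr0.
  have := pos_partB (vj' i); have := pos_partB (vj i); rewrite (vj'E i ik).
  by move: (pos_part _) (pos_part _) (pos_part _) (pos_part _) (pos_part _) => p1 p2 p3 p4 p5; lia.
- have [indX _ _] := gs.
  apply: sub_transcendental (indX (inl j)); apply: sub_laurent => //.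
  + exact: lauring_subring.
  + by apply: lauring_sub => i /andP[].
  + by apply: lauring_var; rewrite /all_but inlE kj.
  + by apply: lauring_inv; rewrite /all_but inlE kj.
- exact: two.
- have -> : X s (inl k) = X (mu s j) (inl k) by rewrite ext_cluster_mut_neq // inlE kj.
  by apply: two => // i /andP[ik ij]; rewrite ext_cluster_mut_neq.
- have -> : X s (inl j) = X (mu s k) (inl j) by rewrite ext_cluster_mut_neq // inlE.
  by apply: two => // i /andP[ik ij]; rewrite ext_cluster_mut_neq.
Qed.
End Upper.


Section Laurent.
Variables (F : fieldType) (n m : nat) (z : 'I_m -> F).
Local Notation idx := ('I_n + 'I_m)%type.
Local Notation X := (ext_cluster z).
Local Notation e := ext_exch.
Local Notation mu s k := (mutation z s k).
Implicit Types (s t : seed F n m) (k j : 'I_n) (i : idx) (f : F).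

(** The upper bound of Berenstein, Fomin and Zelevinsky. *)
Definition upper_bound s : set F :=
  [set f | laurent_seed z s f /\ forall k, laurent_seed z (mu s k) f].

(** The neighbours of the neighbour at [k] are the seed itself and the ends of
    walks of length two. *)
Lemma upper_bound_mutation s k : good z s -> upper_bound s `<=` upper_bound (mu s k).
Proof.
move=> gs f [Ls Lk]; split=> // j; have [->|jk] := eqVneq j k; first by rewrite mutationK.
exact: rank_two.
Qed.

Lemma good_walk s ks : good z s -> good z (foldl (mutation z) s ks).
Proof. by elim: ks s => [|k ks IH] s gs //=; apply/IH/good_mutation. Qed.

Lemma upper_bound_walk s ks : good z s ->
  upper_bound s = upper_bound (foldl (mutation z) s ks).
Proof.
elim: ks s => [|k ks IH] s gs //=; rewrite -IH; last exact: good_mutation.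
apply/seteqP; split; first exact: upper_bound_mutation.
rewrite -{2}(mutationK k gs); apply: upper_bound_mutation; exact: good_mutation.
Qed.

Lemma cluster_upper_bound s (i : 'I_n) : good z s -> upper_bound s (cluster s i).
Proof.
move=> gs; split=> [|k]; first exact: (lauring_var (X := X s) (i := inl i)).
have [->|ik] := eqVneq i k; last first.
  have <- : X (mu s k) (inl i) = cluster s i by rewrite ext_cluster_mut_neq.
  exact: lauring_var.
have gk := good_mutation gs k.
have -> : cluster s k = exchange z (mu s k) k / X (mu s k) (inl k).
  by rewrite exchange_mut // -mutE // mulfK // good_neq0.
apply: (subringM (lauring_subring _ _ _)); last exact: lauring_inv.
by apply: (subringD (lauring_subring _ _ _)); apply: lauring_mon.
Qed.

(** Both seeds have the same upper bound, which contains the cluster of the first. *)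
Lemma laurent_phenomenon s ks ls (i : 'I_n) : good z s ->
  laurent_seed z (foldl (mutation z) s ls) (cluster (foldl (mutation z) s ks) i).
Proof.
move=> gs; have := cluster_upper_bound i (good_walk ks gs).
by rewrite -upper_bound_walk // (upper_bound_walk ls gs) => -[].
Qed.

(** ** Frozen variables that are not inverted *)

(** A frozen variable divides at most one of the two monomials of an exchange
    binomial, which is therefore a nonzerodivisor modulo it. *)
Lemma regular_mod_frozen s k l : good z s ->
  regular_mod (laurent_plus z s) (z l) (exchange z s k).
Proof.
move=> gs; have [indX _ _] := gs; have X0 i : X s i != 0 by apply: good_neq0.
pose mut (i : idx) := if i is inl _ then true else false.
pose E := lauring (X s) (all_but (inr l)) mut.
have sE : subring E by apply: lauring_subring.
have RE : laurent_plus z s = adjoin E (z l).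
  apply/seteqP; split; first exact: (@lauring_adjoin _ _ (X s) predT mut (inr l)).
  move=> f [p Ep ->]; apply: (horner_on _ _ _ Ep).
  - exact: lauring_subring.
  - exact: lauring_sub.
  - exact: (lauring_var (X := X s) (i := inr l)).
have trl : transcendental E (z l).
  by apply: sub_transcendental (indX (inr l)); apply: lauring_sub => // -[].
have E_mon v : (forall i, 0 <= v i) -> v (inr l) = 0 -> E (mon (X s) v).
  move=> v0 vl; apply: lauring_mon => i vi.
    by apply: contraTneq vi => ->; rewrite vl ltxx.
  by have := v0 i; rewrite leNgt vi.
have split_mon v : (forall i, 0 <= v i) -> 0 < v (inr l) ->
    exists2 P1, adjoin E (z l) P1 & mon (X s) v = z l * P1.
  move=> v0 vl; exists (z l ^ (v (inr l) - 1) * mon (X s) (off (inr l) v)).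
    have sA := adjoin_subring sE (z l); apply: (subringM sA).
      apply: (subring_exprz sA); first exact: adjoinX.
      by rewrite ltNge; case/negP; lia.
    by apply: (adjoinC sE); apply: E_mon => [i|]; rewrite /off ?eqxx //; case: ifP.
  rewrite (mon_off _ (inr l)) mulrA; congr (_ * _).
  rewrite -{1}(subrK 1 (v (inr l))) expfzDr; last exact: (X0 (inr l)).
  by rewrite mulrC expr1z.
rewrite RE.
have reg u v : (forall i, 0 <= u i) -> (forall i, 0 <= v i) -> u (inr l) = 0 ->
    mon (X s) u + mon (X s) v != 0 ->
    regular_mod (adjoin E (z l)) (z l) (mon (X s) u + mon (X s) v).
  move=> u0 v0 ul uv; have Eu := E_mon u u0 ul.
  have := v0 (inr l); rewrite le_eqVlt => /orP[/eqP/esym vl|vl].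
    rewrite -[_ + _]addr0 -[X in _ + _ + X](mulr0 (z l)); apply: regular_mod_var => //.
      by apply: (subringD sE) => //; apply: E_mon.
    by apply: (subring0 (adjoin_subring sE _)).
  have [P1 EP1 ->] := split_mon v v0 vl.
  by apply: regular_mod_var => //; apply: mon_neq0.
have [e0|e0] := lerP (e s k (inr l)) 0.
  apply: reg => [i|i||]; try exact: pos_part_ge0; first exact: pos_part_eq0.
  exact: exchange_neq0.
rewrite /exchange addrC; apply: reg => [i|i||]; try exact: pos_part_ge0.
  by rewrite pos_part_eq0 // oppr_le0 ltW.
by rewrite addrC; apply: exchange_neq0.
Qed.

(** Over the ring of the new seed the expansion of [f] in the old seed has a power
    of the exchange binomial as denominator, and its expansion in the new seed a
    product of frozen variables; each frozen variable is cancelled against the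
    binomial. *)
Lemma laurent_plus_mutation s k f : good z s ->
  laurent_plus z s f -> laurent_seed z (mu s k) f -> laurent_plus z (mu s k) f.
Proof.
move=> gs Lf Lkf; have gk := good_mutation gs k.
set R := laurent_plus z (mu s k); have sR : subring R by apply: lauring_subring.
have X0 i : X (mu s k) i != 0 by apply: good_neq0.
have RX i : R (X (mu s k) i) by apply: lauring_var.
have RXV a : R (X (mu s k) (inl a))^-1 by apply: (lauring_inv (i := inl a)).
have RP : R (exchange z (mu s k) k).
  by apply: (subringD sR); apply: lauring_mon => // i; rewrite ltNge pos_part_ge0.
have [N RN] : localization R (exchange z (mu s k) k) f.
  have sW := localization_subring sR RP.
  have mk := mutE gk k; rewrite mutationK // in mk.
  move: f Lf {Lkf}; apply: lauring_min => //.
    move=> i _; have [->|ik] := eqVneq i (inl k); last first.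
      by rewrite -(ext_cluster_mut_neq z s ik); apply: localizationC.
    apply: localizationC; rewrite -[X s _](mulKf (X0 (inl k))) mk.
    by apply: (subringM sR).
  case=> // a _; have [->|ak] := eqVneq a k.
    apply: localization1; rewrite -mk mulfK //.
    exact: (good_neq0 (inl k) gs).
  by rewrite -(@ext_cluster_mut_neq _ _ _ z s k (inl a) ak); apply: localizationC.
pose Z (r : seq 'I_m) : F := \prod_(l <- r) z l.
have RZ r : R (Z r) by apply: (subring_prod sR) => l _; apply: (RX (inr l)).
have [M] : localization R (Z (index_enum 'I_m)) f.
  have sW := localization_subring sR (RZ (index_enum 'I_m)).
  move: f Lkf {Lf RN}; apply: lauring_min => //.
    by move=> i _; apply: localizationC.
  case=> [a|l] _; first exact: localizationC.
  apply: localization1; rewrite /Z (bigD1 l) //= mulrC mulKf; last exact: (X0 (inr l)).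
  by apply: (subring_prod sR) => j _; apply: (RX (inr j)).
elim: (index_enum _) => [|l r IH]; first by rewrite /Z big_nil expr1n mul1r.
rewrite /Z big_cons exprMn -mulrA => Rl; apply: IH.
apply: (regular_frac sR (u := exchange z (mu s k) k) (v := z l) (m := N) _ _ _ _ _ Rl) => //.
- exact: (RX (inr l)).
- exact: (X0 (inr l)).
- exact: regular_mod_frozen.
- by rewrite mulrCA; apply: (subringM sR) => //; apply: (subringX sR); apply: RZ.
Qed.

Lemma laurent_plus_walk s ks f : good z s -> laurent_plus z s f ->
  (forall ls, laurent_seed z (foldl (mutation z) s ls) f) ->
  laurent_plus z (foldl (mutation z) s ks) f.
Proof.
elim: ks s => [|k ks IH] s gs //= Lp Ls; apply: IH.
- exact: good_mutation.
- by apply: laurent_plus_mutation => //; apply: (Ls [:: k]).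
- by move=> ls; apply: (Ls (k :: ls)).
Qed.

Lemma walk_rev s ks : good z s ->
  foldl (mutation z) (foldl (mutation z) s ks) (rev ks) = s.
Proof.
elim: ks s => [|k ks IH] s gs //=; rewrite rev_cons -cats1 foldl_cat IH.
  by rewrite /= mutationK.
exact: good_mutation.
Qed.

(** Walk from the seed containing the cluster variable. *)
Lemma laurent_phenomenon_plus s ks ls (i : 'I_n) : good z s ->
  laurent_plus z (foldl (mutation z) s ls) (cluster (foldl (mutation z) s ks) i).
Proof.
move=> gs; pose t := foldl (mutation z) s ks.
have back l : foldl (mutation z) t (rev ks ++ l) = foldl (mutation z) s l.
  by rewrite foldl_cat walk_rev.
rewrite -back; apply: laurent_plus_walk.
- exact: good_walk.
- exact: (lauring_var (X := X t) (i := inl i)).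
- move=> l'; rewrite -foldl_cat; exact: laurent_phenomenon.
Qed.

(** ** The cluster algebra is contained in the upper cluster algebra *)

Lemma laurent_subalg_seed s : laurent_subalg (ZP z) (cluster s) = laurent_seed z s.
Proof.
have sR := lauring_subring (X s) predT predT.
apply/seteqP; split.
  apply: gen_subring_min => // f [|[[i _ <-]|[i _ <-]]].
  - apply: gen_subring_min => // g [[l _ <-]|[l _ <-]].
      exact: (lauring_var (X := X s) (i := inr l)).
    exact: (lauring_inv (X := X s) (i := inr l)).
  - exact: (lauring_var (X := X s) (i := inl i)).
  - exact: (lauring_inv (X := X s) (i := inl i)).
apply: lauring_min => [|i _|i _]; first exact: gen_subring_subring.
  case: i => [i|l]; apply: sub_gen_subring; first by right; left; exists i.
  by left; apply: sub_gen_subring; left; exists l.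
case: i => [i|l]; apply: sub_gen_subring; first by right; right; exists i.
by left; apply: sub_gen_subring; right; exists l.
Qed.

Lemma laurent_subalg_plus s : laurent_subalg (ZPplus z) (cluster s) = laurent_plus z s.
Proof.
have sR : subring (laurent_plus z s) by apply: lauring_subring.
apply/seteqP; split.
  apply: gen_subring_min => // f [|[[i _ <-]|[i _ <-]]].
  - apply: gen_subring_min => // g [l _ <-].
    exact: (lauring_var (X := X s) (i := inr l)).
  - exact: (lauring_var (X := X s) (i := inl i)).
  - exact: (lauring_inv (X := X s) (i := inl i)).
apply: lauring_min => [|i _|]; first exact: gen_subring_subring.
  case: i => [i|l]; apply: sub_gen_subring; first by right; left; exists i.
  by left; apply: sub_gen_subring; exists l.
by case=> // i _; apply: sub_gen_subring; right; right; exists i.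
Qed.

Lemma range_permute (p : 'S_n) s : range (cluster (permute p s)) = range (cluster s).
Proof.
apply/seteqP; split=> f [i _ <-]; first by exists (p i).
by exists ((p^-1)%g i) => //=; rewrite permKV.
Qed.

Lemma laurent_subalg_permute A (p : 'S_n) s :
  laurent_subalg A (cluster (permute p s)) = laurent_subalg A (cluster s).
Proof.
rewrite /laurent_subalg range_permute; congr (gen_subalg _ (_ `|` _)).
apply/seteqP; split=> f [i _ <-]; first by exists (p i).
by exists ((p^-1)%g i) => //=; rewrite permKV.
Qed.

Lemma cluster_variablesP s f : cluster_variables z s f <->
  exists ks (i : 'I_n), f = cluster (foldl (mutation z) s ks) i.
Proof.
split=> [[t [ks [p ->]]]|[ks [i ->]]].
  by rewrite range_permute => -[i _ <-]; exists ks, i.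
exists (permute 1%g (foldl (mutation z) s ks)); first by exists ks, 1%g.
by rewrite range_permute; exists i.
Qed.

Lemma upper_cluster_algebraP A s f : upper_cluster_algebra z A s f <->
  forall ks, laurent_subalg A (cluster (foldl (mutation z) s ks)) f.
Proof.
split=> [Uf ks|Lf t [ks [p ->]]]; last by rewrite laurent_subalg_permute.
rewrite -(laurent_subalg_permute A 1%g); apply: Uf; by exists ks, 1%g.
Qed.

Lemma sub_upper_cluster_algebra A s :
  (forall ks ls (i : 'I_n), laurent_subalg A (cluster (foldl (mutation z) s ls))
     (cluster (foldl (mutation z) s ks) i)) ->
  cluster_algebra z A s `<=` upper_cluster_algebra z A s.
Proof.
move=> AL f Af; apply/upper_cluster_algebraP => ls; move: f Af.
apply: gen_subring_min; first exact: gen_subring_subring.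
move=> f [Af|/cluster_variablesP[ks [i ->]]]; last exact: AL.
by apply: sub_gen_subring; left.
Qed.

Theorem cluster_sub_upper s : good z s ->
  cluster_algebra z (ZP z) s `<=` upper_cluster_algebra z (ZP z) s.
Proof.
move=> gs; apply: sub_upper_cluster_algebra => ks ls i.
by rewrite laurent_subalg_seed; apply: laurent_phenomenon.
Qed.

Theorem cluster_sub_upper_plus s : good z s ->
  cluster_algebra z (ZPplus z) s `<=` upper_cluster_algebra z (ZPplus z) s.
Proof.
move=> gs; apply: sub_upper_cluster_algebra => ks ls i.
by rewrite laurent_subalg_plus; apply: laurent_phenomenon_plus.
Qed.

End Laurent.


(** * Algebraic independence over the integers *)

Section AlgIndep.

Lemma mmap_int_morph N (S S' : comNzRingType) (g : {rmorphism S -> S'}) (h : 'I_N -> S) p :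
  g (mmap intr h p) = mmap intr (g \o h) p.
Proof.
rewrite /mmap rmorph_sum; apply: eq_bigr => u _.
rewrite rmorphM rmorph_int /mmap1 rmorph_prod; congr (_ * _).
by apply: eq_bigr => i _; rewrite rmorphXn.
Qed.

Lemma mmap_int_eq N (S : comNzRingType) (h h' : 'I_N -> S) p :
  h =1 h' -> mmap intr h p = mmap intr h' p.
Proof. by move=> hh; apply: eq_bigr => u _; rewrite (mmap1_eq _ hh). Qed.

Lemma mmap_int_var N (S : comNzRingType) (h : 'I_N -> S) i : mmap intr h 'X_i = h i.
Proof. by rewrite mmapX mmap1U. Qed.

Variable F : fieldType.

Lemma sub_frac_ZP m (z : 'I_m -> F) : ZP z `<=` frac_ZP z.
Proof. by move=> f Zf A [_]; apply. Qed.

Definition alg_indep N (w : 'I_N -> F) : Prop :=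
  forall p : {mpoly int[N]}, mmap intr w p = 0 -> p = 0.

Lemma gen_subring_poly N (w : 'I_N -> F) (R : set F) p : subring R ->
  (forall i, R (w i)) -> R (mmap intr w p).
Proof.
move=> sR Rw; apply: (subring_sum sR) => u _; apply: (subringM sR).
  exact: (subring_int sR).
by apply: (subring_prod sR) => i _; apply: (subringX sR).
Qed.

(** A polynomial relation of one member over the Laurent ring of the others
    becomes, after clearing denominators, a relation between all of them. *)
Lemma alg_indep_independent N (w : 'I_N -> F) : alg_indep w -> independent w.
Proof.
move=> indw i; have w0 j : w j != 0.
  apply/eqP => wj0; have := indw 'X_j; rewrite mmap_int_var wj0 => /(_ erefl).
  by move/(congr1 (mcoeff U_(j))); rewrite mcoeffXU eqxx mcoeff0.
pose wi j := if j == i then 0 else w j.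
pose d := \prod_(j | j != i) w j.
have d0 : d != 0 by apply/prodf_neq0.
pose num f := exists M p, f * d ^+ M = mmap intr wi p.
have dE : d = mmap intr wi (\prod_(j | j != i) 'X_j).
  rewrite rmorph_prod; apply: eq_bigr => j /negPf ji; by rewrite /= mmap_int_var /wi ji.
have sub_num : lauring w (all_but i) (all_but i) `<=` num.
  apply: lauring_min => [|j /negPf ji|j ji].
  - split=> [|f g [M [p pE]] [K [q qE]]|f g [M [p pE]] [K [q qE]]].
    + by exists 0%N, 1; rewrite rmorph1 mulr1.
    + exists (M + K)%N, (p * (\prod_(j | j != i) 'X_j) ^+ K - q * (\prod_(j | j != i) 'X_j) ^+ M).
      by rewrite rmorphB !rmorphM !rmorphXn /= -dE -pE -qE exprD; ring.
    + by exists (M + K)%N, (p * q); rewrite rmorphM /= -pE -qE exprD; ring.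
  - by exists 0%N, 'X_j; rewrite mmap_int_var /wi ji mulr1.
  - exists 1%N, (\prod_(l | (l != i) && (l != j)) 'X_l).
    rewrite expr1 /d (bigD1 j) //= mulKf // rmorph_prod; apply: eq_bigr => l /andP[/negPf li _].
    by rewrite /= mmap_int_var /wi li.
move=> p Lp pw.
have [M [q qE]] : exists M, exists q : nat -> {mpoly int[N]}, forall a, (a < size p)%N ->
    p`_a * d ^+ M = mmap intr wi (q a).
  elim: (size p) => [|l [M [q qE]]]; first by exists 0%N, (fun=> 0).
  have [K [r rE]] := sub_num _ (Lp l).
  exists (M + K)%N, (fun a => if a == l then r * (\prod_(j | j != i) 'X_j) ^+ M
                              else q a * (\prod_(j | j != i) 'X_j) ^+ K) => a.
  rewrite ltnS leq_eqVlt; case: eqVneq => [-> _|_ /= /qE aE].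
    by rewrite rmorphM rmorphXn /= -dE -rE exprD; ring.
  by rewrite rmorphM rmorphXn /= -dE -aE exprD; ring.
(* [ev] forgets the variable [i], and [sep] singles it out *)
pose ev := mmap intr (fun j => if j == i then 0 else 'X_j) : {mpoly int[N]} -> {mpoly int[N]}.
pose sep := mmap intr (fun j => if j == i then 'X else ('X_j)%:P) : {mpoly int[N]} -> {poly {mpoly int[N]}}.
have evE r : mmap intr w (ev r) = mmap intr wi r.
  rewrite /ev mmap_int_morph; apply: mmap_int_eq => j; rewrite /= /wi.
  by case: ifP => _; rewrite ?rmorph0 ?mmap_int_var.
have sepE r : sep (ev r) = (ev r)%:P.
  rewrite /sep /ev mmap_int_morph (mmap_int_morph polyC); apply: mmap_int_eq => j /=.
  by case: (eqVneq j i) => [_|/negPf ji]; rewrite ?rmorph0 // mmap_int_var ji.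
have Q0 : \sum_(a < size p) ev (q a) * 'X_i ^+ a = 0.
  apply: indw; rewrite rmorph_sum -[RHS](mul0r (d ^+ M)) -[in RHS]pw horner_coef mulr_suml.
  apply: eq_bigr => a _; rewrite rmorphM rmorphXn /= mmap_int_var evE -qE //.
  ring.
apply/polyP => a; rewrite coef0; have [lt_a|] := ltnP a (size p); last exact: nth_default.
have eva : ev (q a) = 0.
  have sep_term b : sep (ev (q b) * 'X_i ^+ b) = (ev (q b))%:P * 'X^b.
    by rewrite /sep rmorphM rmorphXn /= mmap_int_var eqxx -/(sep _) sepE.
  have := congr1 (fun r => (sep r)`_a) Q0; rewrite /= {1}/sep rmorph_sum /sep rmorph0 coef0 coef_sum.
  rewrite (bigD1 (Ordinal lt_a)) //= big1 ?addr0 => [|b /negPf ba].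
    by rewrite -/(sep _) sep_term coefCM coefXn eqxx mulr1.
  rewrite -/(sep _) sep_term coefCM coefXn.
  by rewrite -val_eqE /= eq_sym in ba; rewrite ba mulr0.
have := qE a lt_a; rewrite -evE eva rmorph0 => /eqP.
by rewrite mulf_eq0 expf_eq0 (negPf d0) andbF orbF => /eqP.
Qed.

(** The frozen variables are independent over the integers, and the cluster is
    independent over their field of fractions. *)
Lemma freely_generates_alg_indep n m (z : 'I_m -> F) (x : 'I_n -> F) :
  embeds_ZP z -> freely_generates z x ->
  alg_indep (fun i : 'I_(n + m) => match split i with inl a => x a | inr l => z l end).
Proof.
move=> hz [hx _] p pw.
set w := (fun i => _) in pw.
pose fst_part (u : 'X_{1..n + m}) := [multinom u (lshift m a) | a < n].
pose snd_part (u : 'X_{1..n + m}) := [multinom u (rshift n l) | l < m].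
have mmap1_split u : mmap1 w u = (\prod_a x a ^+ fst_part u a) * mmap1 z (snd_part u).
  rewrite /mmap1 big_split_ord /=; congr (_ * _); apply: eq_bigr => i _; rewrite mnmE /w.
    by have := unsplitK (inl i : 'I_n + 'I_m) => /= ->.
  by have := unsplitK (inr i : 'I_n + 'I_m) => /= ->.
pose P : {mpoly F[n]} := \sum_(u <- msupp p) ((p@_u)%:~R * mmap1 z (snd_part u)) *: 'X_[fst_part u].
have coefP v : P@_v = mmap intr z (\sum_(u <- msupp p | fst_part u == v) p@_u *: 'X_[snd_part u]).
  rewrite rmorph_sum /P raddf_sum [RHS]big_mkcond /=; apply: eq_bigr => u _.
  rewrite mcoeffZ mcoeffX; case: ifP => _; last by rewrite mulr0.
  by rewrite mmapZ mmapX mulr1.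
have P0 : P = 0.
  apply: hx => [v|].
    rewrite coefP; apply: sub_frac_ZP; apply: gen_subring_poly; first exact: gen_subring_subring.
    by move=> l; apply: sub_gen_subring; left; exists l.
  rewrite rmorph_sum -[RHS]pw /mmap; apply: eq_bigr => u _.
  by rewrite /= mevalZ mevalX mmap1_split; ring.
apply/mpolyP => u; rewrite mcoeff0.
have /hz/(congr1 (mcoeff (snd_part u))) : mmap intr z
   (\sum_(v <- msupp p | fst_part v == fst_part u) p@_v *: 'X_[snd_part v]) = 0.
  by rewrite -coefP P0 mcoeff0.
rewrite mcoeff0 raddf_sum /=; case: (boolP (u \in msupp p)) => [up|]; last first.
  by rewrite -mcoeff_eq0 => /eqP.
rewrite big_mkcond (bigD1_seq u) //= eqxx mcoeffZ mcoeffX eqxx mulr1 big1 ?addr0 // => v vu.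
case: eqP => // fst_eq; rewrite mcoeffZ mcoeffX; case: eqP => [snd_eq|_]; last by rewrite mulr0.
case/eqP: vu; apply/mnmP => i; rewrite -(splitK i); case: (split i) => a /=.
  by have /mnmP/(_ a) := fst_eq; rewrite !mnmE.
by have /mnmP/(_ a) := snd_eq; rewrite !mnmE.
Qed.
End AlgIndep.

Lemma independent_reindex (F : fieldType) (I I' : finType) (w : I -> F) (g : I' -> I) :
  injective g -> independent w -> independent (w \o g).
Proof.
move=> inj_g indw i; apply: sub_transcendental (indw (g i)).
apply: lauring_min => [|j ji|j ji]; first exact: lauring_subring.
  by apply: lauring_var; rewrite /all_but (inj_eq inj_g).
by apply: lauring_inv; rewrite /all_but (inj_eq inj_g).
Qed.

Lemma quiver_independent (F : fieldType) n m (z : 'I_m -> F) (x : 'I_n -> F) (Q : quiver n m) :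
  embeds_ZP z -> freely_generates z x -> independent (ext_cluster z (quiver_seed Q x)).
Proof.
move=> hz hx; have indw := alg_indep_independent (freely_generates_alg_indep hz hx).
suff -> : ext_cluster z (quiver_seed Q x) =
    (fun i : 'I_(n + m) => match split i with inl a => x a | inr l => z l end) \o @unsplit n m.
  by apply: independent_reindex => //; apply: can_inj unsplitK.
by apply/funext => i /=; rewrite unsplitK; case: i.
Qed.


(** * The quiver of the Cremmer-Gervais structure *)

(** Concrete exchange matrices are lists of columns of length 9, the frozen rows
    last, so that mutations of them can be computed. *)
Definition entry (t : seq (seq int)) (k i : nat) : int := nth 0 (nth [::] t k) i.

Definition table_mutation (k : nat) (t : seq (seq int)) : seq (seq int) :=
  mkseq (fun j => mkseq (fun i =>
    if (j == k) || (i == k) then - entry t j i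
    else entry t j i + (entry t k i * pos_part (entry t j k)
                        + pos_part (- entry t k i) * entry t j k)) 9) 6.

Definition CG3_table : seq (seq int) :=
  [:: [:: 0; -1; 0; 0; 0; 1; 1; 0; -1];
      [:: 1; 0; 1; 1; -1; 0; -1; 0; 0];
      [:: 0; -1; 0; 1; 1; -1; 1; -1; 0];
      [:: 0; -1; -1; 0; 1; 1; 0; 1; 0];
      [:: 0; 1; -1; -1; 0; 1; 0; 0; 0];
      [:: -1; 0; 1; -1; -1; 0; 0; 0; 1]].

Definition row_of (i : 'I_6 + 'I_3) : nat :=
  match i with inl a => a | inr l => 6 + l end.

Lemma row_of_lt i : (row_of i < 9)%N.
Proof. by case: i => [[a a6]|[l l3]] /=; lia. Qed.

(** Recursion on the list of exponents, with exponents 0 and 1 treated apart, makes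
    concrete exchange relations simplify to identities between polynomials. *)
Fixpoint pos_monomial (R : pzRingType) (c : seq int) (xs : seq R) : R :=
  match c, xs with
  | Posz 0 :: c', _ :: xs' => pos_monomial c' xs'
  | Posz 1 :: c', x :: xs' => x * pos_monomial c' xs'
  | Posz k :: c', x :: xs' => x ^+ k * pos_monomial c' xs'
  | Negz _ :: c', _ :: xs' => pos_monomial c' xs'
  | _, _ => 1
  end.

Fixpoint neg_monomial (R : pzRingType) (c : seq int) (xs : seq R) : R :=
  match c, xs with
  | Posz _ :: c', _ :: xs' => neg_monomial c' xs'
  | Negz 0 :: c', x :: xs' => x * neg_monomial c' xs'
  | Negz k :: c', x :: xs' => x ^+ k.+1 * neg_monomial c' xs'
  | _, _ => 1
  end.

Section CG3.
Variables (F : fieldType) (z : 'I_3 -> F).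
Implicit Types (s : seed F 6 3) (t : seq (seq int)) (xs : seq F).

Definition has_table s t : Prop := forall k i, ext_exch s k i = entry t k (row_of i).

Definition has_cluster s xs : Prop :=
  size xs = 9 /\ forall i, ext_cluster z s i = nth 0 xs (row_of i).

Lemma has_table_mutation s t (k : 'I_6) :
  has_table s t -> has_table (mutation z s k) (table_mutation k t).
Proof.
move=> st j i; rewrite /entry nth_mkseq // nth_mkseq ?row_of_lt //.
rewrite ext_exch_mut !st.
have -> : (i == inl k) = (row_of i == k).
  case: i => [a|l] /=; first by [].
  by apply/esym/negP => /eqP; have := ltn_ord k; lia.
by [].
Qed.

Lemma CG3_has_table (x : 'I_6 -> F) : has_table (quiver_seed QCG3 x) CG3_table.
Proof.
move=> k i; case: i => [a|l]; rewrite /ext_exch /= mxE.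
  case: k => -[|[|[|[|[|[|//]]]]]] k6; case: a => -[|[|[|[|[|[|//]]]]]] a6;
  by vm_compute.
case: k => -[|[|[|[|[|[|//]]]]]] k6; case: l => -[|[|[|//]]] l3;
by vm_compute.
Qed.

Lemma CG3_full_rank (x : 'I_6 -> F) : full_rank (quiver_seed QCG3 x).
Proof.
move=> c c0.
have eq_of i : \sum_k c k * entry CG3_table k (row_of i) = 0.
  by rewrite -[RHS](c0 i); apply: eq_bigr => k _; rewrite (CG3_has_table x).
pose d (a : nat) : int := c (inord a).
have eq_row i : d 0%N * entry CG3_table 0 (row_of i) + d 1%N * entry CG3_table 1 (row_of i) +
   d 2%N * entry CG3_table 2 (row_of i) + d 3%N * entry CG3_table 3 (row_of i) +
   d 4%N * entry CG3_table 4 (row_of i) + d 5%N * entry CG3_table 5 (row_of i) = 0.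
  rewrite -[RHS](eq_of i) !big_ord_recr big_ord0 /= add0r /d.
  by congr (_ + _ + _ + _ + _ + _); congr (c _ * _); apply: val_inj; rewrite /= inordK.
have dE (k : 'I_6) : d k = c k by rewrite /d inord_val.
move: (d) eq_row dE => {}d eq_row dE k; rewrite -dE.
have r0 := eq_row (inl ord0); have r1 := eq_row (inl (@Ordinal 6 1 isT)).
have r2 := eq_row (inl (@Ordinal 6 2 isT)); have r3 := eq_row (inl (@Ordinal 6 3 isT)).
have r4 := eq_row (inl (@Ordinal 6 4 isT)); have r5 := eq_row (inl (@Ordinal 6 5 isT)).
have r6 := eq_row (inr ord0); have r7 := eq_row (inr (@Ordinal 3 1 isT)).
have r8 := eq_row (inr (@Ordinal 3 2 isT)).
rewrite /entry /= in r0 r1 r2 r3 r4 r5 r6 r7 r8.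
by case: k => -[|[|[|[|[|[|//]]]]]] k6 /=; lia.
Qed.

Lemma CG3_good (x : 'I_6 -> F) : embeds_ZP z -> freely_generates z x ->
  good z (quiver_seed QCG3 x).
Proof.
move=> hz hx; split; first exact: quiver_independent.
  by move=> i j; rewrite !mxE opprB.
exact: CG3_full_rank.
Qed.

Lemma pos_monomial_cons (c : int) cs (x : F) xs :
  pos_monomial (c :: cs) (x :: xs) = x ^ pos_part c * pos_monomial cs xs.
Proof. by case: c => [[|[|k]]|k] //=; rewrite ?mul1r. Qed.

Lemma neg_monomial_cons (c : int) cs (x : F) xs :
  neg_monomial (c :: cs) (x :: xs) = x ^ pos_part (- c) * neg_monomial cs xs.
Proof. by case: c => [[|k]|[|k]] //=; rewrite ?mul1r // expr0z mul1r. Qed.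

Lemma exchange_table s t xs (k : 'I_6) c : has_table s t -> has_cluster s xs ->
  nth [::] t k = c -> size c = 9 ->
  exchange z s k = pos_monomial c xs + neg_monomial c xs.
Proof.
move=> st [xs9 sx] tc c9; rewrite /exchange /plus_mon /minus_mon /mon.
have monE (v : int -> int) : \prod_i ext_cluster z s i ^ v (ext_exch s k i) =
    \prod_(i < 9) nth 0 xs i ^ v (nth 0 c i).
  rewrite big_sumType (@big_split_ord _ _ _ 6 3) /=; congr (_ * _); apply: eq_bigr => i _.
    by have := st k (inl i); have := sx (inl i); rewrite /entry tc /= => -> ->.
  by have := st k (inr i); have := sx (inr i); rewrite /entry tc /= => -> ->.
rewrite (monE pos_part) (monE (fun a => pos_part (- a))).
move: c c9 xs xs9 {sx tc monE}; do 9!(case=> [//|?]); case=> [_|//].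
do 9!(case=> [//|?]); case=> [_|//].
by rewrite !pos_monomial_cons !neg_monomial_cons !big_ord_recl !big_ord0.
Qed.

(** This computes mutations without divisions: the new variable is given in
    advance and verified through its exchange relation. *)
Lemma has_cluster_mutation s t xs (k : 'I_6) c y : good z s ->
  has_table s t -> has_cluster s xs -> nth [::] t k = c -> size c = 9 ->
  nth 0 xs k * y = pos_monomial c xs + neg_monomial c xs ->
  has_cluster (mutation z s k) (set_nth 0 xs k y).
Proof.
move=> gs st sx tc c9 yE; have [xs9 sxE] := sx.
have k9 : (k < 9)%N by apply: leq_trans (ltn_ord k) _.
split; first by rewrite size_set_nth xs9; apply/maxn_idPr.
move=> i; rewrite nth_set_nth /=.
have [iE|ne_ik] := eqVneq i (inl k).
  rewrite iE /= eqxx; apply: (mulfI (good_neq0 (inl k) gs)).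
  by rewrite mutE // (sxE (inl k)) yE; apply: exchange_table st sx tc c9.
rewrite ext_cluster_mut_neq // sxE; case: eqP => // ik.
case/eqP: ne_ik; case: i ik => [a|l] /= ik; first by congr inl; apply: val_inj.
by have := ltn_ord k; rewrite -ik; lia.
Qed.

End CG3.


(** ** Polynomial rings in an independent family *)

Section PolyFamily.
Variables (F : fieldType) (I : finType) (w : I -> F).
Hypothesis indw : independent w.
Implicit Types (J : pred I) (i : I).

Definition polyring J : set F := lauring w J pred0.

Lemma polyring_subring J : subring (polyring J).
Proof. exact: lauring_subring. Qed.

Lemma polyring_adjoin J i : J i ->
  polyring J = adjoin (polyring (fun j => J j && (j != i))) (w i).
Proof.
move=> Ji; apply/seteqP; split; first exact: lauring_adjoin.
move=> f [p Ep ->]; apply: (horner_on _ _ _ Ep); first exact: lauring_subring.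
- by apply: lauring_sub => // j /andP[].
- exact: lauring_var.
Qed.

Lemma polyring_transcendental J i :
  transcendental (polyring (fun j => J j && (j != i))) (w i).
Proof. by apply: sub_transcendental (@indw i); apply: lauring_sub => // j /andP[]. Qed.

Lemma affine_neq0 i u v : lauring w (all_but i) (all_but i) u ->
  lauring w (all_but i) (all_but i) v -> v != 0 -> v * w i + u != 0.
Proof.
set E := lauring _ _ _ => Eu Ev v0; have sE : subring E by apply: lauring_subring.
apply/eqP => uv0; have : v *: 'X + u%:P = 0.
  apply: (@indw i); last by rewrite !(hornerD, hornerZ, hornerX, hornerC).
  by apply: (poly_onD sE); [apply: (poly_onZ sE) => //; apply: (poly_onX sE)|apply: (poly_onC sE)].
move/polyP/(_ 1%N); rewrite coefD coefZ coefX coefC mulr1 addr0 coef0 => /eqP.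
by rewrite (negPf v0).
Qed.

Lemma regular_mod_member J i P0 P1 : J i ->
  polyring (fun j => J j && (j != i)) P0 -> P0 != 0 -> polyring J P1 ->
  regular_mod (polyring J) (w i) (P0 + w i * P1).
Proof.
move=> Ji EP0 P00 JP1; rewrite (polyring_adjoin Ji) in JP1 *.
by apply: regular_mod_var => //; [apply: polyring_subring|apply: polyring_transcendental].
Qed.

(** The element [a * w i + b] is prime, and the value of [u + v * w i] at its root
    [- b / a] is not zero. *)
Lemma regular_mod_affine i a b u v : 
  let E := polyring (all_but i) in
  E a -> E b -> a != 0 -> regular_mod E a b -> E u -> E v -> u * a - v * b != 0 ->
  regular_mod (polyring predT) (a * w i + b) (u + v * w i).
Proof.
move=> E Ea Eb a0 reg Eu Ev uv; rewrite (@polyring_adjoin predT i) //.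
have sE : subring E by apply: polyring_subring.
have -> : u + v * w i = (u%:P + v *: 'X).[w i].
  by rewrite !(hornerD, hornerZ, hornerX, hornerC).
apply: regular_mod_linear => //.
- exact: (@polyring_transcendental predT).
- by apply: (poly_onD sE); [apply: (poly_onC sE)|apply: (poly_onZ sE) => //; apply: (poly_onX sE)].
rewrite !(hornerD, hornerZ, hornerX, hornerC); apply: contraNneq uv => uv0.
by apply/eqP; rewrite -[RHS](mul0r a) -uv0; field.
Qed.

End PolyFamily.

Section RegularMod.
Variables (F : fieldType) (R : set F).
Hypothesis sR : subring R.

Lemma regular_modN u y : regular_mod R u y -> regular_mod R (- u) y.
Proof.
move=> reg g h yh Rg Rh; have [||k Rk ->] := reg (- g) h _ _ Rh.
- by rewrite yh mulNr mulrN.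
- exact: (subringN sR).
by exists (- k); [apply: (subringN sR)|rewrite mulrNN].
Qed.

Lemma regular_mod_mul u v y : u != 0 -> R v -> regular_mod R u y -> regular_mod R v y ->
  regular_mod R (u * v) y.
Proof.
move=> u0 Rv regu regv g h yh Rg Rh.
have [k Rk kE] := regu (v * g) h (etrans yh (esym (mulrA _ _ _))) (subringM sR Rv Rg) Rh.
have [|l Rl lE] := regv g k _ Rg Rk; last by exists l; rewrite // kE lE mulrA.
by apply: (mulfI u0); rewrite mulrCA -kE yh mulrA.
Qed.

Lemma regular_mod1 y : regular_mod R 1 y.
Proof. by move=> g h yh Rg Rh; exists h; rewrite ?mul1r. Qed.
End RegularMod.

(** ** Entries of a 3 x 3 matrix *)

(** The Cremmer-Gervais initial cluster, frozen variables last, for the matrix with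
    rows [a], [b] and [c]. *)
Definition CG3_cluster (R : pzRingType) (m : seq R) : seq R :=
  match m with
  | [:: a1; a2; a3; b1; b2; b3; c1; c2; c3] =>
    [:: c3;
        a3 * (a1 * c2 - a2 * c1) - b3 * (a1 * b2 - a2 * b1);
        a2 * b3 - a3 * b2;
        a1 * b2 - a2 * b1;
        a3;
        a2;
        (a2 * c1 - a1 * c2) * (a2 * c3 - a3 * c2) + (a1 * b2 - a2 * b1) * (b2 * c3 - b3 * c2);
        a1 * (b2 * c3 - b3 * c2) - a2 * (b1 * c3 - b3 * c1) + a3 * (b1 * c2 - b2 * c1);
        a1 * c3 - a2 * c2]
  | _ => [::]
  end.

Section Affine.
Variables (F : fieldType) (n : nat).

Lemma affine_transcendental (E : set F) (T u v : F) : subring E -> E u -> E u^-1 -> u != 0 ->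
  E v -> transcendental E T -> transcendental E (u * T + v).
Proof.
move=> sE Eu Eu' u0 Ev trT p Ep pT.
pose q := u *: 'X + v%:P; pose q' := u^-1 *: ('X - v%:P).
have Eq : poly_on E q.
  by apply: (poly_onD sE); [apply: (poly_onZ sE) => //; apply: (poly_onX sE)|apply: (poly_onC sE)].
have pq0 : p \Po q = 0.
  apply: trT.
    rewrite comp_polyE; apply: (poly_on_sum sE) => i _; apply: (poly_onZ sE) => //.
    exact: (poly_on_exp sE).
  by rewrite horner_comp !(hornerD, hornerZ, hornerX, hornerC).
rewrite -(comp_polyXr p); have -> : 'X = q \Po q'.
  by rewrite comp_polyD comp_polyZ comp_polyX comp_polyC scalerA divff // scale1r subrK.
by rewrite comp_polyA pq0 comp_poly0.
Qed.

Lemma independent_set_nth (l : seq F) k y :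
  independent (fun i : 'I_n => nth 0 l i) ->
  (forall i : 'I_n, i = k :> nat ->
     transcendental (lauring (fun i : 'I_n => nth 0 l i) (all_but i) (all_but i)) y) ->
  (k < n)%N -> independent (fun i : 'I_n => nth 0 (set_nth 0 l k y) i).
Proof.
move=> indl try kn; apply: (independent_replace (k := Ordinal kn) _ _ indl).
  by move=> i; rewrite -val_eqE nth_set_nth /= => /negPf ->.
by rewrite /= nth_set_nth /= eqxx; apply: try.
Qed.
End Affine.


Lemma independent_affine (F : fieldType) (l : seq F) (k : 'I_9) (y u v : F) :
  let E := lauring (fun i : 'I_9 => nth 0 l i) (all_but k) (all_but k) in
  independent (fun i : 'I_9 => nth 0 l i) -> E u -> E u^-1 -> u != 0 -> E v ->
  y = u * nth 0 l k + v -> independent (fun i : 'I_9 => nth 0 (set_nth 0 l k y) i).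
Proof.
move=> E indl Eu Eu' u0 Ev ->; apply: independent_set_nth => // i ik.
have -> : i = k by apply: val_inj.
by apply: affine_transcendental => //; apply: lauring_subring.
Qed.

Ltac lauring_atom_at X J K i :=
  first [ exact: (@lauring_var _ _ X J K (@Ordinal 9 i isT) isT)
        | exact: (@lauring_inv _ _ X J K (@Ordinal 9 i isT) isT) ].

Ltac lauring_atom X J K :=
  first [ lauring_atom_at X J K 0%N | lauring_atom_at X J K 1%N | lauring_atom_at X J K 2%N
        | lauring_atom_at X J K 3%N | lauring_atom_at X J K 4%N | lauring_atom_at X J K 5%N
        | lauring_atom_at X J K 6%N | lauring_atom_at X J K 7%N | lauring_atom_at X J K 8%N ].

Ltac lauring_mem :=
  match goal with |- lauring ?X ?J ?K ?f =>
    match f with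
    | _ + - _ => apply: (subringB (lauring_subring X J K)); lauring_mem
    | _ + _ => apply: (subringD (lauring_subring X J K)); lauring_mem
    | - _ => apply: (subringN (lauring_subring X J K)); lauring_mem
    | _ * _ => apply: (subringM (lauring_subring X J K)); lauring_mem
    | _ ^+ _ => apply: (subringX (lauring_subring X J K)); lauring_mem
    | 1 => exact: (subring1 (lauring_subring X J K))
    | 0 => exact: (subring0 (lauring_subring X J K))
    | _ => lauring_atom X J K
    end
  end.

(** The entries of the matrix are recovered one at a time: in this order each
    is an affine function of the variable that it replaces, whose slope is a
    monomial in the remaining ones. *)
Lemma CG3_entries (F : fieldType) (x1 x2 x3 x4 x5 x6 z1 z2 z3 : F) :
  independent (fun i : 'I_9 => nth 0 [:: x1; x2; x3; x4; x5; x6; z1; z2; z3] i) ->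
  exists a1 a2 a3 b1 b2 b3 c1 c2 c3,
    independent (fun i : 'I_9 => nth 0 [:: a1; a2; a3; b1; b2; b3; c1; c2; c3] i) /\
    [:: x1; x2; x3; x4; x5; x6; z1; z2; z3] =
    CG3_cluster [:: a1; a2; a3; b1; b2; b3; c1; c2; c3].
Proof.
move=> ind0; have nz (i : 'I_9) := independent_neq0 i ind0.
have x10 : x1 != 0 := nz (@Ordinal 9 0 isT). have x20 : x2 != 0 := nz (@Ordinal 9 1 isT).
have x30 : x3 != 0 := nz (@Ordinal 9 2 isT). have x40 : x4 != 0 := nz (@Ordinal 9 3 isT).
have x50 : x5 != 0 := nz (@Ordinal 9 4 isT). have x60 : x6 != 0 := nz (@Ordinal 9 5 isT).
have [c2 c2E] : exists c2, c2 = x2^-1 * z1 + (x1 * x3 * x4 * (x2^-1 * x5^-1) + x1 * x6 * x5^-1) by eexists.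
have [a1 a1E] : exists a1, a1 = x1^-1 * z3 + x6 * c2 * x1^-1 by eexists.
have z1E : z1 = c2 * x2 - x1 * x3 * x4 * x5^-1 - x1 * x2 * x6 * x5^-1.
  by rewrite c2E; field; rewrite x20 x50.
have [b2 b2E] : exists b2, b2 = - (x6 * x6 * x3^-1 * x4^-1) * z2 +
    - (x5 * x6 * (c2 * x2 - x1 * x3 * x4 * x5^-1 - x1 * x2 * x6 * x5^-1) * x2^-1 * x3^-1 +
     x3 * x5^-1 + x2 * x6 * x4^-1 * x5^-1 + x1 * x4 * x6 * x2^-1) by eexists.
have [b3 b3E] : exists b3, b3 = x6^-1 * x3 + x5 * b2 * x6^-1 by eexists.
have [b1 b1E] : exists b1, b1 = - x6^-1 * x4 + a1 * b2 * x6^-1 by eexists.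
have [c1 c1E] : exists c1, c1 = - x5^-1 * x6^-1 * x2 +
    (a1 * x5 * c2 - a1 * b2 * b3 + x6 * b1 * b3) * (x5^-1 * x6^-1) by eexists.
have ind1 := @independent_affine F _ (@Ordinal 9 6 isT) c2 x2^-1
  (x1 * x3 * x4 * (x2^-1 * x5^-1) + x1 * x6 * x5^-1) ind0.
rewrite /= invrK invr_eq0 in ind1.
have {}ind1 := ind1 ltac:(lauring_mem) ltac:(lauring_mem) x20 ltac:(lauring_mem) c2E.
have ind2 := @independent_affine F _ (@Ordinal 9 8 isT) a1 x1^-1 (x6 * c2 * x1^-1) ind1.
rewrite /= invrK invr_eq0 in ind2.
have {ind1}ind2 := ind2 ltac:(lauring_mem) ltac:(lauring_mem) x10 ltac:(lauring_mem) a1E.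
have ind3 := @independent_affine F _ (@Ordinal 9 7 isT) b2 _ _ ind2 _ _ _ _ b2E.
have u0 : - (x6 * x6 * x3^-1 * x4^-1) != 0 by rewrite oppr_eq0 !mulf_neq0 // invr_eq0.
have uE : (- (x6 * x6 * x3^-1 * x4^-1))^-1 = - (x6^-1 * x6^-1 * x3 * x4).
  by rewrite invrN; congr (- _); field; rewrite x30 x40 x60.
rewrite uE in ind3.
have {ind2}ind3 := ind3 ltac:(lauring_mem) ltac:(lauring_mem) u0 ltac:(lauring_mem).
have ind4 := @independent_affine F _ (@Ordinal 9 2 isT) b3 x6^-1 (x5 * b2 * x6^-1) ind3.
rewrite /= invrK invr_eq0 in ind4.
have {ind3}ind4 := ind4 ltac:(lauring_mem) ltac:(lauring_mem) x60 ltac:(lauring_mem) b3E.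
have ind5 := @independent_affine F _ (@Ordinal 9 3 isT) b1 (- x6^-1) (a1 * b2 * x6^-1) ind4.
rewrite /= invrN invrK oppr_eq0 invr_eq0 in ind5.
have {ind4}ind5 := ind5 ltac:(lauring_mem) ltac:(lauring_mem) x60 ltac:(lauring_mem) b1E.
have ind6 := @independent_affine F _ (@Ordinal 9 1 isT) c1 _ _ ind5 _ _ _ _ c1E.
have v0 : - x5^-1 * x6^-1 != 0 by rewrite mulf_neq0 ?oppr_eq0 ?invr_eq0.
have vE : (- x5^-1 * x6^-1)^-1 = - x5 * x6 by field; rewrite ?oppr_eq0 ?oner_eq0 x50 x60.
rewrite vE in ind6.
have {ind5}ind6 := ind6 ltac:(lauring_mem) ltac:(lauring_mem) v0 ltac:(lauring_mem).
exists a1, x6, x5, b1, b2, b3, c1, c2, x1; split.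
  pose g (i : 'I_9) : 'I_9 := inord (nth 0%N [:: 8; 5; 4; 3; 7; 2; 1; 6; 0] i).
  have gE i : g i = nth 0%N [:: 8; 5; 4; 3; 7; 2; 1; 6; 0] i :> nat.
    by rewrite inordK //; case: i => -[|[|[|[|[|[|[|[|[|//]]]]]]]]].
  have inj_g : injective g.
    move=> i j /(congr1 val); rewrite /= !gE => /eqP.
    by rewrite nth_uniq // => /eqP /val_inj.
  have := independent_reindex inj_g ind6.
  congr (independent _); apply/funext => i /=; rewrite gE.
  by case: i => -[|[|[|[|[|[|[|[|[|//]]]]]]]]].
have x3E : x3 = x6 * b3 - x5 * b2 by rewrite b3E; field.
have x4E : x4 = a1 * b2 - x6 * b1 by rewrite b1E; field.
have x2E : x2 = x5 * (a1 * c2 - x6 * c1) - b3 * (a1 * b2 - x6 * b1).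
  by rewrite c1E; field; rewrite x50 x60.
have z3E : z3 = a1 * x1 - x6 * c2 by rewrite a1E; field.
rewrite /=; congr [:: _; _; _; _; _; _; _; _; _] => //.
  apply: (mulIf x50).
  transitivity (c2 * x2 * x5 - x1 * x3 * x4 - x1 * x2 * x6); first by rewrite z1E; field.
  by rewrite x2E x3E x4E; ring.
have y0 : x6 * x6 * x2 * x5 != 0 by rewrite !mulf_neq0.
apply: (mulIf y0).
transitivity (- b2 * (x2 * x3 * x4 * x5) - x5 * x5 * x6 * (c2 * x2 - x1 * x3 * x4 * x5^-1 - x1 * x2 * x6 * x5^-1) * x4
   - x3 * x3 * x4 * x2 - x2 * x2 * x6 * x3 - x1 * x4 * x4 * x6 * x3 * x5).
  by rewrite [in RHS]b2E; field; rewrite x20 x30 x40 x50.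
transitivity (- b2 * (x2 * x3 * x4 * x5) - x5 * x6 * (c2 * x2 * x5 - x1 * x3 * x4 - x1 * x2 * x6) * x4
   - x3 * x3 * x4 * x2 - x2 * x2 * x6 * x3 - x1 * x4 * x4 * x6 * x3 * x5); first by field.
by rewrite x2E x3E x4E; ring.
Qed.


Section Hartogs.
Variables (F : fieldType) (S : set F).
Hypothesis sS : subring S.

(** Each factor [v] of the denominator is cancelled against a second denominator
    [u], which may depend on it. *)
Lemma remove_denominators (vs : seq F) f :
  (forall v, v \in vs -> [/\ S v, v != 0 &
     exists u N, [/\ S u, regular_mod S v u & S (u ^+ N * f)]]) ->
  (exists N, S ((\prod_(v <- vs) v) ^+ N * f)) -> S f.
Proof.
elim: vs f => [|v vs IH] f Hvs [N]; first by rewrite big_nil expr1n mul1r.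
have [Sv v0 [u [M [Su reg SuM]]]] := Hvs v (mem_head _ _).
rewrite big_cons exprMn -mulrA => SvN; apply: IH => [w ws|]; first by apply: Hvs; rewrite inE ws orbT.
exists N; apply: (regular_frac sS Su Sv v0 reg (m := M) _ SvN).
rewrite mulrCA; apply: (subringM sS) => //; apply: (subringX sS).
rewrite big_seq; apply: (subring_prod sS) => w ws.
by have [|] := Hvs w; rewrite ?inE ?ws ?orbT.
Qed.

Lemma laurent_plus_localization (z : 'I_3 -> F) s xs f : good z s ->
  has_cluster z s xs -> (forall i, S (nth 0 xs i)) -> laurent_plus z s f ->
  exists N, S ((\prod_(v <- take 6 xs) v) ^+ N * f).
Proof.
move=> gs [xs9 sx] Sxs; have xs6 : size (take 6 xs) = 6 by rewrite size_take xs9.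
have SP (r : seq F) : {subset r <= xs} -> S (\prod_(v <- r) v).
  move=> rx; rewrite big_seq; apply: (subring_prod sS) => v /rx vx.
  by rewrite -(nth_index 0 vx).
have := @lauring_min F _ (ext_cluster z s) predT (fun i => if i is inl _ then true else false)
  (localization S (\prod_(v <- take 6 xs) v)).
apply.
- apply: localization_subring => //; apply: SP => v; exact: mem_take.
- by move=> i _; apply: localizationC => //; rewrite sx.
case=> // a _; apply: localization1.
have -> : ext_cluster z s (inl a) = nth 0 (take 6 xs) a by rewrite nth_take // sx.
have a6 : (a < size (take 6 xs))%N by rewrite xs6.
have x0 : nth 0 (take 6 xs) a != 0 by rewrite nth_take // -(sx (inl a)); apply: good_neq0 gs.
rewrite -{1}(cat_take_drop a (take 6 xs)) (drop_nth 0 a6) big_cat big_cons /=.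
rewrite mulrCA mulrC mulKf //; apply: (subringM sS); apply: SP => v.
  by move/mem_take/mem_take.
by move/mem_drop/mem_take.
Qed.
End Hartogs.

Lemma regular_mod_prod (F : fieldType) (R : set F) v (us : seq F) : subring R ->
  (forall i, (i < size us)%N -> R (nth 0 us i) /\ regular_mod R v (nth 0 us i)) ->
  regular_mod R v (\prod_(u <- us) u).
Proof.
move=> sR; elim: us => [|u us IH] Rus; first by rewrite big_nil => g h; rewrite mul1r => ->; exists g.
have Rus' i : (i < size us)%N -> _ := fun ius => Rus i.+1 ius.
rewrite big_cons; apply: (regular_modM sR); [|by have [] := Rus 0%N|exact: IH].
rewrite big_seq; apply: (subring_prod sR) => w ws.
by rewrite -(nth_index 0 ws); have [] := Rus' (index w us); rewrite ?index_mem.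
Qed.

(** * Elements of the upper bound are polynomials in the entries *)

Ltac polyring_mem := rewrite ?/polyring; lauring_mem.

(** The [k]-th element replaces the [k]-th initial variable under mutation at [k];
    this is verified in [CG3_neighbour]. *)
Definition CG3_neighbours (R : pzRingType) (m : seq R) : seq R :=
  match m with
  | [:: a1; a2; a3; b1; b2; b3; c1; c2; c3] =>
    [:: a1 ^+ 2 * a3 * c2 - a1 ^+ 2 * b2 * b3 - a1 * a2 ^+ 2 * c2 - a1 * a2 * a3 * c1
          + a1 * a2 * b1 * b3 + a1 * a2 * b2 ^+ 2 + a2 ^+ 3 * c1 - a2 ^+ 2 * b1 * b2;
        a3 * c2 - a2 * c3;
        - a3 * (a1 * c2 - a2 * c1) ^+ 2 - c3 * (a1 * b2 - a2 * b1) ^+ 2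
          + b3 * (a1 * b2 - a2 * b1) * (a1 * c2 - a2 * c1);
        a2 * a3 * c3 - a2 * b3 ^+ 2 - a3 ^+ 2 * c2 + a3 * b2 * b3;
        a1 * a2 * c2 - a1 * b2 ^+ 2 - a2 ^+ 2 * c1 + a2 * b1 * b2;
        a1 * b3 * c3 - a2 * b3 * c2 - a3 * b1 * c3 + a3 * b2 * c2]
  | _ => [::]
  end.

Section CG3Hartogs.
Variables (F : fieldType) (a1 a2 a3 b1 b2 b3 c1 c2 c3 : F).
Let m := [:: a1; a2; a3; b1; b2; b3; c1; c2; c3].
Let w (i : 'I_9) := nth 0 m i.
Hypothesis indw : independent w.
Let S := polyring w predT.

Lemma regular_mod_slope i a b u v x y :
  let E := polyring w (all_but i) in
  E a -> E b -> a != 0 -> regular_mod E a b ->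
  x = a * w i + b -> y = u + v * w i -> E u -> E v -> u * a - v * b != 0 ->
  regular_mod S x y.
Proof. by move=> E ? ? ? ? -> ->; apply: regular_mod_affine. Qed.

Lemma affine_form_neq0 i u v y : y = v * w i + u -> lauring w (all_but i) (all_but i) u ->
  lauring w (all_but i) (all_but i) v -> v != 0 -> y != 0.
Proof. by move=> ->; apply: affine_neq0. Qed.

Let nz i := independent_neq0 i indw.
Let a10 : a1 != 0 := nz (@Ordinal 9 0 isT). Let a20 : a2 != 0 := nz (@Ordinal 9 1 isT).
Let a30 : a3 != 0 := nz (@Ordinal 9 2 isT). Let b10 : b1 != 0 := nz (@Ordinal 9 3 isT).
Let b20 : b2 != 0 := nz (@Ordinal 9 4 isT). Let b30 : b3 != 0 := nz (@Ordinal 9 5 isT).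
Let c10 : c1 != 0 := nz (@Ordinal 9 6 isT). Let c20 : c2 != 0 := nz (@Ordinal 9 7 isT).
Let c30 : c3 != 0 := nz (@Ordinal 9 8 isT).

Let xs := CG3_cluster m.
Let ys := CG3_neighbours m.
Hypothesis ys0 : forall i, (i < 6)%N -> nth 0 ys i != 0.
Hypothesis xs0 : forall i, (i < 6)%N -> nth 0 xs i != 0.

Lemma CG3_cluster_member i : S (nth 0 xs i).
Proof.
case: i => [|[|[|[|[|[|[|[|[|i]]]]]]]]]; rewrite /xs /=; try by [rewrite /S; polyring_mem].
by rewrite nth_default //; apply: (subring0 (polyring_subring _ _)).
Qed.

Lemma CG3_neighbour_member i : S (nth 0 ys i).
Proof.
case: i => [|[|[|[|[|[|i]]]]]]; rewrite /ys /=; try by [rewrite /S; polyring_mem].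
by rewrite nth_default //; apply: (subring0 (polyring_subring _ _)).
Qed.

Lemma regular_entry_mod a i p0 p1 x : a != i ->
  polyring w (fun j => (j != a) && (j != i)) p0 -> p0 != 0 ->
  polyring w (all_but a) p1 -> x = p0 + w i * p1 ->
  regular_mod (polyring w (all_but a)) (w i) x.
Proof.
move=> ai Ep0 p00 Ep1 ->; apply: (regular_mod_member indw) => //.
by rewrite /all_but eq_sym.
Qed.

Local Notation o k := (@Ordinal 9 k isT).

(** Modulo an entry, only the value of [y] at 0 matters. *)
Lemma regular_mod_entry i u v y : y = u + v * w i ->
  polyring w (all_but i) u -> polyring w (all_but i) v -> u != 0 -> regular_mod S (w i) y.
Proof.
move=> yE Eu Ev u0; have sE := polyring_subring w (all_but i).
apply: (@regular_mod_slope i 1 0 u v) => //; rewrite ?mul1r ?addr0 //.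
- exact: (subring1 sE).
- exact: (subring0 sE).
- exact: oner_neq0.
- exact: regular_mod1.
- by rewrite mulr1 mulr0 subr0.
Qed.

Let x20 := xs0 (isT : (1 < 6)%N). Let x30 := xs0 (isT : (2 < 6)%N).
Let x40 := xs0 (isT : (3 < 6)%N).
Let y10 := ys0 (isT : (0 < 6)%N). Let y20 := ys0 (isT : (1 < 6)%N).
Let y30 := ys0 (isT : (2 < 6)%N). Let y40 := ys0 (isT : (3 < 6)%N).
Let y50 := ys0 (isT : (4 < 6)%N). Let y60 := ys0 (isT : (5 < 6)%N).

Let E0 i : polyring w (all_but i) 0 := subring0 (polyring_subring w (all_but i)).

(** The mutable variables of the neighbour at [k]: their product is the denominator
    against which the [k]-th initial variable is cancelled. *)
Definition exchanged (k : nat) : seq F := take 6 (set_nth 0 xs k (nth 0 ys k)).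

Lemma exchanged_member k i : S (nth 0 (exchanged k) i).
Proof.
have [i6|i6] := ltnP i 6; last first.
  rewrite nth_default; first exact: (subring0 (polyring_subring _ _)).
  by rewrite size_take; case: ltnP => // /leq_trans ->.
rewrite nth_take // nth_set_nth /=; case: eqP => _.
  exact: CG3_neighbour_member.
exact: CG3_cluster_member.
Qed.


Ltac entry_rule u v := apply: (@regular_mod_entry _ u v);
  [rewrite /w /=; ring | polyring_mem | polyring_mem | rewrite ?mulf_neq0 ?oppr_eq0 //].

Lemma exchanged_regular1 i : (i < 6)%N -> regular_mod S (nth 0 xs 0) (nth 0 (exchanged 0) i).
Proof.
change (nth 0 xs 0) with (w (o 8)).
have key y : polyring w (all_but (o 8)) y -> y != 0 -> regular_mod S (w (o 8)) y.
  by move=> Ey y0; apply: (@regular_mod_entry _ y 0); rewrite ?mul0r ?addr0.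
by case: i => [|[|[|[|[|[|//]]]]]] _; rewrite /exchanged /xs /ys /=; apply: key => //; polyring_mem.
Qed.

Lemma exchanged_regular5 i : (i < 6)%N -> regular_mod S (nth 0 xs 4) (nth 0 (exchanged 4) i).
Proof.
change (nth 0 xs 4) with (w (o 2)).
have key y : polyring w (all_but (o 2)) y -> y != 0 -> regular_mod S (w (o 2)) y.
  by move=> Ey y0; apply: (@regular_mod_entry _ y 0); rewrite ?mul0r ?addr0.
case: i => [|[|[|[|[|[|//]]]]]] _; rewrite /exchanged /xs /ys /=.
- by apply: key => //; polyring_mem.
- by entry_rule (- b3 * (a1 * b2 - a2 * b1)) (a1 * c2 - a2 * c1).
- by entry_rule (a2 * b3) (- b2).
- by apply: key => //; polyring_mem.
- by apply: key => //; polyring_mem.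
- by apply: key => //; polyring_mem.
Qed.

Lemma exchanged_regular6 i : (i < 6)%N -> regular_mod S (nth 0 xs 5) (nth 0 (exchanged 5) i).
Proof.
change (nth 0 xs 5) with (w (o 1)).
have key y : polyring w (all_but (o 1)) y -> y != 0 -> regular_mod S (w (o 1)) y.
  by move=> Ey y0; apply: (@regular_mod_entry _ y 0); rewrite ?mul0r ?addr0.
case: i => [|[|[|[|[|[|//]]]]]] _; rewrite /exchanged /xs /ys /=.
- by apply: key => //; polyring_mem.
- entry_rule (a1 * (a3 * c2 - b3 * b2)) (b3 * b1 - a3 * c1).
  apply: (@affine_form_neq0 (o 2) (- b3 * b2) c2).
  + by rewrite /w /=; ring.
  + by polyring_mem.
  + by polyring_mem.
  + by [].
- by entry_rule (- a3 * b2) b3.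
- by entry_rule (a1 * b2) (- b1).
- by apply: key => //; polyring_mem.
- entry_rule (a1 * b3 * c3 - a3 * b1 * c3 + a3 * b2 * c2) (- b3 * c2).
  apply: (@affine_form_neq0 (o 3) (a1 * b3 * c3 + a3 * b2 * c2) (- a3 * c3)).
  + by rewrite /w /=; ring.
  + by polyring_mem.
  + by polyring_mem.
  + by rewrite mulf_neq0 // oppr_eq0.
Qed.

(** The variable [x3 = a2 * b3 - a3 * b2] is affine in [b3], with [a2] and [a3 * b2]
    coprime: what counts is the value at [b3 = a3 * b2 / a2]. *)
Lemma exchanged_regular3 i : (i < 6)%N -> regular_mod S (nth 0 xs 2) (nth 0 (exchanged 2) i).
Proof.
have rule y u v : y = u + v * w (o 5) -> polyring w (all_but (o 5)) u ->
    polyring w (all_but (o 5)) v -> u * a2 - v * (- a3 * b2) != 0 -> regular_mod S (nth 0 xs 2) y.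
  apply: (@regular_mod_slope (o 5) a2 (- a3 * b2)) => //; try by polyring_mem.
  - apply: (@regular_entry_mod (o 5) (o 1) (- a3 * b2) 0) => //; try by polyring_mem.
    + by rewrite mulf_neq0 // oppr_eq0.
    + by rewrite mulr0 addr0.
  - by rewrite /w /=; ring.
have key y : polyring w (all_but (o 5)) y -> y != 0 -> regular_mod S (nth 0 xs 2) y.
  move=> Ey y0; apply: (rule y y 0); rewrite ?mul0r ?addr0 ?subr0 ?mulf_neq0 //.
case: i => [|[|[|[|[|[|//]]]]]] _; rewrite /exchanged /xs /ys /=; try by apply: key => //; polyring_mem.
- apply: (rule _ (a3 * (a1 * c2 - a2 * c1)) (- (a1 * b2 - a2 * b1))); try by polyring_mem.
    by rewrite /w /=; ring.
  apply: (@affine_form_neq0 (o 6) (a2 * a3 * a1 * c2 - a3 * b2 * (a1 * b2 - a2 * b1)) (- a2 * a2 * a3)).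
  + by rewrite /w /=; ring.
  + by polyring_mem.
  + by polyring_mem.
  + by rewrite !mulf_neq0 // oppr_eq0.
apply: (rule _ (- a3 * (a1 * c2 - a2 * c1) ^+ 2 - c3 * (a1 * b2 - a2 * b1) ^+ 2)
  ((a1 * b2 - a2 * b1) * (a1 * c2 - a2 * c1))); try by polyring_mem.
  by rewrite /w /=; ring.
apply: (@affine_form_neq0 (o 8) (- a3 * (a1 * c2 - a2 * c1) ^+ 2 * a2
   + (a1 * b2 - a2 * b1) * (a1 * c2 - a2 * c1) * a3 * b2) (- (a1 * b2 - a2 * b1) ^+ 2 * a2)).
+ by rewrite /w /=; ring.
+ by polyring_mem.
+ by polyring_mem.
+ by rewrite !mulf_neq0 // oppr_eq0 expf_neq0.
Qed.

(** The variable [x4 = a1 * b2 - a2 * b1] is affine in [b1]: what counts is the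
    value at [b1 = a1 * b2 / a2]. *)
Lemma exchanged_regular4 i : (i < 6)%N -> regular_mod S (nth 0 xs 3) (nth 0 (exchanged 3) i).
Proof.
have rule y u v : y = u + v * w (o 3) -> polyring w (all_but (o 3)) u ->
    polyring w (all_but (o 3)) v -> u * a2 - v * (- a1 * b2) != 0 -> regular_mod S (nth 0 xs 3) y.
  move=> yE Eu Ev uv; rewrite -[nth 0 xs 3]opprK; apply: regular_modN; first exact: polyring_subring.
  move: yE Eu Ev uv; apply: (@regular_mod_slope (o 3) a2 (- a1 * b2)) => //; try by polyring_mem.
  - apply: (@regular_entry_mod (o 3) (o 1) (- a1 * b2) 0) => //; try by polyring_mem.
    + by rewrite mulf_neq0 // oppr_eq0.
    + by rewrite mulr0 addr0.
  - by rewrite /w /=; ring.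
have key y : polyring w (all_but (o 3)) y -> y != 0 -> regular_mod S (nth 0 xs 3) y.
  move=> Ey y0; apply: (rule y y 0); rewrite ?mul0r ?addr0 ?subr0 ?mulf_neq0 //.
case: i => [|[|[|[|[|[|//]]]]]] _; rewrite /exchanged /xs /ys /=; try by apply: key => //; polyring_mem.
apply: (rule _ (a3 * (a1 * c2 - a2 * c1) - b3 * a1 * b2) (b3 * a2)); try by polyring_mem.
  by rewrite /w /=; ring.
apply: (@affine_form_neq0 (o 6) (a2 * a3 * a1 * c2) (- a2 * a2 * a3)).
+ by rewrite /w /=; ring.
+ by polyring_mem.
+ by polyring_mem.
+ by rewrite !mulf_neq0 // oppr_eq0.
Qed.

(** The variable [x2] is affine in [c1] with slope [- a2 * a3], and no other variable
    of this neighbour involves [c1]. *)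
Lemma exchanged_regular2 i : (i < 6)%N -> regular_mod S (nth 0 xs 1) (nth 0 (exchanged 1) i).
Proof.
pose a := - (a2 * a3); pose b := a1 * a3 * c2 - a1 * b2 * b3 + a2 * b1 * b3.
have a0 : a != 0 by rewrite oppr_eq0 mulf_neq0.
have reg : regular_mod (polyring w (all_but (o 6))) a b.
  apply: regular_modN; first exact: polyring_subring.
  apply: regular_mod_mul => //; [exact: polyring_subring|by polyring_mem| | ].
  - apply: (@regular_entry_mod (o 6) (o 1) (a1 * a3 * c2 - a1 * b2 * b3) (b1 * b3)) => //;
      try by polyring_mem.
    + apply: (@affine_form_neq0 (o 2) (- a1 * b2 * b3) (a1 * c2)).
      * by rewrite /w /=; ring.
      * by polyring_mem.
      * by polyring_mem.
      * by rewrite mulf_neq0.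
    + by rewrite /b /w /=; ring.
  - apply: (@regular_entry_mod (o 6) (o 2) (- b3 * (a1 * b2 - a2 * b1)) (a1 * c2)) => //;
      try by polyring_mem.
    + by rewrite mulf_neq0 // oppr_eq0.
    + by rewrite /b /w /=; ring.
have key y : polyring w (all_but (o 6)) y -> y != 0 -> regular_mod S (nth 0 xs 1) y.
  move=> Ey y0; apply: (@regular_mod_slope (o 6) a b y 0) => //; try by [rewrite ?/a ?/b; polyring_mem].
  - by rewrite /a /b /w /=; ring.
  - by rewrite mul0r addr0.
  - by rewrite mul0r subr0 mulf_neq0.
by case: i => [|[|[|[|[|[|//]]]]]] _; rewrite /exchanged /xs /ys /=; apply: key => //; polyring_mem.
Qed.
End CG3Hartogs.


Section CG3Polynomial.
Variables (F : fieldType) (z : 'I_3 -> F) (s : seed F 6 3).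
Variables (a1 a2 a3 b1 b2 b3 c1 c2 c3 : F).
Let m := [:: a1; a2; a3; b1; b2; b3; c1; c2; c3].
Let w (i : 'I_9) := nth 0 m i.
Hypotheses (gs : good z s) (st : has_table s CG3_table).
Hypotheses (sx : has_cluster z s (CG3_cluster m)) (indw : independent w).

Lemma CG3_neighbour (k : 'I_6) :
  has_cluster z (mutation z s k) (set_nth 0 (CG3_cluster m) k (nth 0 (CG3_neighbours m) k)).
Proof.
apply: (has_cluster_mutation gs st sx (c := nth [::] CG3_table k) (erefl _)).
  by case: k => -[|[|[|[|[|[|//]]]]]].
by case: k => -[|[|[|[|[|[|//]]]]]] k6 /=; ring.
Qed.

(** The expansion in the seed gives the denominator to be removed, and the expansion
    in the [k]-th neighbour the denominator against which [x_k] is cancelled. *)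
Lemma upper_bound_polynomial f : laurent_plus z s f ->
  (forall k, laurent_plus z (mutation z s k) f) -> polyring w predT f.
Proof.
move=> Ls Lk; have sS := polyring_subring w predT.
have xs0 i : (i < 6)%N -> nth 0 (CG3_cluster m) i != 0.
  move=> i6; rewrite -[nth _ _ i](sx.2 (inl (Ordinal i6))).
  exact: good_neq0 gs.
have ys0 i : (i < 6)%N -> nth 0 (CG3_neighbours m) i != 0.
  move=> i6; have [_ /(_ (inl (Ordinal i6)))] := CG3_neighbour (Ordinal i6).
  rewrite /= nth_set_nth /= eqxx => <-.
  exact: (good_neq0 (inl (Ordinal i6)) (good_mutation gs _)).
apply: (remove_denominators sS (vs := take 6 (CG3_cluster m))); last first.
  by apply: (laurent_plus_localization sS gs sx) => // i; apply: CG3_cluster_member.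
move=> v /(nthP 0) [k]; rewrite size_take => k6; have {}k6 : (k < 6)%N := k6.
rewrite nth_take // => <-; split; [exact: CG3_cluster_member|exact: xs0|].
have memS i := @exchanged_member F a1 a2 a3 b1 b2 b3 c1 c2 c3 k i.
have Sxk i : polyring w predT (nth 0 (set_nth 0 (CG3_cluster m) k (nth 0 (CG3_neighbours m) k)) i).
  rewrite nth_set_nth /=; case: eqP => _; first exact: CG3_neighbour_member.
  exact: CG3_cluster_member.
have [N SN] := laurent_plus_localization sS (good_mutation gs (Ordinal k6)) (CG3_neighbour (Ordinal k6))
  Sxk (Lk (Ordinal k6)).
exists (\prod_(y <- exchanged a1 a2 a3 b1 b2 b3 c1 c2 c3 k) y), N; split=> //.
  rewrite big_seq; apply: (subring_prod sS) => y ys.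
  by rewrite -(nth_index 0 ys); apply: memS.
have size_ex : size (exchanged a1 a2 a3 b1 b2 b3 c1 c2 c3 k) = 6.
  by case: k k6 {memS Sxk SN} => [|[|[|[|[|[|//]]]]]].
apply: regular_mod_prod => // i; rewrite size_ex => i6; split; first exact: memS.
case: k k6 {memS Sxk SN size_ex} => [|[|[|[|[|[|//]]]]]] _.
- exact: exchanged_regular1.
- exact: exchanged_regular2.
- exact: exchanged_regular3.
- exact: exchanged_regular4.
- exact: exchanged_regular5.
- exact: exchanged_regular6.
Qed.
End CG3Polynomial.


(** * The entries are in the cluster algebra *)

Section Walk.
Variables (F : fieldType) (z : 'I_3 -> F) (s : seed F 6 3).

Definition reaches (t : seq (seq int)) (xs : seq F) : Prop :=
  exists ks, [/\ good z (foldl (mutation z) s ks), has_table (foldl (mutation z) s ks) t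
    & has_cluster z (foldl (mutation z) s ks) xs].

Lemma reaches_step t xs (k : nat) c y t' xs' : (k < 6)%N -> reaches t xs -> 
  nth [::] t k = c -> size c = 9 -> 
  nth 0 xs k * y = pos_monomial c xs + neg_monomial c xs ->
  t' = table_mutation k t -> xs' = set_nth 0 xs k y -> reaches t' xs'.
Proof.
move=> k6 [ks [gs st sx]] tc c9 yE -> ->.
exists (rcons ks (Ordinal k6)); rewrite foldl_rcons; split.
- exact: good_mutation.
- exact: has_table_mutation.
- exact: (has_cluster_mutation (k := Ordinal k6) gs st sx tc c9 yE).
Qed.

Lemma reaches_member A t xs i : reaches t xs -> (i < 6)%N ->
  cluster_algebra z A s (nth 0 xs i).
Proof.
move=> [ks [_ _ [_ sx]]] i6; apply: sub_gen_subring; right.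
by apply/cluster_variablesP; exists ks, (Ordinal i6); rewrite -(sx (inl (Ordinal i6))).
Qed.
End Walk.

Section Generators.
Variables (F : fieldType) (z : 'I_3 -> F) (s : seed F 6 3).
Variables (a1 a2 a3 b1 b2 b3 c1 c2 c3 : F).
Let m := [:: a1; a2; a3; b1; b2; b3; c1; c2; c3].
Let w (i : 'I_9) := nth 0 m i.
Hypotheses (gs : good z s) (st : has_table s CG3_table).
Hypotheses (sx : has_cluster z s (CG3_cluster m)).
Let A := cluster_algebra z (ZP z) s.

Let sA : subring A := gen_subring_subring _.

Local Notation x1 := c3.
Local Notation x2 := (a3 * (a1 * c2 - a2 * c1) - b3 * (a1 * b2 - a2 * b1)).
Local Notation x3 := (a2 * b3 - a3 * b2).
Local Notation x4 := (a1 * b2 - a2 * b1).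
Local Notation x5 := a3.
Local Notation x6 := a2.
Local Notation d1 := ((a2 * c1 - a1 * c2) * (a2 * c3 - a3 * c2)
  + (a1 * b2 - a2 * b1) * (b2 * c3 - b3 * c2)).
Local Notation d2 := (a1 * (b2 * c3 - b3 * c2) - a2 * (b1 * c3 - b3 * c1) + a3 * (b1 * c2 - b2 * c1)).
Local Notation d3 := (a1 * c3 - a2 * c2).
Local Notation y2 := (a3 * c2 - a2 * c3).
Local Notation y3 := (- a3 * (a1 * c2 - a2 * c1) ^+ 2 - c3 * (a1 * b2 - a2 * b1) ^+ 2
          + b3 * (a1 * b2 - a2 * b1) * (a1 * c2 - a2 * c1)).
Local Notation y5 := (a1 * a2 * c2 - a1 * b2 ^+ 2 - a2 ^+ 2 * c1 + a2 * b1 * b2).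
Local Notation u := (a2 * c1 - a1 * c2).
Local Notation v4 := (b2 * c3 - b3 * c2).
Local Notation v3 := (b1 * c2 - b2 * c1).
Local Notation w4 := (- a1 * b2 * c3 + a1 * b3 * c2 + a2 * b1 * c3 - a2 * b3 * c1).
Local Notation v56 := (a1 ^+ 2 * c2 * c3 - a1 * a2 * c1 * c3 - a1 * a2 * c2 ^+ 2 - a1 * b1 * b2 * c3
  + a1 * b2 ^+ 2 * c2 + a2 ^+ 2 * c1 * c2 + a2 * b1 ^+ 2 * c3 - a2 * b1 * b2 * c2).
Local Notation T k := (table_mutation k).

Let start : reaches z s CG3_table [:: x1; x2; x3; x4; x5; x6; d1; d2; d3].
Proof. by exists [::]. Qed.

Tactic Notation "step" constr(r) constr(k) constr(c) constr(y) :=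
  apply: (@reaches_step _ _ _ _ _ k c y _ _ isT r); [reflexivity|reflexivity|rewrite /=; ring|reflexivity|reflexivity].

Let r2 : reaches z s (T 1 CG3_table) [:: x1; y2; x3; x4; x5; x6; d1; d2; d3].
Proof. step start 1%N [:: 1; 0; 1; 1; -1; 0; -1; 0; 0 : int] y2. Qed.
Let r23 : reaches z s (T 2 (T 1 CG3_table)) [:: x1; y2; u; x4; x5; x6; d1; d2; d3].
Proof. step r2 2%N [:: 0; 1; 0; 1; 0; -1; 0; -1; 0 : int] u. Qed.
Let r235 : reaches z s (T 4 (T 2 (T 1 CG3_table))) [:: x1; y2; u; x4; c2; x6; d1; d2; d3].
Proof. step r23 4%N [:: 1; -1; 0; 0; 0; 1; 0; 0; 0 : int] c2. Qed.
Let r2351 : reaches z s (T 0 (T 4 (T 2 (T 1 CG3_table)))) [:: a1; y2; u; x4; c2; x6; d1; d2; d3].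
Proof. step r235 0%N [:: 0; 0; 0; 0; 1; 1; 0; 0; -1 : int] a1. Qed.
Let r23516 : reaches z s (T 5 (T 0 (T 4 (T 2 (T 1 CG3_table))))) [:: a1; y2; u; x4; c2; c1; d1; d2; d3].
Proof. step r2351 5%N [:: 1; 0; -1; 0; 1; 0; 0; 0; 0 : int] c1. Qed.
Let r234 : reaches z s (T 3 (T 2 (T 1 CG3_table))) [:: x1; y2; u; v4; x5; x6; d1; d2; d3].
Proof. step r23 3%N [:: 0; 1; 1; 0; 0; 0; -1; 0; 0 : int] v4. Qed.
Let r3 : reaches z s (T 2 CG3_table) [:: x1; x2; y3; x4; x5; x6; d1; d2; d3].
Proof. step start 2%N [:: 0; -1; 0; 1; 1; -1; 1; -1; 0 : int] y3. Qed.
Let r32 : reaches z s (T 1 (T 2 CG3_table)) [:: x1; u; y3; x4; x5; x6; d1; d2; d3].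
Proof. step r3 1%N [:: 1; 0; -1; 2; 0; 0; 0; 0; 0 : int] u. Qed.
Let r324 : reaches z s (T 3 (T 1 (T 2 CG3_table))) [:: x1; u; y3; w4; x5; x6; d1; d2; d3].
Proof. step r32 3%N [:: 0; 2; -1; 0; 1; 0; 0; 0; 0 : int] w4. Qed.
Let r3245 : reaches z s (T 4 (T 3 (T 1 (T 2 CG3_table)))) [:: x1; u; y3; w4; v3; x6; d1; d2; d3].
Proof. step r324 4%N [:: 0; 0; 0; 1; 0; 0; 0; -1; 0 : int] v3. Qed.
Let r5 : reaches z s (T 4 CG3_table) [:: x1; x2; x3; x4; y5; x6; d1; d2; d3].
Proof. step start 4%N [:: 0; 1; -1; -1; 0; 1; 0; 0; 0 : int] y5. Qed.
Let r56 : reaches z s (T 5 (T 4 CG3_table)) [:: x1; x2; x3; x4; y5; v56; d1; d2; d3].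
Proof. step r5 5%N [:: -1; 0; 0; -2; 1; 0; 0; 0; 1 : int] v56. Qed.


Let d_eq i : nth 0 [:: d1; d2; d3] i = nth 0 [:: z ord0; z (@Ordinal 3 1 isT); z (@Ordinal 3 2 isT)] i.
Proof.
case: i => [|[|[|i]]] //=; have [_ sE] := sx.
- exact: esym (sE (inr ord0)).
- exact: esym (sE (inr (@Ordinal 3 1 isT))).
- exact: esym (sE (inr (@Ordinal 3 2 isT))).
Qed.

Let AzP l : A (z l) /\ A (z l)^-1.
Proof.
split; apply: sub_gen_subring; left; apply: sub_gen_subring; first by left; exists l.
by right; exists l.
Qed.

Ltac generated :=
  match goal with |- A ?f =>
    match f with
    | _ + - _ => apply: (subringB sA); generated
    | _ + _ => apply: (subringD sA); generated
    | - _ => apply: (subringN sA); generated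
    | _ * _ => apply: (subringM sA); generated
    | _ ^+ _ => apply: (subringX sA); generated
    | _ => assumption
    end
  end.

(** The first and the last row consist of cluster variables.  For the middle row,
    the products with a frozen variable are polynomials in cluster variables and
    in entries already treated, which is where the inverses of the frozen variables
    are needed. *)
Lemma cluster_algebra_entries i : A (w i).
Proof.
have Ac3 : A c3 := reaches_member (A := ZP z) (i := 0) start isT.
have Ax2 : A (x2) := reaches_member (A := ZP z) (i := 1) start isT.
have Ax3 : A (x3) := reaches_member (A := ZP z) (i := 2) start isT.
have Ax4 : A (x4) := reaches_member (A := ZP z) (i := 3) start isT.
have Aa3 : A a3 := reaches_member (A := ZP z) (i := 4) start isT.
have Aa2 : A a2 := reaches_member (A := ZP z) (i := 5) start isT.
have Ac2 : A c2 := reaches_member (A := ZP z) (i := 4) r235 isT.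
have Aa1 : A a1 := reaches_member (A := ZP z) (i := 0) r2351 isT.
have Ac1 : A c1 := reaches_member (A := ZP z) (i := 5) r23516 isT.
have Av4 : A (v4) := reaches_member (A := ZP z) (i := 3) r234 isT.
have Av3 : A (v3) := reaches_member (A := ZP z) (i := 4) r3245 isT.
have Ay5 : A (y5) := reaches_member (A := ZP z) (i := 4) r5 isT.
have Av56 : A (v56) := reaches_member (A := ZP z) (i := 5) r56 isT.
have cancel l b d : z l = d -> A (b * d) -> A b.
  move=> zd; have d0 : z l != 0 := good_neq0 (inr l) gs.
  by rewrite -zd => Abd; rewrite -(mulfK d0 b); apply: (subringM sA) => //; apply: (AzP _).2.
have z1E : z ord0 = d1 := esym (d_eq 0).
have z2E : z (@Ordinal 3 1 isT) = d2 := esym (d_eq 1).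
have Ab2 : A b2.
  apply: (cancel _ _ _ z2E).
  have -> : b2 * (d2) = - c3 * a2 ^+ 2 * c1 + c3 * a2 * c2 * a1 - c3 * (y5) + a3 * a2 * c2 * c1
      - a3 * c2 ^+ 2 * a1 + c2 * (x2) - (x3) * (v3) by ring.
  by generated.
have Ab3 : A b3.
  apply: (cancel _ _ _ z1E).
  have -> : b3 * (d1) = - c3 ^+ 2 * a2 * a1 * b2 + c3 * a3 * c2 * a1 * b2 + c3 * a2 * a1 * (v4)
      + c3 * a2 * c1 * (x3) - (v4) * (x2) by ring.
  by generated.
have Ab1 : A b1.
  apply: (cancel _ _ _ z1E).
  have -> : b1 * (d1) = - c3 * a2 * a1 * c1 * b2 - c3 * a2 * a1 * (v3) - c3 * a2 * c1 * (x4)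
      + c3 * c2 * a1 ^+ 2 * b2 - a3 * a2 * c1 ^+ 2 * b2 - a3 * a2 * c1 * (v3) + a3 * c2 * a1 * c1 * b2
      + a3 * c2 * a1 * (v3) + a2 ^+ 2 * c2 * c1 * b2 - a2 * c2 ^+ 2 * a1 * b2 - a2 * c1 * b2 ^+ 3
      - a2 * b2 ^+ 2 * (v3) + c2 * a1 * b2 ^+ 3 - c1 * b2 * b3 * (x4) - b2 * (v56) - b3 * (x4) * (v3)
    by ring.
  by generated.
by case: i => -[|[|[|[|[|[|[|[|[|//]]]]]]]]].
Qed.

Lemma polyring_cluster_algebra : polyring w predT `<=` A.
Proof. by apply: lauring_min => // i _; apply: cluster_algebra_entries. Qed.

End Generators.

Lemma laurent_seed_denominator (F : fieldType) n p (z : 'I_p -> F) (s : seed F n p) f :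
  (forall l, z l != 0) -> laurent_seed z s f ->
  exists N, forall M, (N <= M)%N -> laurent_plus z s ((\prod_l z l) ^+ M * f).
Proof.
move=> z0 Lf; set R := laurent_plus z s; have sR : subring R by apply: lauring_subring.
have Rz l : R (z l) by exact: (lauring_var (X := ext_cluster z s) (i := inr l)).
have Rprod (P : pred 'I_p) : R (\prod_(l | P l) z l) by apply: (subring_prod sR) => l _.
suff [N RN] : localization R (\prod_l z l) f.
  exists N => M NM; rewrite -(subnK NM) exprD -mulrA.
  by apply: (subringM sR) => //; apply: (subringX sR).
move: f Lf; apply: lauring_min.
- exact: localization_subring.
- by move=> i _; apply: localizationC => //; apply: lauring_var.
case=> [i|l] _; first by apply: localizationC => //; apply: lauring_inv.
by apply: localization1; rewrite (bigD1 l) //= mulrAC divff // mul1r.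
Qed.

Lemma has_entries (F : fieldType) (z : 'I_3 -> F) (s : seed F 6 3) : good z s ->
  exists a1 a2 a3 b1 b2 b3 c1 c2 c3,
    independent (fun i : 'I_9 => nth 0 [:: a1; a2; a3; b1; b2; b3; c1; c2; c3] i) /\
    has_cluster z s (CG3_cluster [:: a1; a2; a3; b1; b2; b3; c1; c2; c3]).
Proof.
move=> gs; pose o k3 := cluster s (inord k3); pose q k3 := z (inord k3).
have sx : has_cluster z s [:: o 0; o 1; o 2; o 3; o 4; o 5; q 0; q 1; q 2]%N.
  split=> // -[k|l] /=.
    by case: k => -[|[|[|[|[|[|//]]]]]] k6 /=; congr (cluster s _); apply: val_inj; rewrite /= inordK.
  by case: l => -[|[|[|//]]] k3 /=; congr (z _); apply: val_inj; rewrite /= inordK.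
have ind0 : independent (fun i : 'I_9 => nth 0 [:: o 0; o 1; o 2; o 3; o 4; o 5; q 0; q 1; q 2]%N i).
  have [indX _ _] := gs.
  pose g (i : 'I_9) : 'I_6 + 'I_3 := if (i < 6)%N then inl (inord i) else inr (inord (i - 6)).
  have gK i : row_of (g i) = i.
    rewrite /g; case: ltnP => i6 /=; first by rewrite inordK.
    by rewrite inordK ?subnKC //; have := ltn_ord i; lia.
  have inj_g : injective g by move=> i j gij; apply: val_inj; rewrite /= -gK gij gK.
  have := independent_reindex inj_g indX; congr (independent _); apply/funext => i /=.
  by rewrite (sx.2 (g i)) gK.
have [a1 [a2 [a3 [b1 [b2 [b3 [c1 [c2 [c3 [indw xsE]]]]]]]]]] := CG3_entries ind0.
by rewrite xsE in sx; exists a1, a2, a3, b1, b2, b3, c1, c2, c3.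
Qed.

(** Multiplication by a large monomial in the frozen variables reduces this to
    elements without frozen denominators, which are polynomials in the entries. *)
Theorem CG3_upper_sub_cluster (F : fieldType) (z : 'I_3 -> F) (s : seed F 6 3) :
  good z s -> has_table s CG3_table ->
  upper_cluster_algebra z (ZP z) s `<=` cluster_algebra z (ZP z) s.
Proof.
move=> gs st f /upper_cluster_algebraP Uf.
have z0 l : z l != 0 := good_neq0 (inr l) gs.
have [a1 [a2 [a3 [b1 [b2 [b3 [c1 [c2 [c3 [indw sx]]]]]]]]]] := has_entries gs.
have Lk k : laurent_seed z (mutation z s k) f.
  by rewrite -laurent_subalg_seed; apply: (Uf [:: k]).
have L0 : laurent_seed z s f by rewrite -laurent_subalg_seed; apply: (Uf [::]).
have [N0 LN0] := laurent_seed_denominator z0 L0.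
have /boolp.choice[N LN] k : exists N, forall M, (N <= M)%N ->
    laurent_plus z (mutation z s k) ((\prod_l z l) ^+ M * f).
  exact: laurent_seed_denominator.
pose M := (N0 + \sum_k N k)%N; pose A := cluster_algebra z (ZP z) s.
have sA : subring A := gen_subring_subring _.
have AM : A ((\prod_l z l) ^+ M * f).
  apply: (polyring_cluster_algebra gs st sx); apply: (upper_bound_polynomial gs st sx indw).
    by apply: LN0; rewrite leq_addr.
  by move=> k; apply: LN; rewrite /M (bigD1 k) //=; lia.
have p0 : (\prod_l z l) ^+ M != 0 by rewrite expf_neq0 //; apply/prodf_neq0.
rewrite -(mulKf p0 f); apply: (subringM sA) => //; rewrite -exprVn; apply: (subringX sA).
rewrite -prodfV; apply: (subring_prod sA) => l _; apply: sub_gen_subring; left.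
by apply: sub_gen_subring; right; exists l.
Qed.


(** * Derivations of Laurent rings *)

Definition derivation (F : fieldType) (R : set F) (d : F -> F) : Prop :=
  forall f g, R f -> R g ->
    [/\ R (d f), d (f - g) = d f - d g & d (f * g) = d f * g + f * d g].

Section Euler.
Variables (F : fieldType) (E : set F) (T : F).
Hypotheses (sE : subring E) (trT : transcendental E T).

Let euler (N : nat) (p : {poly F}) : {poly F} := 'X * p^`() - p *+ N.

Lemma euler_poly_on N p : poly_on E p -> poly_on E (euler N p).
Proof.
move=> Ep; apply: (poly_onB sE); first apply: (poly_onM sE); first exact: (poly_onX sE).
  by move=> i; rewrite coef_deriv -mulr_natr; apply: (subringM sE) => //; apply: (subring_nat sE).
by move=> i; rewrite coefMn -mulr_natr; apply: (subringM sE) => //; apply: (subring_nat sE).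
Qed.

Lemma eulerM N M p q : euler (N + M) (p * q) = euler N p * q + p * euler M q.
Proof. by rewrite /euler derivM mulrnDr; ring. Qed.

Lemma eulerXn N : euler N 'X^N = 0.
Proof.
rewrite /euler derivXn; case: N => [|N]; first by rewrite !mulr0n mulr0 subr0.
by rewrite mulrnAr -exprS subrr.
Qed.

(** On a representation [p / T ^+ N] the derivation [T d/dT] is given by the
    polynomial [euler N p]; a relation is used because the representation is not
    unique. *)
Definition euler_rel f g : Prop := exists N, exists2 p, poly_on E p &
  f * T ^+ N = p.[T] /\ g * T ^+ N = (euler N p).[T].

Lemma euler_rel_fun f g g' : euler_rel f g -> euler_rel f g' -> g = g'.
Proof.
have T0 := transcendental_neq0 sE trT.
move=> [N [p Ep [fp gp]]] [M [q Eq [fq gq]]].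
have pq : p * 'X^M = q * 'X^N.
  apply: (transcendental_inj sE trT).
  - by apply: (poly_onM sE) => //; apply: (poly_onXn sE).
  - by apply: (poly_onM sE) => //; apply: (poly_onXn sE).
  by rewrite !hornerM !hornerXn -fp -fq; ring.
apply: (mulIf (expf_neq0 (N + M) T0)).
have -> : g * T ^+ (N + M) = (euler N p * 'X^M).[T].
  by rewrite hornerM hornerXn -gp exprD mulrA.
have -> : g' * T ^+ (N + M) = (euler M q * 'X^N).[T].
  by rewrite hornerM hornerXn -gq addnC exprD mulrA.
congr _.[T]; have := eulerM N M p 'X^M.
by rewrite eulerXn mulr0 addr0 => <-; rewrite pq addnC eulerM eulerXn mulr0 addr0.
Qed.

(** This is [T d/dT]. *)
Lemma euler_derivation : exists d, [/\ derivation (laurent E T) d,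
  (forall u, E u -> d u = 0) & d T = T].
Proof.
have T0 := transcendental_neq0 sE trT; have sL := laurent_subring sE T.
have /boolp.choice[d dP] f : exists g, laurent E T f -> euler_rel f g.
  have [[N [p Ep fp]]|nL] := pselect (laurent E T f); last by exists 0.
  exists ((euler N p).[T] / T ^+ N) => _; exists N, p => //; split=> //.
  by rewrite divfK // expf_neq0.
have dE f g : laurent E T f -> euler_rel f g -> d f = g by move=> /dP; apply: euler_rel_fun.
have polyE p N : poly_on E p -> laurent E T (p.[T] / T ^+ N).
  by move=> Ep; exists N, p => //; rewrite divfK // expf_neq0.
exists d; split=> [f g Lf Lg|u Eu|].
- have [N [p Ep [fp dfp]]] := dP f Lf; have [M [q Eq [gq dgq]]] := dP g Lg.
  split.
  + by exists N, (euler N p) => //; apply: euler_poly_on.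
  + apply: dE; first exact: (subringB sL).
    exists (N + M)%N, (p * 'X^M - 'X^N * q).
      by apply: (poly_onB sE); apply: (poly_onM sE) => //; apply: (poly_onXn sE).
    have eulerB L a b : euler L (a - b) = euler L a - euler L b.
      by rewrite /euler derivB mulrnBl; ring.
    rewrite eulerB !eulerM !eulerXn mul0r mulr0 addr0 add0r.
    move: (euler N p) (euler M q) dfp dgq => u v dfp dgq; rewrite !hornerE.
    by rewrite -fp -gq -dfp -dgq exprD; split; ring.
  + apply: dE; first exact: (subringM sL).
    exists (N + M)%N, (p * q); first exact: (poly_onM sE).
    rewrite eulerM; move: (euler N p) (euler M q) dfp dgq => u v dfp dgq.
    by rewrite !hornerE -fp -gq -dfp -dgq exprD; split; ring.
- apply: dE; first exact: laurentC.
  exists 0%N, u%:P; first exact: poly_onC.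
  by rewrite /euler derivC mulr0 mulr0n subr0 hornerC horner0 mul0r mulr1.
- apply: dE; first exact: laurentX.
  exists 0%N, 'X; first exact: poly_onX.
  by rewrite /euler derivX mulr0n subr0 mulr1 hornerX !mulr1.
Qed.
End Euler.

Section Derivations.
Variables (F : fieldType) (R : set F).
Hypothesis sR : subring R.
Implicit Types d : F -> F.

Lemma derivation0 d : derivation R d -> d 0 = 0.
Proof.
move=> dd; have R0 := subring0 sR; have [_ + _] := dd 0 0 R0 R0.
by rewrite !subrr.
Qed.

Lemma derivationN d f : derivation R d -> R f -> d (- f) = - d f.
Proof.
move=> dd Rf; have [_ + _] := dd 0 f (subring0 sR) Rf.
by rewrite !sub0r (derivation0 dd) sub0r.
Qed.

Lemma derivationD d f g : derivation R d -> R f -> R g -> d (f + g) = d f + d g.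
Proof.
move=> dd Rf Rg; have [_ + _] := dd f (- g) Rf (subringN sR Rg).
by rewrite (derivationN dd Rg) !opprK.
Qed.

Lemma derivationM d f g : derivation R d -> R f -> R g -> d (f * g) = d f * g + f * d g.
Proof. by move=> dd Rf Rg; have [] := dd f g Rf Rg. Qed.

Lemma derivation_member d f : derivation R d -> R f -> R (d f).
Proof. by move=> dd Rf; have [] := dd f f Rf Rf. Qed.

Lemma derivation1 d : derivation R d -> d 1 = 0.
Proof.
move=> dd; have R1 := subring1 sR; have := derivationM dd R1 R1.
by rewrite !mulr1 mul1r -{1}[d 1]addr0 => /addrI <-.
Qed.

Lemma derivation_int d (k : int) : derivation R d -> d k%:~R = 0.
Proof.
move=> dd; have dn j : d j%:R = 0.
  elim: j => [|j IH]; first exact: derivation0.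
  rewrite -addn1 natrD (derivationD dd) ?IH ?add0r //; last exact: (subring1 sR).
    exact: derivation1.
  exact: (subring_nat sR).
by case: k => j; rewrite ?NegzE ?rmorphN /= ?(derivationN dd) ?dn ?oppr0 //; apply: (subring_nat sR).
Qed.

Lemma derivation_sum (I : Type) (r : seq I) (P : pred I) (D : I -> F -> F) (c : I -> F) :
  (forall i, R (c i)) -> (forall i, derivation R (D i)) ->
  derivation R (fun f => \sum_(i <- r | P i) c i * D i f).
Proof.
move=> Rc dD f g Rf Rg; split.
- by apply: (subring_sum sR) => i _; apply: (subringM sR) => //; apply: derivation_member.
- by rewrite -sumrB; apply: eq_bigr => i _; have [_ -> _] := dD i f g Rf Rg; rewrite mulrBr.
- rewrite mulr_suml mulr_sumr -big_split; apply: eq_bigr => i _ /=.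
by rewrite (derivationM (dD i) Rf Rg); ring.
Qed.
End Derivations.

Section Bracket.
Variables (F : fieldType) (I : finType) (X : I -> F).
Hypothesis indX : independent X.
Let R : set F := lauring X predT predT.
Let sR : subring R := lauring_subring X predT predT.

Lemma euler_derivations : exists D : I -> F -> F,
  forall i, derivation R (D i) /\ forall j, D i (X j) = (i == j)%:R * X j.
Proof.
suff Dex i : exists d, derivation R d /\ forall j, d (X j) = (i == j)%:R * X j.
  by have [D DP] := boolp.choice Dex; exists D.
pose E := lauring X (all_but i) (all_but i).
have sE : subring E by apply: lauring_subring.
have LR : laurent E (X i) = R.
  apply/seteqP; split.
    by apply: (@laurent_lauring _ _ X predT predT i) => //; apply: independent_neq0.
  by apply: (@lauring_laurent _ _ X predT predT i); apply: independent_neq0.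
have [d [dd dE dX]] := euler_derivation sE (@indX i); exists d; split; first by rewrite -LR.
move=> j; have [<-|ij] := eqVneq i j; first by rewrite mul1r.
by rewrite mul0r dE //; apply: lauring_var; rewrite /all_but eq_sym.
Qed.

Lemma diagonal_derivation (c : I -> F) : (forall i, R (c i)) ->
  exists d, derivation R d /\ forall j, d (X j) = c j * X j.
Proof.
move=> Rc; have [D DP] := euler_derivations.
exists (fun f => \sum_i c i * D i f); split.
  by apply: derivation_sum => // i; have [] := DP i.
move=> j; rewrite (bigD1 j) //= (DP j).2 eqxx mul1r big1 ?addr0 // => i ij.
by rewrite (DP i).2 (negPf ij) mul0r mulr0.
Qed.

(** The bracket is [\sum_(i, j) om i j * (D i f) * (D j g)], for [D i] the derivation
    [X i d/dX i]. *)
Lemma log_canonical_bracket (om : I -> I -> int) :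
  (forall i j, om i j = - om j i) ->
  exists br : F -> F -> F, [/\ (forall f, R f -> derivation R (br f)),
    (forall f g, br f g = - br g f) & forall i j, br (X i) (X j) = (om i j)%:~R * X i * X j].
Proof.
move=> anti; have [D DP] := euler_derivations.
have RD i f : R f -> R (D i f) by apply: derivation_member; have [] := DP i.
pose br f g := \sum_j (\sum_i (om i j)%:~R * D i f) * D j g.
exists br; split=> [f Rf|f g|i j].
- apply: derivation_sum => // j; last by have [] := DP j.
  by apply: (subring_sum sR) => i _; apply: (subringM sR); [apply: subring_int|apply: RD].
- rewrite /br; under eq_bigr do rewrite mulr_suml.
  rewrite exchange_big -sumrN; apply: eq_bigr => i _ /=; rewrite mulr_suml -sumrN.
  by apply: eq_bigr => j _; rewrite anti rmorphN; ring.
- rewrite /br (bigD1 j) //= [X in _ + X]big1 ?addr0 => [|j' jj']; last first.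
    by rewrite (DP j').2 (negPf jj') mul0r mulr0.
  rewrite (DP j).2 eqxx mul1r (bigD1 i) //= [X in _ + X]big1 ?addr0 => [|i' ii']; last first.
    by rewrite (DP i').2 (negPf ii') mul0r mulr0.
  by rewrite (DP i).2 eqxx mul1r.
Qed.
End Bracket.


(** * Eigenvectors of derivations and mutation *)

Section Eigen.
Variables (F : fieldType) (R : set F) (d : F -> F) (h : F).
Hypotheses (sR : subring R) (dd : derivation R d).

(** The eigenvalue is [n * h]: for weights [h] is 1, for a bracket with a cluster
    variable it is this variable. *)
Definition eigen (n : int) (f : F) : Prop := R f /\ d f = n%:~R * h * f.

Lemma eigen1 : eigen 0 1.
Proof. by split; [apply: (subring1 sR)|rewrite (derivation1 sR dd) !mul0r]. Qed.

Lemma eigenM n m f g : eigen n f -> eigen m g -> eigen (n + m) (f * g).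
Proof.
move=> [Rf df] [Rg dg]; split; first exact: (subringM sR).
by rewrite (derivationM dd Rf Rg) df dg rmorphD; ring.
Qed.

Lemma eigenX n f k : eigen n f -> eigen (n * k%:Z) (f ^+ k).
Proof.
move=> nf; elim: k => [|k IH]; first by rewrite mulr0; apply: eigen1.
by rewrite exprS -[k.+1]add1n PoszD mulrDr mulr1; apply: eigenM.
Qed.

Lemma eigenD n f g : eigen n f -> eigen n g -> eigen n (f + g).
Proof.
move=> [Rf df] [Rg dg]; split; first exact: (subringD sR).
by rewrite (derivationD sR dd Rf Rg) df dg; ring.
Qed.

Lemma eigenN n f : eigen n f -> eigen n (- f).
Proof.
move=> [Rf df]; split; first exact: (subringN sR).
by rewrite (derivationN sR dd Rf) df; ring.
Qed.

Lemma eigenB n f g : eigen n f -> eigen n g -> eigen n (f - g).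
Proof. by move=> nf ng; apply: eigenD => //; apply: eigenN. Qed.

Lemma eigen_div n m u f : u != 0 -> eigen m u -> R f -> eigen (n + m) (f * u) -> eigen n f.
Proof.
move=> u0 [Ru du] Rf [_ duf]; split=> //; apply: (mulIf u0).
have := derivationM dd Rf Ru; rewrite duf du rmorphD => E.
by apply: (addIr (f * (m%:~R * h * u))); rewrite -E; ring.
Qed.

Lemma eigen_monomial (I : finType) (X : I -> F) (w v : I -> int) :
  (forall i, eigen (w i) (X i)) -> (forall i, 0 <= v i) ->
  eigen (\sum_i v i * w i) (mon X v).
Proof.
move=> wX v0; rewrite /mon; apply: (big_rec2 (fun a b => eigen a b)) => [|i a b _ ab].
  exact: eigen1.
apply: eigenM => //; rewrite mulrC -(gez0_abs (v0 i)) -exprnP;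
by apply: eigenX.
Qed.
End Eigen.

Section EigenMutation.
Variables (F : fieldType) (n m : nat) (z : 'I_m -> F) (R : set F) (d : F -> F) (h : F).
Hypotheses (sR : subring R) (dd : derivation R d).
Implicit Types (s : seed F n m) (k : 'I_n) (w : 'I_n + 'I_m -> int).
Local Notation X := (ext_cluster z).

Definition mut_weight s k w : 'I_n + 'I_m -> int := fun i =>
  if i == inl k then \sum_j pos_part (ext_exch s k j) * w j - w (inl k) else w i.

(** Equal eigenvalues of the two exchange monomials make the exchange binomial an
    eigenvector, hence also its quotient by the old variable. *)
Lemma eigen_mutation s k w : good z s -> (forall i, eigen R d h (w i) (X s i)) ->
  \sum_i ext_exch s k i * w i = 0 -> (forall i, R (X (mutation z s k) i)) ->
  forall i, eigen R d h (mut_weight s k w i) (X (mutation z s k) i).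
Proof.
move=> gs wX ek0 RX' i; rewrite /mut_weight; have [->|ik] := eqVneq i (inl k); last first.
  by rewrite ext_cluster_mut_neq.
apply: (eigen_div (m := w (inl k)) (u := X s (inl k)) dd) => //; first exact: good_neq0 gs.
rewrite subrK mulrC mutE //; apply: eigenD => //.
  by apply: eigen_monomial => // j; apply: pos_part_ge0.
have -> : \sum_j pos_part (ext_exch s k j) * w j = \sum_j pos_part (- ext_exch s k j) * w j.
  apply/eqP; rewrite -subr_eq0 -sumrB -[X in _ == X]ek0; apply/eqP; apply: eq_bigr => j _.
  by rewrite -mulrBl pos_partB.
by apply: eigen_monomial => // j; apply: pos_part_ge0.
Qed.

(** The pairing of a column with a vector of weights after mutation, in terms of the
    pairings before it: when the pairing with column [k] vanishes and [v] is the
    weight of the new variable, the pairing does not change. *)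
Lemma exch_mut_sum s k l w v : good z s -> l != k ->
  \sum_i ext_exch (mutation z s k) l i * (if i == inl k then v else w i) =
  \sum_i ext_exch s l i * w i
  + ext_exch s l (inl k) * (\sum_i pos_part (ext_exch s k i) * w i - w (inl k) - v)
  + (\sum_i ext_exch s k i * w i) * pos_part (- ext_exch s l (inl k)).
Proof.
move=> gs lk; pose a := ext_exch s l (inl k).
have -> : \sum_i ext_exch (mutation z s k) l i * (if i == inl k then v else w i) =
    \sum_i (ext_exch s l i + (ext_exch s k i * pos_part a + pos_part (- ext_exch s k i) * a)) * w i
    - a * (w (inl k) + v).
  rewrite (bigD1 (inl k)) // [in RHS](bigD1 (inl k)) // eqxx ext_exch_mut eqxx orbT -/a.
  rewrite (ext_exch_kk gs) oppr0 (pos_part_eq0 (lexx 0)).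
  have -> : \sum_(i | i != inl k) ext_exch (mutation z s k) l i * (if i == inl k then v else w i) =
    \sum_(i | i != inl k) (ext_exch s l i + (ext_exch s k i * pos_part a +
      pos_part (- ext_exch s k i) * a)) * w i.
    by apply: eq_bigr => i ik; rewrite ext_exch_mut (negPf ik) (negPf lk).
  by rewrite /=; ring.
have -> : \sum_i (ext_exch s l i + (ext_exch s k i * pos_part a + pos_part (- ext_exch s k i) * a)) * w i
    = \sum_i ext_exch s l i * w i + (\sum_i ext_exch s k i * w i) * pos_part a
      + (\sum_i pos_part (- ext_exch s k i) * w i) * a.
  by rewrite !mulr_suml -!big_split; apply: eq_bigr => i _ /=; ring.
have -> : \sum_i pos_part (- ext_exch s k i) * w i =
    \sum_i pos_part (ext_exch s k i) * w i - \sum_i ext_exch s k i * w i.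
  rewrite -sumrB; apply: eq_bigr => i _; rewrite -mulrBl; congr (_ * _).
  by rewrite -{3}[ext_exch s k i]pos_partB; ring.
rewrite -/a -{3}[a]pos_partB; move: (pos_part a) (pos_part (- a)) (pos_partB a) => p q <-.
by ring.
Qed.

Lemma exch_mut_sum_kk s k w v : good z s ->
  \sum_i ext_exch (mutation z s k) k i * (if i == inl k then v else w i) =
  - \sum_i ext_exch s k i * w i.
Proof.
move=> gs; rewrite -sumrN; apply: eq_bigr => i _; rewrite ext_exch_mut eqxx mulNr.
by have [->|_] := eqVneq i (inl k); rewrite // (ext_exch_kk gs) !mul0r.
Qed.
End EigenMutation.

(** That the two monomials of each exchange relation have equal weights is
    inherited by the neighbouring seeds. *)
Lemma eigen_walk (F : fieldType) (n m : nat) (z : 'I_m -> F) (R : set F) d (s : seed F n m) w :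
  subring R -> derivation R d -> good z s ->
  (forall ks i, R (ext_cluster z (foldl (mutation z) s ks) i)) ->
  (forall i, d (ext_cluster z s i) = (w i)%:~R * ext_cluster z s i) ->
  (forall k, \sum_i ext_exch s k i * w i = 0) ->
  forall ks, exists w', forall i, eigen R d 1 (w' i) (ext_cluster z (foldl (mutation z) s ks) i).
Proof.
move=> sR dd gs RX dw ew ks.
suff [w' []] : exists w', (forall i, eigen R d 1 (w' i) (ext_cluster z (foldl (mutation z) s ks) i)) /\
    forall k, \sum_i ext_exch (foldl (mutation z) s ks) k i * w' i = 0 by exists w'.
elim/last_ind: ks => [|ks k [w' [w'X ew']]].
  exists w; split=> // i; split; first exact: (RX [::]).
  by rewrite mulr1; apply: dw.
have gk := good_walk ks gs; have Rk := RX (rcons ks k); move: Rk; rewrite foldl_rcons => Rk.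
exists (mut_weight (foldl (mutation z) s ks) k w'); split.
  exact: (eigen_mutation sR dd gk w'X (ew' k) Rk).
move=> l; have [->|lk] := eqVneq l k.
  by rewrite [LHS](@exch_mut_sum_kk _ _ _ z _ _ w' _ gk) ew' oppr0.
by rewrite [LHS](@exch_mut_sum _ _ _ z _ _ _ w' _ gk lk) !ew' subrr mulr0 mul0r !addr0.
Qed.

(** * Log-canonical Poisson brackets *)

Section LogCanonical.
Variables (F : fieldType) (n m : nat) (z : 'I_m -> F) (R : set F) (br : F -> F -> F).
Hypotheses (sR : subring R) (brd : forall f, R f -> derivation R (br f)).
Hypothesis br_anti : forall f g, br f g = - br g f.
Hypothesis two_neq0 : 2 != 0 :> F.
Implicit Types (s : seed F n m) (om : 'I_n + 'I_m -> 'I_n + 'I_m -> int).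
Local Notation X := (ext_cluster z).

Definition log_canonical s om : Prop :=
  forall i j, br (X s i) (X s j) = (om i j)%:~R * X s i * X s j.

(** The transposed extended exchange matrix times [om] is [c] times the identity,
    followed by zero columns: a compatible pair of Berenstein and Zelevinsky. *)
Definition compatible s (c : int) om : Prop :=
  (forall i j, om i j = - om j i) /\
  forall l j, \sum_i ext_exch s l i * om i j = if j == inl l then c else 0.

(** Compatibility makes the two monomials of an exchange relation bracket in the
    same way with every other variable, so that mutation keeps the bracket
    log-canonical; the compatibility of the new matrix is then a computation
    with the mutation rule. *)
Lemma log_canonical_mutation s k c om : good z s ->
  (forall i, R (X s i)) -> (forall i, R (X (mutation z s k) i)) ->
  log_canonical s om -> compatible s c om ->
  exists om', log_canonical (mutation z s k) om' /\ compatible (mutation z s k) c om'.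
Proof.
move=> gs RX RX' lc [anti compat].
pose p j := \sum_i pos_part (ext_exch s k i) * om i j - om (inl k) j.
pose om' i j := if i == inl k then (if j == inl k then 0 else p j)
  else if j == inl k then - p i else om i j.
have om_kk i : om i i = 0 by have := anti i i; lia.
have brk j : j != inl k ->
    br (X (mutation z s k) (inl k)) (X s j) = (p j)%:~R * X (mutation z s k) (inl k) * X s j.
  move=> jk; have dX : derivation R (br (X s j)) by apply: brd.
  have eX i : eigen R (br (X s j)) (X s j) (- om i j) (X s i).
    by split; rewrite // lc (anti j i); ring.
  have ek0 : \sum_i ext_exch s k i * - om i j = 0.
    by under eq_bigr do rewrite mulrN; rewrite sumrN compat (negPf jk) oppr0.
  have [_] := eigen_mutation sR dX gs eX ek0 RX' (inl k).
  rewrite /mut_weight eqxx br_anti => /eqP; rewrite eqr_oppLR => /eqP ->.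
  have -> : \sum_j0 pos_part (ext_exch s k j0) * - om j0 j - - om (inl k) j = - p j.
    by rewrite /p; under eq_bigr do rewrite mulrN; rewrite sumrN; ring.
  by rewrite rmorphN; ring.
exists om'; split.
  move=> i j; rewrite /om'.
  have [->|ik] := eqVneq i (inl k); have [->|jk] := eqVneq j (inl k).
  - have := br_anti (X (mutation z s k) (inl k)) (X (mutation z s k) (inl k)).
    move/eqP; rewrite -addr_eq0 -mulr2n -mulr_natr mulf_eq0 (negPf two_neq0) orbF => /eqP ->.
    by rewrite !mul0r.
  - by rewrite !(ext_cluster_mut_neq _ _ jk) brk.
  - by rewrite !(ext_cluster_mut_neq _ _ ik) br_anti brk // rmorphN; ring.
  - by rewrite !(ext_cluster_mut_neq _ _ ik) !(ext_cluster_mut_neq _ _ jk) lc.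
split.
  move=> i j; rewrite /om'.
  by do 2!case: eqP => _; rewrite ?opprK ?oppr0 // -?anti.
move=> l j; have [->|jk] := eqVneq j (inl k).
  pose v i := - p i.
  have -> : \sum_i ext_exch (mutation z s k) l i * om' i (inl k) =
      \sum_i ext_exch (mutation z s k) l i * (if i == inl k then 0 else v i).
    by apply: eq_bigr => i _; rewrite /om' eqxx; case: eqP.
  have vE i : v i = \sum_a pos_part (ext_exch s k a) * om i a - om i (inl k).
    rewrite /v /p opprB addrC -sumrN; congr (_ + _); last by rewrite -anti.
    by apply: eq_bigr => a _; rewrite (anti i a) mulrN.
  have sv a : \sum_i ext_exch s a i * v i =
      pos_part (ext_exch s k (inl a)) * c - (if a == k then c else 0).
    under eq_bigr do rewrite vE mulrBr mulr_sumr.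
    rewrite sumrB compat exchange_big /=; congr (_ - _); last by rewrite eq_sym.
    transitivity (\sum_b pos_part (ext_exch s k b) * (if b == inl a then c else 0)).
      apply: eq_bigr => b _; rewrite -compat mulr_sumr; apply: eq_bigr => i _; ring.
    rewrite (bigD1 (inl a)) //= eqxx big1 ?addr0 // => b /negPf ->.
    by rewrite mulr0.
  have [->|lk] := eqVneq l k.
    rewrite [LHS](@exch_mut_sum_kk _ _ _ z _ _ v _ gs) sv eqxx (ext_exch_kk gs) (pos_part_eq0 (lexx 0)).
    by rewrite eqxx; ring.
  rewrite [LHS](@exch_mut_sum _ _ _ z _ _ _ v _ gs lk) !sv (negPf lk) eqxx (ext_exch_kk gs) (pos_part_eq0 (lexx 0)).
  have -> : \sum_i pos_part (ext_exch s k i) * v i = v (inl k).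
    under eq_bigr do rewrite vE mulrBr; rewrite sumrB.
    set T := \sum_i _; have -> : T = 0.
      suff : T = - T by lia.
      rewrite /T -sumrN; under eq_bigr do rewrite mulr_sumr; rewrite exchange_big /=.
      apply: eq_bigr => a _; rewrite mulr_sumr -sumrN; apply: eq_bigr => i _.
      by rewrite (anti i a); ring.
    rewrite vE om_kk subr0 sub0r -sumrN; apply: eq_bigr => i _.
    by rewrite (anti i); ring.
  have -> : ext_exch s k (inl l) = - ext_exch s l (inl k) by exact: ext_exch_skew gs.
  have -> : (inl k == inl l :> 'I_n + 'I_m) = false by rewrite eq_sym; exact: (negbTE lk).
  ring.
have -> : \sum_i ext_exch (mutation z s k) l i * om' i j =
    \sum_i ext_exch (mutation z s k) l i * (if i == inl k then p j else om i j).
  by apply: eq_bigr => i _; rewrite /om' (negPf jk).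
have [->|lk] := eqVneq l k.
  by rewrite [LHS](@exch_mut_sum_kk _ _ _ z _ _ (om^~ j) _ gs) compat (negPf jk) oppr0.
by rewrite [LHS](@exch_mut_sum _ _ _ z _ _ _ (om^~ j) _ gs lk) !compat (negPf jk) /p; ring.
Qed.

Lemma log_canonical_walk s c om ks : good z s ->
  (forall ls i, R (X (foldl (mutation z) s ls) i)) ->
  log_canonical s om -> compatible s c om ->
  exists om', log_canonical (foldl (mutation z) s ks) om'.
Proof.
move=> gs RX lc comp.
suff [om' []] : exists om', log_canonical (foldl (mutation z) s ks) om' /\
    compatible (foldl (mutation z) s ks) c om' by exists om'.
elim/last_ind: ks => [|ks k [om' [lc' comp']]]; first by exists om.
have Rk := RX (rcons ks k); rewrite foldl_rcons in Rk *.
exact: (log_canonical_mutation (good_walk ks gs) (RX ks) Rk lc' comp').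
Qed.
End LogCanonical.


(** * Sums of eigenvectors *)

Section Annihilators.
Variables (F : fieldType) (R : set F) (d : F -> F) (h : F).
Hypotheses (sR : subring R) (dd : derivation R d) (Rh : R h) (dh : d h = 0).
Implicit Types (ns : seq int) (r : seq (int * F)).

Definition annihilator ns f : F := foldl (fun g (n : int) => d g - n%:~R * h * g) f ns.

Definition eigenvectors r : Prop := forall x, x \in r -> eigen R d h x.1 x.2.

Lemma derivation_big r : (forall x, x \in r -> R x.2) ->
  d (\sum_(x <- r) x.2) = \sum_(x <- r) d x.2.
Proof.
elim: r => [|x r IH] Rr; first by rewrite !big_nil (derivation0 sR dd).
have Rr' y : y \in r -> R y.2 by move=> yr; apply: Rr; rewrite inE yr orbT.
rewrite !big_cons (derivationD sR dd) ?IH //; first by apply: Rr; apply: mem_head.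
by rewrite big_seq; apply: (subring_sum sR).
Qed.

Lemma eigenhM n k f : eigen R d h n f -> eigen R d h n (k%:~R * h * f).
Proof.
move=> [Rf df]; have Rk : R (k%:~R * h) by apply: (subringM sR) => //; apply: (subring_int sR).
split; first exact: (subringM sR).
rewrite (derivationM dd Rk Rf) df.
by rewrite (derivationM dd (subring_int sR k) Rh) dh (derivation_int sR k dd); ring.
Qed.

Lemma annihilator_eigenvectors ns r : eigenvectors r ->
  annihilator ns (\sum_(x <- r) x.2) =
  \sum_(x <- r) (\prod_(k <- ns) ((x.1 - k)%:~R * h)) * x.2.
Proof.
elim: ns r => [|k ns IH] r er /=.
  by apply: eq_bigr => x _; rewrite big_nil mul1r.
pose r' := [seq (x.1, (x.1 - k)%:~R * h * x.2) | x <- r].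
have -> : d (\sum_(x <- r) x.2) - k%:~R * h * (\sum_(x <- r) x.2) = \sum_(x <- r') x.2.
  rewrite derivation_big => [|x /er[]//]; rewrite big_map mulr_sumr -sumrB.
  by apply: eq_big_seq => x /er[_ ->] /=; rewrite rmorphB; ring.
rewrite -/(annihilator ns _) IH => [|_ /mapP[x /er xr ->]]; last exact: eigenhM.
by rewrite big_map; apply: eq_bigr => x _ /=; rewrite big_cons; ring.
Qed.
End Annihilators.

Section Separation.
Variables (F : fieldType) (R : set F) (d : F -> F).
Hypotheses (sR : subring R) (dd : derivation R d).
Hypothesis char0 : forall n : int, n%:~R = 0 :> F -> n = 0.
Local Notation eigenvectors := (eigenvectors R d 1).

(** Annihilate all the summands with eigenvalues other than [n]. *)
Lemma eigen_separation r n f : eigenvectors r -> eigen R d 1 n f ->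
  f = \sum_(x <- r) x.2 -> f = \sum_(x <- r | x.1 == n) x.2.
Proof.
move=> er nf fE; have d1 := derivation1 sR dd; have R1 := subring1 sR.
pose ns := [seq x.1 | x <- r & x.1 != n].
pose c := \prod_(k <- ns) ((n - k)%:~R * 1 : F).
have c0 : c != 0.
  rewrite /c prodf_seq_neq0; apply/allP => k /mapP[x]; rewrite mem_filter => /andP[xn _ ->].
  by rewrite /= mulr1; apply/eqP => /char0 /eqP; rewrite subr_eq0 eq_sym (negPf xn).
apply: (mulfI c0).
have e1 : eigenvectors [:: (n, f)] by move=> x; rewrite inE => /eqP ->.
have := annihilator_eigenvectors sR dd R1 d1 ns e1; rewrite !big_seq1 /= -/c => <-.
rewrite fE (annihilator_eigenvectors sR dd R1 d1 ns er) [RHS]mulr_sumr.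
rewrite [RHS]big_mkcond; apply: eq_big_seq => x xr /=.
have [->//|xn] := eqVneq x.1 n.
have xns : x.1 \in ns by apply/mapP; exists x; rewrite // mem_filter xn.
by rewrite (big_rem _ xns) /= subrr !mul0r.
Qed.
End Separation.

Section Graded.
Variables (F : fieldType) (R : set F) (d : F -> F) (h : F).
Hypotheses (sR : subring R) (dd : derivation R d).
Local Notation eigenvectors := (eigenvectors R d h).

Definition graded (P : int -> Prop) : set F :=
  [set f | exists2 r, eigenvectors r /\ (forall x, x \in r -> P x.1) & f = \sum_(x <- r) x.2].

Lemma graded_eigen (P : int -> Prop) n f : P n -> eigen R d h n f -> graded P f.
Proof.
move=> Pn nf; exists [:: (n, f)]; last by rewrite big_seq1.
by split=> x; rewrite inE => /eqP ->.
Qed.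

Lemma graded0 (P : int -> Prop) : graded P 0.
Proof. by exists [::]; rewrite ?big_nil. Qed.

Lemma gradedD (P : int -> Prop) f g : graded P f -> graded P g -> graded P (f + g).
Proof.
move=> [r [er Pr] ->] [r' [er' Pr'] ->]; exists (r ++ r'); last by rewrite big_cat.
by split=> x; rewrite mem_cat => /orP[]; [apply: er|apply: er'|apply: Pr|apply: Pr'].
Qed.

Lemma gradedM (P Q T : int -> Prop) f g : (forall n m, P n -> Q m -> T (n + m)) ->
  graded P f -> graded Q g -> graded T (f * g).
Proof.
move=> PQT [r [er Pr] ->] [r' [er' Pr'] ->].
exists [seq (x.1 + y.1, x.2 * y.2) | x <- r, y <- r'].
  split=> _ /allpairsP[[x y] /= [xr yr ->]] /=; last by apply: PQT; [apply: Pr|apply: Pr'].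
  exact: (eigenM sR dd (er _ xr) (er' _ yr)).
rewrite big_allpairs_dep mulr_suml; apply: eq_bigr => x _ /=; rewrite mulr_sumr.
by [].
Qed.

Lemma gradedN (P : int -> Prop) f : graded P f -> graded P (- f).
Proof.
move=> [r [er Pr] ->]; exists [seq (x.1, - x.2) | x <- r].
  by split=> _ /mapP[x xr ->] /=; [apply: (eigenN sR dd); apply: er|apply: Pr].
by rewrite big_map sumrN.
Qed.

Lemma graded_subring (P : int -> Prop) : P 0 -> (forall n m, P n -> P m -> P (n + m)) ->
  subring (graded P).
Proof.
move=> P0 PD; split=> [|f g Pf Pg|f g]; last exact: gradedM.
  by apply: (graded_eigen P0); apply: (eigen1 h sR dd).
by apply: gradedD => //; apply: gradedN.
Qed.
End Graded.

Section Diagonal.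
Variables (F : fieldType) (R : set F) (d : F -> F) (h : F).
Hypotheses (sR : subring R) (dd : derivation R d) (Rh : R h) (dh : d h = 0).
Local Notation annihilator := (annihilator d h).

Lemma annihilator_member ns f : R f -> R (annihilator ns f).
Proof.
elim: ns f => [|k ns IH] f Rf //=; apply: IH; apply: (subringB sR).
  exact: (derivation_member dd).
by apply: (subringM sR) => //; apply: (subringM sR) => //; apply: (subring_int sR).
Qed.

(** Multiplication by an eigenvector shifts the eigenvalues. *)
Lemma annihilator_shift ns n u f : eigen R d h n u -> R f ->
  annihilator ns (u * f) = u * annihilator [seq k - n | k <- ns] f.
Proof.
move=> nu; elim: ns f => [|k ns IH] f Rf //=.
have [Ru du] := nu; rewrite (derivationM dd Ru Rf) du -IH.
  by apply: (congr1 (annihilator ns)); rewrite rmorphB; ring.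
exact: (@annihilator_member [:: k - n]).
Qed.

(** In the Laurent ring of a seed made of eigenvectors the derivation is
    diagonalizable; here this is only claimed for the elements of [R], the
    inverses of the cluster variables being absorbed in a denominator. *)
Lemma laurent_annihilated n m (z : 'I_m -> F) (t : seed F n m) w f :
  good z t -> (forall i, eigen R d h (w i) (ext_cluster z t i)) ->
  laurent_seed z t f -> R f -> exists ns, annihilator ns f = 0.
Proof.
move=> gt wX Lf Rf; pose u := \prod_i ext_cluster z t i.
have sG : subring (graded R d h (fun=> True)) by apply: graded_subring.
have Gprod (P : pred _) : graded R d h (fun=> True) (\prod_(i | P i) ext_cluster z t i).
  by apply: (subring_prod sG) => i _; apply: (graded_eigen I).
have u0 : u != 0 by apply/prodf_neq0 => i _; apply: good_neq0 gt.
have [N [r [er _] ufE]] : localization (graded R d h (fun=> True)) u f.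
  move: f Lf {Rf}; apply: lauring_min.
  - by apply: localization_subring => //; apply: Gprod.
  - by move=> i _; apply: localizationC => //; apply: (graded_eigen I).
  move=> i _; apply: localization1; rewrite /u (bigD1 i) //= mulrAC divff ?mul1r //.
  exact: good_neq0 gt.
have eu : eigen R d h (\sum_i w i) u.
  rewrite /u; apply: (big_rec2 (fun a b => eigen R d h b a)) => [|i a b _ ab].
    exact: (eigen1 h sR dd).
  exact: eigenM.
have euN := eigenX sR dd N eu.
have uN0 : u ^+ N != 0 by rewrite expf_neq0.
exists [seq k - (\sum_i w i) * N%:Z | k <- [seq x.1 | x <- r]].
apply: (mulfI uN0); rewrite -annihilator_shift // ufE mulr0.
rewrite (annihilator_eigenvectors sR dd Rh dh _ er) big_seq big1 // => x xr.
have xns : x.1 \in [seq x.1 | x <- r] by apply/mapP; exists x.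
by rewrite (big_rem _ xns) /= subrr !mul0r.
Qed.

(** On the span of [y] and [x] the derivation acts by a matrix of trace zero
    whose square is the scalar [h ^+ 2 - 4 * a * c], so it has no eigenvalue
    which is an integral multiple of [h]. *)
Lemma span_not_annihilated (K : set F) x y a c ns : subring K -> K `<=` R ->
  (forall u, K u -> d u = 0) -> R x -> R y -> K h -> K a -> K c ->
  (forall u v, K u -> K v -> u * y + v * x = 0 -> u = 0 /\ v = 0) ->
  (forall n : int, (n%:~R ^+ 2 - 1) * h ^+ 2 + 4 * a * c != 0) ->
  d y = h * y + 2 * c * x -> d x = - h * x - 2 * a * y ->
  annihilator ns y != 0.
Proof.
move=> sK KR dK Rx Ry Kh Ka Kc free det dy dx.
suff span u v : K u -> K v -> annihilator ns (u * y + v * x) = 0 -> u = 0 /\ v = 0.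
  apply/eqP => y0; have [|/eqP] := span 1 0 (subring1 sK) (subring0 sK).
    by rewrite mul1r mul0r addr0.
  by rewrite oner_eq0.
elim: ns u v => [|k ns IH] u v Ku Kv; first exact: free.
have Kn n : K n%:R by apply: (subring_nat sK).
have Kk : K k%:~R by apply: (subring_int sK).
pose u' := (1 - k%:~R) * h * u - 2 * a * v; pose v' := 2 * c * u - (1 + k%:~R) * h * v.
have Ku' : K u'.
  by do ?[apply: (subringB sK)|apply: (subringM sK)] => //; apply: (subring1 sK).
have Kv' : K v'.
  apply: (subringB sK); first by do ?[apply: (subringM sK)] => //.
  do 2!(apply: (subringM sK) => //).
  by apply: (subringD sK) => //; apply: (subring1 sK).
have step : d (u * y + v * x) - k%:~R * h * (u * y + v * x) = u' * y + v' * x.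
  have Ru := KR u Ku; have Rv := KR v Kv.
  rewrite (derivationD sR dd (subringM sR Ru Ry) (subringM sR Rv Rx)).
  rewrite (derivationM dd Ru Ry) (derivationM dd Rv Rx) (dK u Ku) (dK v Kv) dy dx /u' /v'; ring.
rewrite /= -/(annihilator ns _) step => /(IH _ _ Ku' Kv')[u'0 v'0].
have detE w : ((k%:~R ^+ 2 - 1) * h ^+ 2 + 4 * a * c) * w = 0 -> w = 0.
  by move/eqP; rewrite mulf_eq0 (negPf (det k)) => /eqP.
split; apply: detE.
- have -> : ((k%:~R ^+ 2 - 1) * h ^+ 2 + 4 * a * c) * u =
    2 * a * v' - (1 + k%:~R) * h * u' by rewrite /u' /v'; ring.
  by rewrite u'0 v'0 !mulr0 subrr.
- have -> : ((k%:~R ^+ 2 - 1) * h ^+ 2 + 4 * a * c) * v =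
    (1 - k%:~R) * h * v' - 2 * c * u' by rewrite /u' /v'; ring.
  by rewrite u'0 v'0 !mulr0 subrr.
Qed.
End Diagonal.


(** * The central entry is not in the cluster algebra *)

(** The seed reached from the initial one by mutation at 2, 4 and 5; the central
    entry has a Laurent expansion with three terms there. *)
Definition CG3_seed_table : seq (seq int) :=
  [:: [:: 0; 0; 0; 0; 1; 1; 0; 0; -1];
      [:: 0; 0; -2; 1; -1; 1; 0; 0; 0];
      [:: 0; 2; 0; -1; 0; 0; 0; 0; 0];
      [:: 0; -1; 1; 0; 0; -1; 1; -1; 0];
      [:: -1; 1; 0; 0; 0; -1; 0; 0; 0];
      [:: -1; -1; 0; 1; 1; 0; -1; 0; 1]].

(** Weights balancing the exchange relations of this seed, for which the entries
    have weights 9 to 17. *)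
Definition CG3_weights : seq int := [:: 17; 27; 24; 54; 16; 10; 52; 39; 26].

(** Among the compatible structures, which differ by combinations of weights, this
    one is chosen so that [b2], [a2] and [c2] commute with each other. *)
Definition CG3_poisson : seq (seq int) :=
  [:: [:: 0; 0; 1; 0; -2; 0; -2; -1; 0];
      [:: 0; 0; 1; 0; 0; 0; 0; 1; 0];
      [:: -1; -1; 0; 0; 0; 0; 2; 3; 0];
      [:: 0; 0; 0; 0; 0; 0; 0; 2; 0];
      [:: 2; 0; 0; 0; 0; 0; -2; -2; 0];
      [:: 0; 0; 0; 0; 0; 0; 2; 2; 0];
      [:: 2; 0; -2; 0; 2; -2; 0; 0; 0];
      [:: 1; -1; -3; -2; 2; -2; 0; 0; 0];
      [:: 0; 0; 0; 0; 0; 0; 0; 0; 0]].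

Lemma sum_row_of (f : nat -> int) : \sum_(i : 'I_6 + 'I_3) f (row_of i) =
  f 0%N + (f 1%N + (f 2%N + (f 3%N + (f 4%N + (f 5%N + (f 6%N + (f 7%N + f 8%N))))))).
Proof.
transitivity (\sum_(i < 9) f i).
  by rewrite big_sumType (@big_split_ord _ _ _ 6 3).
by rewrite !big_ord_recl big_ord0 addr0.
Qed.

Section Tables.
Variables (F : fieldType) (s : seed F 6 3).
Hypothesis st : has_table s CG3_seed_table.

Lemma CG3_weights_balanced k : \sum_i ext_exch s k i * nth 0 CG3_weights (row_of i) = 0.
Proof.
under eq_bigr do rewrite st; rewrite (sum_row_of (fun i => entry CG3_seed_table k i * nth 0 CG3_weights i)).
by case: k => -[|[|[|[|[|[|//]]]]]] k6; vm_compute.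
Qed.

Lemma CG3_poisson_compatible :
  compatible s 2 (fun i j => entry CG3_poisson (row_of i) (row_of j)).
Proof.
split.
  by case=> [[[|[|[|[|[|[|//]]]]]] ?]|[[|[|[|//]]] ?]];
     case=> [[[|[|[|[|[|[|//]]]]]] ?]|[[|[|[|//]]] ?]]; vm_compute.
move=> l j; under eq_bigr do rewrite st.
rewrite (sum_row_of (fun i => entry CG3_seed_table l i * entry CG3_poisson i (row_of j))).
by case: l => -[|[|[|[|[|[|//]]]]]] ?; case: j => [[[|[|[|[|[|[|//]]]]]] ?]|[[|[|[|//]]] ?]];
   vm_compute.
Qed.
End Tables.

Section Centre.
Variables (F : fieldType) (z : 'I_3 -> F) (s : seed F 6 3).
Variables (a1 a2 a3 b1 b2 b3 c1 c2 c3 : F).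
Let m := [:: a1; a2; a3; b1; b2; b3; c1; c2; c3].
Let w (i : 'I_9) := nth 0 m i.
Let y := a3 * c2 - a2 * c3.
Let x := a2 * b3 - a3 * b2.
Let v := x * (b2 * c3 - b3 * c2) - y ^+ 2.
Let x4 := a1 * b2 - a2 * b1.
Let d1 := (a2 * c1 - a1 * c2) * (a2 * c3 - a3 * c2) + (a1 * b2 - a2 * b1) * (b2 * c3 - b3 * c2).
Let d2 := a1 * (b2 * c3 - b3 * c2) - a2 * (b1 * c3 - b3 * c1) + a3 * (b1 * c2 - b2 * c1).
Let d3 := a1 * c3 - a2 * c2.
Hypotheses (gs : good z s) (st : has_table s CG3_seed_table).
Hypothesis sx : has_cluster z s [:: c3; y; x; v; c2; a2; d1; d2; d3].
Hypothesis indw : independent w.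
Hypothesis char0 : forall n : int, n%:~R = 0 :> F -> n = 0.
Let R := laurent_seed z s.
Let sR : subring R := lauring_subring _ _ _.
Hypothesis Rw : forall i, R (w i).

Let Rx i : R (ext_cluster z s i) := lauring_var (isT : predT i).
Let nz i := independent_neq0 i indw.
Let a20 : a2 != 0 := nz (@Ordinal 9 1 isT). Let c20 : c2 != 0 := nz (@Ordinal 9 7 isT).
Let c30 : c3 != 0 := nz (@Ordinal 9 8 isT). Let b20 : b2 != 0 := nz (@Ordinal 9 4 isT).
Let Xnz (i : 'I_6 + 'I_3) : nth 0 [:: c3; y; x; v; c2; a2; d1; d2; d3] (row_of i) != 0.
Proof. by rewrite -(sx.2 i); apply: good_neq0 gs. Qed.
Let y0 : y != 0 := Xnz (inl (@Ordinal 6 1 isT)).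
Let x0 : x != 0 := Xnz (inl (@Ordinal 6 2 isT)).
Let v0 : v != 0 := Xnz (inl (@Ordinal 6 3 isT)).

Let b2E : b2 * (y * x) = - (v * a2 + x ^+ 2 * c2 + y ^+ 2 * a2).
Proof. by rewrite /v /y /x; ring. Qed.

Let Ra1 : R a1 := Rw (@Ordinal 9 0 isT). Let Ra3 : R a3 := Rw (@Ordinal 9 2 isT).
Let Rb1 : R b1 := Rw (@Ordinal 9 3 isT). Let Rb2 : R b2 := Rw (@Ordinal 9 4 isT).
Let Rb3 : R b3 := Rw (@Ordinal 9 5 isT). Let Rc1 : R c1 := Rw (@Ordinal 9 6 isT).
Let Rx4 : R x4.
Proof.
by apply: (subringB sR); apply: (subringM sR) => //; apply: (Rw (@Ordinal 9 1 isT)).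
Qed.

Lemma entry_weights d : derivation R d ->
  (forall i, d (ext_cluster z s i) = (nth 0 CG3_weights (row_of i))%:~R * ext_cluster z s i) ->
  forall i : 'I_9, eigen R d 1 (9 + i)%:Z (w i).
Proof.
move=> dd dX.
have eX i : eigen R d 1 (nth 0 CG3_weights (row_of i)) (nth 0 [:: c3; y; x; v; c2; a2; d1; d2; d3] (row_of i)).
  by rewrite -(sx.2 i); split; rewrite // mulr1.
have ec3 : eigen R d 1 17 c3 := eX (inl (@Ordinal 6 0 isT)).
have ey : eigen R d 1 27 y := eX (inl (@Ordinal 6 1 isT)).
have ex : eigen R d 1 24 x := eX (inl (@Ordinal 6 2 isT)).
have ev : eigen R d 1 54 v := eX (inl (@Ordinal 6 3 isT)).
have ec2 : eigen R d 1 16 c2 := eX (inl (@Ordinal 6 4 isT)).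
have ea2 : eigen R d 1 10 a2 := eX (inl (@Ordinal 6 5 isT)).
have ed1 : eigen R d 1 52 d1 := eX (inr (@Ordinal 3 0 isT)).
have ed2 : eigen R d 1 39 d2 := eX (inr (@Ordinal 3 1 isT)).
have ed3 : eigen R d 1 26 d3 := eX (inr (@Ordinal 3 2 isT)).
have M := @eigenM F R d 1 sR dd; have D := @eigenD F R d 1 sR dd.
have B := @eigenB F R d 1 sR dd; have N := @eigenN F R d 1 sR dd.
have V n k u f : u != 0 -> eigen R d 1 k u -> R f -> eigen R d 1 (n + k) (f * u) -> eigen R d 1 n f.
  exact: eigen_div.
have ea3 : eigen R d 1 11 a3.
  apply: (V _ _ _ _ c20 ec2) => //; have -> : a3 * c2 = y + c3 * a2 by rewrite /y; ring.
  by apply: (D _ _ _ ey (M _ _ _ _ ec3 ea2)).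
have eb2 : eigen R d 1 13 b2.
  apply: (V _ _ _ _ (mulf_neq0 y0 x0) (M _ _ _ _ ey ex)) => //; rewrite b2E.
  apply/N/D; first apply: D; first exact: (M _ _ _ _ ev ea2).
    exact: (M _ _ _ _ (M _ _ _ _ ex ex) ec2).
  exact: (M _ _ _ _ (M _ _ _ _ ey ey) ea2).
have eb3 : eigen R d 1 14 b3.
  apply: (V _ _ _ _ a20 ea2) => //; have -> : b3 * a2 = x + a3 * b2 by rewrite /x; ring.
  by apply: (D _ _ _ ex (M _ _ _ _ ea3 eb2)).
have ea1 : eigen R d 1 9 a1.
  apply: (V _ _ _ _ c30 ec3) => //; have -> : a1 * c3 = d3 + a2 * c2 by rewrite /d3; ring.
  by apply: (D _ _ _ ed3 (M _ _ _ _ ea2 ec2)).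
have ex4 : eigen R d 1 22 x4.
  apply: (V _ _ _ _ v0 ev) => //.
  have -> : x4 * v = x * d1 + y * a2 * d2 by rewrite /x4 /v /x /y /d1 /d2; ring.
  by apply: (D _ _ _ (M _ _ _ _ ex ed1) (M _ _ _ _ (M _ _ _ _ ey ea2) ed2)).
have eb1 : eigen R d 1 12 b1.
  apply: (V _ _ _ _ a20 ea2) => //; have -> : b1 * a2 = a1 * b2 - x4 by rewrite /x4; ring.
  by apply: (B _ _ _ (M _ _ _ _ ea1 eb2) ex4).
have ec1 : eigen R d 1 15 c1.
  apply: (V _ _ _ _ x0 ex) => //.
  have -> : c1 * x = d2 - a1 * (b2 * c3 - b3 * c2) - b1 * y by rewrite /x /y /d2; ring.
  apply: (B _ _ _ _ (M _ _ _ _ eb1 ey)); apply: (B _ _ _ ed2); apply: (M 9 30 _ _ ea1).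
  by apply: (B _ _ _ (M _ _ _ _ eb2 ec3) (M _ _ _ _ eb3 ec2)).
by case=> -[|[|[|[|[|[|[|[|[|//]]]]]]]]].
Qed.

Hypothesis two_neq0 : 2 != 0 :> F.

(** Differentiate the Laurent expansion [b2E] of the central entry. *)
Lemma derivation_centre d p q : derivation R d -> d v = 0 -> d c2 = 0 -> d a2 = 0 ->
  d y = p * y -> d x = q * x ->
  d b2 * (y * x) = - (p + q) * b2 * y * x - 2 * (q * x ^+ 2 * c2 + p * y ^+ 2 * a2).
Proof.
move=> dd dv dc da dy dx.
have Ry : R y := eq_ind _ R (Rx (inl (@Ordinal 6 1 isT))) _ (sx.2 (inl (@Ordinal 6 1 isT))).
have Rxx : R x := eq_ind _ R (Rx (inl (@Ordinal 6 2 isT))) _ (sx.2 (inl (@Ordinal 6 2 isT))).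
have Rv : R v := eq_ind _ R (Rx (inl (@Ordinal 6 3 isT))) _ (sx.2 (inl (@Ordinal 6 3 isT))).
have Rc2 : R c2 := Rw (@Ordinal 9 7 isT). have Ra2 : R a2 := Rw (@Ordinal 9 1 isT).
have M f g : R f -> R g -> R (f * g) := @subringM _ _ sR f g.
have Dva : d (v * a2) = 0 by rewrite (derivationM dd Rv Ra2) dv da mul0r mulr0 addr0.
have Dxc : d (x ^+ 2 * c2) = 2 * q * x ^+ 2 * c2.
  by rewrite expr2 (derivationM dd (M _ _ Rxx Rxx) Rc2) (derivationM dd Rxx Rxx) dx dc; ring.
have Dya : d (y ^+ 2 * a2) = 2 * p * y ^+ 2 * a2.
  by rewrite expr2 (derivationM dd (M _ _ Ry Ry) Ra2) (derivationM dd Ry Ry) dy da; ring.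
have R1 : R (v * a2) := M _ _ Rv Ra2.
have R2 : R (x ^+ 2 * c2) := M _ _ (M _ _ Rxx Rxx) Rc2.
have R3 : R (y ^+ 2 * a2) := M _ _ (M _ _ Ry Ry) Ra2.
have R12 := subringD sR R1 R2.
have := congr1 d b2E.
rewrite (derivationM dd Rb2 (M _ _ Ry Rxx)) (derivationM dd Ry Rxx) dy dx.
rewrite (derivationN sR dd (subringD sR R12 R3)) (derivationD sR dd R12 R3) (derivationD sR dd R1 R2).
rewrite Dva Dxc Dya => E.
by apply: (addIr (b2 * (p * y * x + y * (q * x)))); rewrite E; ring.
Qed.

(** A cluster variable which is a multiple of the central entry would generate,
    through the bracket, a diagonalizable derivation with eigenvalues in its
    integral multiples; on the span of [y] and [x] this derivation has other
    eigenvalues. *)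
Lemma centre_not_cluster_variable ks (i : 'I_6) (k : int) : k != 0 ->
  cluster (foldl (mutation z) s ks) i <> k%:~R * b2.
Proof.
move=> k0 Xk; have [indX _ _] := gs.
have [anti _] := CG3_poisson_compatible st.
have [br [brd br_anti brX]] := log_canonical_bracket indX anti.
have RX ls j : R (ext_cluster z (foldl (mutation z) s ls) j).
  case: j => [j|l]; first exact: (@laurent_phenomenon _ _ _ z s ls [::] j gs).
  exact: (Rx (inr l)).
have [om lc] := log_canonical_walk sR brd br_anti two_neq0 ks gs RX brX (CG3_poisson_compatible st).
pose h := k%:~R * b2.
have kF : k%:~R != 0 :> F by apply: contra_neq k0; apply: char0.
have Rk : R k%:~R by apply: (subring_int sR).
have Rh : R h by apply: (subringM sR).
have dd : derivation R (br h) by apply: brd.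
have br0 f : br f f = 0.
  have := br_anti f f; move/eqP; rewrite -addr_eq0 -mulr2n -mulr_natr mulf_eq0 (negPf two_neq0) orbF.
  by move/eqP.
have hE f : R f -> br h f = - k%:~R * br f b2.
  move=> Rf; rewrite br_anti (derivationM (brd f Rf) Rk Rb2) (derivation_int sR k (brd f Rf)).
  by ring.
pose X j := nth 0 [:: c3; y; x; v; c2; a2; d1; d2; d3] (row_of j).
have brE i1 i2 : br (X i1) (X i2) = (entry CG3_poisson (row_of i1) (row_of i2))%:~R * X i1 * X i2.
  by rewrite /X -!(sx.2 _) brX.
have RXj j : R (X j) by rewrite /X -(sx.2 j); apply: Rx.
have yx0 : y * x != 0 by rewrite mulf_neq0.
have brb j p q : br (X j) v = 0 -> br (X j) c2 = 0 -> br (X j) a2 = 0 ->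
    br (X j) y = p * y -> br (X j) x = q * x ->
    br (X j) b2 * (y * x) = - (p + q) * b2 * y * x - 2 * (q * x ^+ 2 * c2 + p * y ^+ 2 * a2).
  exact: (derivation_centre (brd _ (RXj j))).
pose jy := inl (@Ordinal 6 1 isT) : 'I_6 + 'I_3. pose jx := inl (@Ordinal 6 2 isT) : 'I_6 + 'I_3.
pose jv := inl (@Ordinal 6 3 isT) : 'I_6 + 'I_3.
pose jc := inl (@Ordinal 6 4 isT) : 'I_6 + 'I_3. pose ja := inl (@Ordinal 6 5 isT) : 'I_6 + 'I_3.
have zero i1 i2 : entry CG3_poisson (row_of i1) (row_of i2) = 0 -> br (X i1) (X i2) = 0.
  by move=> e0; rewrite brE e0 !mul0r.
have zero' i1 i2 : entry CG3_poisson (row_of i1) (row_of i2) = 0 -> br (X i1) (X i2) = 0 * X i2.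
  by rewrite mul0r; apply: zero.
have dy : br h y = h * y + 2 * (k%:~R * c2) * x.
  have yx : br (X jy) x = y * x by rewrite (brE jy jx) mul1r.
  have E := brb jy 0 y (zero jy jv erefl) (zero jy jc erefl) (zero jy ja erefl) (zero' jy jy erefl) yx; rewrite -[X jy]/y in E.
  rewrite hE; last exact: (RXj jy).
  by apply: (mulIf yx0); rewrite -[LHS]mulrA E /h; ring.
have dx : br h x = - h * x - 2 * (k%:~R * a2) * y.
  have xy : br (X jx) y = - x * y by rewrite (brE jx jy) mulN1r.
  have E := brb jx (- x) 0 (zero jx jv erefl) (zero jx jc erefl) (zero jx ja erefl) xy (zero' jx jx erefl); rewrite -[X jx]/x in E.
  rewrite hE; last exact: (RXj jx).
  by apply: (mulIf yx0); rewrite -[LHS]mulrA E /h; ring.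
have da : br h a2 = 0.
  rewrite hE; last exact: (RXj ja).
  have := brb ja 0 0 (zero ja jv erefl) (zero ja jc erefl) (zero ja ja erefl) (zero' ja jy erefl) (zero' ja jx erefl).
  rewrite !mul0r addr0 mulr0 subr0 oppr0 !mul0r => /eqP.
  by rewrite mulf_eq0 (negPf yx0) orbF => /eqP ->; rewrite mulr0.
have dc : br h c2 = 0.
  rewrite hE; last exact: (RXj jc).
  have := brb jc 0 0 (zero jc jv erefl) (zero jc jc erefl) (zero jc ja erefl) (zero' jc jy erefl) (zero' jc jx erefl).
  rewrite !mul0r addr0 mulr0 subr0 oppr0 !mul0r => /eqP.
  by rewrite mulf_eq0 (negPf yx0) orbF => /eqP ->; rewrite mulr0.
have db : br h b2 = 0 by rewrite hE // br0 mulr0.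
have [ns ann] : exists ns, annihilator (br h) h ns y = 0.
  apply: (laurent_annihilated sR dd Rh (br0 h) (good_walk ks gs) (w := fun j => om (inl i) j)) => //.
  - move=> j; split; first exact: RX.
    by rewrite /h -Xk; apply: (lc (inl i) j).
  - rewrite -[y](sx.2 jy).
    have := @laurent_phenomenon _ _ _ z s (ks ++ rev ks) ks (@Ordinal 6 1 isT) gs.
    by rewrite foldl_cat walk_rev.
  - exact: (RXj jy).
pose J : pred 'I_9 := fun i => [|| i == @Ordinal 9 1 isT, i == @Ordinal 9 4 isT | i == @Ordinal 9 7 isT].
pose K := polyring w J; have sK : subring K by apply: polyring_subring.
have KR : K `<=` R by apply: lauring_min => // i1 _; apply: Rw.
have Ka : K a2 by apply: (@lauring_var _ _ w J pred0 (@Ordinal 9 1 isT)).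
have Kb : K b2 by apply: (@lauring_var _ _ w J pred0 (@Ordinal 9 4 isT)).
have Kc : K c2 by apply: (@lauring_var _ _ w J pred0 (@Ordinal 9 7 isT)).
have Kk : K k%:~R by apply: (subring_int sK).
have dK u : K u -> br h u = 0.
  have sC : subring [set f | R f /\ br h f = 0].
    split=> [|f g [Rf df] [Rg dg]|f g [Rf df] [Rg dg]].
    - by split; [exact: (subring1 sR)|exact: (derivation1 sR dd)].
    - by split; [exact: (subringB sR)|have [_ -> _] := dd f g Rf Rg; rewrite df dg subrr].
    - by split; [exact: (subringM sR)|rewrite (derivationM dd Rf Rg) df dg mul0r mulr0 addr0].
  suff KC : K `<=` [set f | R f /\ br h f = 0] by move/KC => [].
  apply: lauring_min => // i1 Ji; split; first exact: Rw.
  by move: Ji; rewrite /J => /or3P[] /eqP ->.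
have : annihilator (br h) h ns y != 0.
  apply: (@span_not_annihilated _ _ _ _ sR dd K x y (k%:~R * a2) (k%:~R * c2) ns sK KR dK (RXj jx) (RXj jy) _ _ _ _ _ dy dx).
  - exact: (subringM sK).
  - exact: (subringM sK).
  - exact: (subringM sK).
  - have KE : K `<=` lauring w (all_but (@Ordinal 9 8 isT)) (all_but (@Ordinal 9 8 isT)).
      by apply: lauring_sub => // i1 /or3P[] /eqP ->.
    have sE := lauring_subring w (all_but (@Ordinal 9 8 isT)) (all_but (@Ordinal 9 8 isT)).
    move=> p q Kp Kq pq0; have Ep := KE p Kp; have Eq := KE q Kq.
    have p0 : p = 0.
      apply/eqP; apply: contraTT isT => p0.
      have : - a2 * p * c3 + (p * a3 * c2 + q * x) != 0.
        apply: (affine_neq0 indw (i := @Ordinal 9 8 isT)).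
        + apply: (subringD sE); first by apply: (subringM sE); [apply: (subringM sE) => //|]; lauring_mem.
          by apply: (subringM sE) => //; rewrite /x; lauring_mem.
        + by apply: (subringM sE) => //; lauring_mem.
        + by rewrite mulf_neq0 // oppr_eq0.
      by apply: contraNT => _; apply/eqP; rewrite -pq0 /y; ring.
    split=> //; move: pq0; rewrite p0 mul0r add0r => /eqP.
    by rewrite mulf_eq0 (negPf x0) orbF => /eqP.
  - move=> n; have -> : (n%:~R ^+ 2 - 1) * h ^+ 2 + 4 * (k%:~R * a2) * (k%:~R * c2) =
      k%:~R ^+ 2 * (4 * a2 * c2 + (n%:~R ^+ 2 - 1) * b2 ^+ 2) by rewrite /h; ring.
    rewrite mulf_neq0 ?expf_neq0 //.
    have four0 : 4 != 0 :> F by apply/eqP => e; have := char0 (n := 4) e.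
    apply: (affine_neq0 indw (i := @Ordinal 9 7 isT)).
    + have sE := lauring_subring w (all_but (@Ordinal 9 7 isT)) (all_but (@Ordinal 9 7 isT)).
      apply: (subringM sE); last by lauring_mem.
      by apply: (subringB sE); [apply: (subringX sE); apply: (subring_int sE)|apply: (subring1 sE)].
    + have sE := lauring_subring w (all_but (@Ordinal 9 7 isT)) (all_but (@Ordinal 9 7 isT)).
      by apply: (subringM sE); [apply: (subring_nat sE)|lauring_mem].
    + by rewrite mulf_neq0.
by rewrite ann eqxx.
Qed.

(** Integral combinations of 1 and [b2] plus elements with weights at least 9 other
    than 13 form a ring [S'], as products of two weights exceed 13, so every
    polynomial in the entries is of this form.  A homogeneous such element has
    weight 0, is a multiple of [b2], or has weight at least 9 and not 13.  The
    second case being excluded for cluster variables, they all lie in the subring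
    of elements without component of weight 13. *)
Lemma centre_notin_cluster_algebra :
  (forall ks (i : 'I_6), polyring w predT (cluster (foldl (mutation z) s ks) i)) ->
  ~ cluster_algebra z (ZPplus z) s b2.
Proof.
move=> Sx; have [indX _ _] := gs.
have RX ls j : R (ext_cluster z (foldl (mutation z) s ls) j).
  case: j => [j|l]; first exact: (@laurent_phenomenon _ _ _ z s ls [::] j gs).
  exact: (Rx (inr l)).
have [d [dd dX]] := diagonal_derivation indX
  (c := fun i => (nth 0 CG3_weights (row_of i))%:~R) (fun i => subring_int sR _).
have ew := entry_weights dd dX.
pose P (n : int) := n = 0 \/ (9 <= n /\ n != 13); pose P9 (n : int) := 9 <= n /\ n != 13.
have sP : subring (graded R d 1 P) by apply: graded_subring => // [|n k]; rewrite /P; [left|lia].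
have e0 (p : int) : eigen R d 1 0 p%:~R.
  by split; [apply: (subring_int sR)|rewrite (derivation_int sR p dd) !mul0r].
have eb2 : eigen R d 1 13 b2 := ew (@Ordinal 9 4 isT).
pose S' := [set f | exists p q : int, exists2 g, graded R d 1 P9 g & f = p%:~R + q%:~R * b2 + g].
have gint (p : int) g : graded R d 1 P9 g -> graded R d 1 P9 (p%:~R * g).
  apply: (gradedM sR dd (P := fun n => n = 0)); last exact: graded_eigen (e0 p).
  by move=> n k -> ; rewrite add0r.
have gb2 g : graded R d 1 P9 g -> graded R d 1 P9 (b2 * g).
  apply: (gradedM sR dd (P := fun n => n = 13)); last exact: graded_eigen eb2.
  by move=> n k ->; rewrite /P9; lia.
have sS' : subring S'.
  split=> [|_ _ [p [q [g Gg ->]]] [p' [q' [g' Gg' ->]]]|_ _ [p [q [g Gg ->]]] [p' [q' [g' Gg' ->]]]].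
  - by exists 1, 0, 0; [apply: graded0|rewrite mul0r !addr0].
  - exists (p - p'), (q - q'), (g - g'); first by apply: gradedD => //; apply: gradedN.
    by rewrite !rmorphB; ring.
  exists (p * p'), (p * q' + q * p'), ((q * q')%:~R * (b2 * b2) + p%:~R * g' + p'%:~R * g
    + q%:~R * (b2 * g') + q'%:~R * (b2 * g) + g * g').
    have gg' : graded R d 1 P9 (g * g').
      by apply: (gradedM sR dd _ Gg Gg') => n k; rewrite /P9; lia.
    have b2b2 : graded R d 1 P9 (b2 * b2).
      by apply: (graded_eigen (n := 26)) => //; apply: (eigenM sR dd eb2 eb2).
    by do !apply: gradedD => //; apply: gint => //; apply: gb2.
  by rewrite !rmorphD !rmorphM; ring.
have SS' : polyring w predT `<=` S'.
  apply: lauring_min => // i _; have [i4|i4] := eqVneq i (@Ordinal 9 4 isT).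
    by exists 0, 1, 0; [apply: graded0|rewrite i4 mul1r add0r addr0].
  exists 0, 0, (w i); last by rewrite mul0r !add0r.
  apply: graded_eigen (ew i); split; first by lia.
  by apply: contra_neq i4 => i4; apply: val_inj => /=; lia.
have Gx ks (i : 'I_6) : graded R d 1 P (cluster (foldl (mutation z) s ks) i).
  have [w' ew'] := eigen_walk sR dd gs RX dX (CG3_weights_balanced st) ks.
  have := ew' (inl i); rewrite /=; set f := cluster _ i => ef.
  have f0 : f != 0 := good_neq0 (inl i) (good_walk ks gs).
  have [p [q [g [r [er Pr] gE] fE]]] := SS' _ (Sx ks i).
  have [Pn|nP] := pselect (P (w' (inl i))); first exact: graded_eigen ef.
  have ebq : eigen R d 1 13 (q%:~R * b2) := eigenM sR dd (e0 q) eb2.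
  have er' : eigenvectors R d 1 [:: (0, p%:~R), (13, q%:~R * b2) & r].
    move=> a; rewrite !inE => /or3P[/eqP ->|/eqP ->|/er//]; [exact: e0|exact: ebq].
  have fE' : f = \sum_(a <- [:: (0, p%:~R), (13, q%:~R * b2) & r]) a.2.
    by rewrite !big_cons /= -gE addrA -fE.
  have := eigen_separation sR dd char0 er' ef fE'; rewrite !big_cons /=.
  have -> : \sum_(a <- r | a.1 == w' (inl i)) a.2 = 0.
    rewrite big_seq_cond big1 // => a /andP[/Pr Pa /eqP an].
    by case: nP; rewrite -an; right.
  have -> : (0 == w' (inl i)) = false by apply/eqP => n0; case: nP; left.
  case: ifP => _; last by move/eqP; rewrite (negPf f0).
  rewrite addr0 => fq; have q0 : q != 0 by apply: contraNneq f0 => q0; rewrite fq q0 mul0r.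
  by case: (centre_not_cluster_variable (i := i) (ks := ks) q0).
suff sub : cluster_algebra z (ZPplus z) s `<=` graded R d 1 P.
  move=> /sub [r [er Pr] b2r].
  have := eigen_separation sR dd char0 er eb2 b2r.
  rewrite big_seq_cond big1 => [b20'|a /andP[/Pr Pa /eqP a13]]; first by move: b20; rewrite b20' eqxx.
  by move: Pa; rewrite a13 => -[/eqP|[_ /eqP]].
apply: gen_subring_min => // f [|/cluster_variablesP[ks [i ->]]] //.
apply: gen_subring_min => // _ [l _ <-].
apply: (graded_eigen (n := nth 0 CG3_weights (row_of (inr l)))).
  by right; case: l => -[|[|[|//]]].
by split; [exact: (Rx (inr l))|rewrite mulr1; exact: (dX (inr l))].
Qed.
End Centre.


(** * Comparison of the two algebras *)

Lemma embeds_ZP_char0 (F : fieldType) m (z : 'I_m -> F) : embeds_ZP z ->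
  forall n : int, n%:~R = 0 :> F -> n = 0.
Proof.
move=> hz n n0; have := hz n%:MP; rewrite mmapC => /(_ n0) /eqP.
by rewrite mpolyC_eq0 => /eqP.
Qed.

Lemma cluster_variables_walk (F : fieldType) n m (z : 'I_m -> F) (s : seed F n m) ks : good z s ->
  cluster_variables z (foldl (mutation z) s ks) = cluster_variables z s.
Proof.
move=> gs; apply/seteqP; split=> f /cluster_variablesP[ls [i ->]]; apply/cluster_variablesP.
  by exists (ks ++ ls), i; rewrite foldl_cat.
by exists (rev ks ++ ls), i; rewrite foldl_cat walk_rev.
Qed.

(** The central entry is Laurent in the seed reached by mutation at 2, 4 and 5
    without frozen denominators, hence in all seeds. *)
Lemma CG3_upper_not_sub_cluster (F : fieldType) (z : 'I_3 -> F) (s : seed F 6 3) :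
  (forall n : int, n%:~R = 0 :> F -> n = 0) -> good z s -> has_table s CG3_table ->
  ~ upper_cluster_algebra z (ZPplus z) s `<=` cluster_algebra z (ZPplus z) s.
Proof.
move=> char0 gs st.
have [a1 [a2 [a3 [b1 [b2 [b3 [c1 [c2 [c3 [indw sx]]]]]]]]]] := has_entries gs.
pose w (i : 'I_9) := nth 0 [:: a1; a2; a3; b1; b2; b3; c1; c2; c3] i.
pose y := a3 * c2 - a2 * c3; pose x := a2 * b3 - a3 * b2.
pose v := x * (b2 * c3 - b3 * c2) - y ^+ 2.
pose d1 := (a2 * c1 - a1 * c2) * (a2 * c3 - a3 * c2) + (a1 * b2 - a2 * b1) * (b2 * c3 - b3 * c2).
pose d2 := a1 * (b2 * c3 - b3 * c2) - a2 * (b1 * c3 - b3 * c1) + a3 * (b1 * c2 - b2 * c1).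
pose d3 := a1 * c3 - a2 * c2.
have [ks [gt tt tx]] : reaches z s CG3_seed_table [:: c3; y; x; v; c2; a2; d1; d2; d3].
  have r0 : reaches z s CG3_table (CG3_cluster [:: a1; a2; a3; b1; b2; b3; c1; c2; c3]).
    by exists [::].
  have r2 : reaches z s (table_mutation 1 CG3_table)
      [:: c3; y; x; a1 * b2 - a2 * b1; a3; a2; d1; d2; d3].
    apply: (@reaches_step _ _ _ _ _ 1 [:: 1; 0; 1; 1; -1; 0; -1; 0; 0] y _ _ isT r0) => //.
    by rewrite /= /y; ring.
  have r24 : reaches z s (table_mutation 3 (table_mutation 1 CG3_table))
      [:: c3; y; x; v; a3; a2; d1; d2; d3].
    apply: (@reaches_step _ _ _ _ _ 3 [:: 0; 1; -1; 0; 0; 1; -1; 1; 0] v _ _ isT r2) => //.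
    by rewrite /= /v /y /x /d1 /d2; ring.
  apply: (@reaches_step _ _ _ _ _ 4 [:: 1; -1; 0; 0; 0; 1; 0; 0; 0] c2 _ _ isT r24) => //.
  by rewrite /= /y; ring.
pose t := foldl (mutation z) s ks; rewrite -/t in gt tt tx.
have walkE ls : foldl (mutation z) t ls = foldl (mutation z) s (ks ++ ls) by rewrite foldl_cat.
have Lw ls i : laurent_seed z (foldl (mutation z) t ls) (w i).
  rewrite walkE -laurent_subalg_seed.
  have /(cluster_sub_upper gs) := cluster_algebra_entries gs st sx i.
  by move/upper_cluster_algebraP; apply.
have Sx ls (i : 'I_6) : polyring w predT (cluster (foldl (mutation z) t ls) i).
  rewrite walkE; apply: (upper_bound_polynomial gs st sx indw).
    exact: (@laurent_phenomenon_plus _ _ _ z s _ [::] i gs).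
  by move=> k; apply: (@laurent_phenomenon_plus _ _ _ z s _ [:: k] i gs).
have two_neq0 : 2 != 0 :> F by apply/eqP => e; have := char0 2 e.
have Ub2 : upper_cluster_algebra z (ZPplus z) s b2.
  apply/upper_cluster_algebraP => ls; rewrite laurent_subalg_plus.
  have -> : foldl (mutation z) s ls = foldl (mutation z) t (rev ks ++ ls).
    by rewrite walkE catA foldl_cat foldl_cat walk_rev.
  apply: laurent_plus_walk => //; last by move=> ls'; apply: (Lw ls' (@Ordinal 9 4 isT)).
  have sP : subring (laurent_plus z t) by apply: lauring_subring.
  have X1 k : laurent_plus z t (nth 0 [:: c3; y; x; v; c2; a2; d1; d2; d3] (row_of k)).
    by rewrite -(tx.2 k); apply: lauring_var.
  have X2 (k : 'I_6) : laurent_plus z t (nth 0 [:: c3; y; x; v; c2; a2; d1; d2; d3] k)^-1.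
    by rewrite -[k : nat]/(row_of (inl k)) -(tx.2 (inl k)); apply: lauring_inv.
  have y0 : y != 0 by rewrite -[y](tx.2 (inl (@Ordinal 6 1 isT))); apply: good_neq0 gt.
  have x0 : x != 0 by rewrite -[x](tx.2 (inl (@Ordinal 6 2 isT))); apply: good_neq0 gt.
  have -> : b2 = - (v * a2 + x * x * c2 + y * y * a2) * (y^-1 * x^-1).
    have -> : - (v * a2 + x * x * c2 + y * y * a2) = b2 * (y * x) by rewrite /v /y /x; ring.
    by rewrite -invfM mulfK // mulf_neq0.
  have Py : laurent_plus z t y := X1 (inl (@Ordinal 6 1 isT)).
  have Px : laurent_plus z t x := X1 (inl (@Ordinal 6 2 isT)).
  have Pv : laurent_plus z t v := X1 (inl (@Ordinal 6 3 isT)).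
  have Pc : laurent_plus z t c2 := X1 (inl (@Ordinal 6 4 isT)).
  have Pa : laurent_plus z t a2 := X1 (inl (@Ordinal 6 5 isT)).
  have Py' : laurent_plus z t y^-1 := X2 (@Ordinal 6 1 isT).
  have Px' : laurent_plus z t x^-1 := X2 (@Ordinal 6 2 isT).
  apply: (subringM sP); last exact: (subringM sP).
  apply: (subringN sP); apply: (subringD sP); last by do 2?apply: (subringM sP).
  by apply: (subringD sP); do 2?apply: (subringM sP).
move=> /(_ b2 Ub2); rewrite /cluster_algebra -(cluster_variables_walk ks gs).
exact: (centre_notin_cluster_algebra gt tt tx indw char0 (Lw [::]) two_neq0 Sx).
Qed.

Theorem proposition4p1 (F : fieldType) (z : 'I_3 -> F) (x : 'I_6 -> F)
    (hz : embeds_ZP z) (hx : freely_generates z x) :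
  cluster_algebra z (ZP z) (quiver_seed QCG3 x)
    = upper_cluster_algebra z (ZP z) (quiver_seed QCG3 x)
  /\ cluster_algebra z (ZPplus z) (quiver_seed QCG3 x)
       `<` upper_cluster_algebra z (ZPplus z) (quiver_seed QCG3 x).
Proof.
have gs := CG3_good hz hx; have st := CG3_has_table x.
split.
  apply/seteqP; split; first exact: cluster_sub_upper.
  exact: CG3_upper_sub_cluster.
split; first exact: cluster_sub_upper_plus.
exact: (CG3_upper_not_sub_cluster (embeds_ZP_char0 hz) gs st).
Qed.
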